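(* Let $\mathcal{A}$ be a finite linearly ordered alphabet with minimal element $\underline{a}$ and maximal element $\bar{a}$, and let $P$ be a weakly monotone transition matrix over a lattice $\Lambda$ such that $(\Lambda,\mathrm{Exp}(1))$ is causal. Then for $\mathrm{IPS}(P)$ the following holds: 1. For any increasing event $A\subseteq\mathcal{A}^\Lambda$, the function $t\mapsto\delta_aP_t(A)$ is non-increasing for $a=\bar{a}$ and non-decreasing for $a=\underline{a}$. 2. The weak limits of $\delta_aP_t$ as $t\to\infty$, for $a\in\{\underline{a},\bar{a}\}$, exist; denote them by $\mu_{\underline{a}}$ and $\mu_{\bar{a}}$ respectively. 3. Any invariant measure stochastically dominates $\mu_{\underline{a}}$ and is stochastically dominated by $\mu_{\bar{a}}$. 4. The measures $\mu_{\underline{a}}$ and $\mu_{\bar{a}}$ coincide if and only if $\mathrm{IPS}(P)$ is ergodic.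
   Context: A lattice is a countable set $\Lambda$ of sites in which each $j\in\Lambda$ has a neighbourhood $\mathcal{N}_j\subseteq\Lambda$ with $j\in\mathcal{N}_j$. A transition matrix $P$ is a collection of probability distributions $P_j(\cdot\,|\,\sigma)$ on $\mathcal{A}$, for $j\in\Lambda$, $\sigma\in\mathcal{A}^{\mathcal{N}_j}$; for $\zeta\in\mathcal{A}^\Lambda$ write $P_j(\cdot\,|\,\zeta):=P_j(\cdot\,|\,\zeta|_{\mathcal{N}_j})$ and $P_j(a_+\,|\,\zeta):=\sum_{b\ge a}P_j(b\,|\,\zeta)$. Configurations are ordered coordinatewise. $P$ is weakly monotone if for all $a\in\mathcal{A}$, $j\in\Lambda$ and all $\zeta\ge\xi$ such that either $\zeta(j),\xi(j)\ge a$ or $\zeta(j),\xi(j)<a$, one has $P_j(a_+\,|\,\zeta)\ge P_j(a_+\,|\,\xi)$. $\mathrm{IPS}(P)$: every site has an independent rate-$1$ exponential clock; whenever the clock at $j$ rings at time $\tau$, the state at $j$ is resampled from $P_j(\cdot\,|\,\zeta_{\tau^-})$ (left limit) independently of everything else, and states do not change otherwise. $(\Lambda,\mathrm{Exp}(1))$ is causal if for every $(t,j)$ the backward exploration of the space-time points that can influence $(t,j)$ (start with $K_0=\{j\}$ at time $t$; going backward in time, whenever a clock rings at a site $i$ of the current set $K_n$, replace $K_n$ by $K_n\cup\mathcal{N}_i$) almost surely reaches time $0$ after finitely many steps; this makes the process well defined and forces the $\mathcal{N}_j$ to be finite. $\mu P_t$ is the law of $\zeta_t$ when $\zeta_0\sim\mu$;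 $\delta_a$ is the Dirac measure at the configuration constantly equal to $a$. An event $A$ (measurable subset of $\mathcal{A}^\Lambda$) is increasing if $\xi\in A$ and $\zeta\ge\xi$ imply $\zeta\in A$. $\mu$ stochastically dominates $\nu$ if $\mu(A)\ge\nu(A)$ for all increasing events $A$. $\mu$ is invariant if $\mu P_t=\mu$ for all $t\ge0$; it is attractive if $\nu P_t\Rightarrow\mu$ as $t\to\infty$ for every distribution $\nu$; the IPS is ergodic if it has an attractive invariant measure. *)

(* Defs.v *)
From HB Require Import structures.
From mathcomp Require Import all_boot all_order all_algebra finmap.
From mathcomp Require Import all_classical all_reals all_analysis.

Set Implicit Arguments.
Unset Strict Implicit.
Unset Printing Implicit Defensive.

Import Order.TTheory GRing.Theory Num.Theory.
Import numFieldNormedType.Exports.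

Local Open Scope classical_set_scope.
Local Open Scope ring_scope.

(* finTBOrderType: a finite total order with least element \bot and greatest
   element \top. *)
Definition states (L : countType) dA (A : finTBOrderType dA) : Type := L -> A.

Section states_instances.
Context (L : countType) dA (A : finTBOrderType dA).
HB.instance Definition _ := Choice.copy (states L A) (L -> A).
HB.instance Definition _ := isPointed.Build (states L A) (fun=> \bot%O).
End states_instances.

Definition cylinders (L : countType) dA (A : finTBOrderType dA) :
    set (set (states L A)) :=
  [set B | exists j a, B = [set x | x j = a]].

(* A^L with the product sigma-algebra *)
Definition config (L : countType) dA (A : finTBOrderType dA) :
    measurableType _ :=
  g_sigma_algebraType (@cylinders L dA A).

Section configurations.
Context (R : realType) (L : countType) dA (A : finTBOrderType dA).
Implicit Types (mu nu : probability (config L A) R).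

Definition const_config (a : A) : config L A := fun=> a.

Definition config_le (xi zeta : config L A) :=
  forall i, (xi i <= zeta i)%O.

Definition increasing_event (B : set (config L A)) :=
  measurable B /\ forall xi zeta, B xi -> config_le xi zeta -> B zeta.

Definition stoch_dominates mu nu :=
  forall B, increasing_event B -> (nu B <= mu B)%E.

(* Functions in `probability` are also defined (arbitrarily) on non-measurable
   sets, so Leibniz equality would be too strong. *)
Definition same_measure mu nu :=
  forall B, measurable B -> mu B = nu B.

(* weak convergence, for the product of the discrete topologies on A^L *)
Definition weakly_converges (nu : R -> probability (config L A) R) mu :=
  forall f : {ptws L -> discrete_topology A} -> R,
    continuous f -> bounded_fun f ->
    (\int[nu t]_x (f x)%:E)%E @[t --> +oo] --> (\int[mu]_x (f x)%:E)%E.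

End configurations.

Definition is_lattice (L : countType) (N : L -> set L) := forall j, N j j.

Section transition_matrices.
Context (R : realType) (L : countType) (N : L -> set L).
Context dA (A : finTBOrderType dA).
Variable P : forall j : L, (N j -> A) -> A -> R.

Definition is_transition_matrix :=
  forall j sigma, (forall a, 0 <= @P j sigma a) /\ \sum_(a : A) @P j sigma a = 1.

(* P_j( . | zeta) for a configuration zeta on all of L *)
Definition trans (j : L) (zeta : config L A) : A -> R :=
  P (fun i : N j => zeta (val i)).

Definition trans_up (j : L) (zeta : config L A) (a : A) : R :=
  \sum_(b : A | (a <= b)%O) trans j zeta b.

Definition weakly_monotone :=
  forall (a : A) (j : L) (zeta xi : config L A), config_le xi zeta ->
    ((a <= zeta j)%O /\ (a <= xi j)%O) \/ ((zeta j < a)%O /\ (xi j < a)%O) ->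
    trans_up j xi a <= trans_up j zeta a.

(* Inverse transform sampling: if u is uniform on [0, 1], this is distributed
   according to P_j( . | zeta). *)
Definition resample (j : L) (zeta : config L A) (u : R) : A :=
  [arg min_(a < \top | u <= \sum_(b : A | (b <= a)%O) trans j zeta b) a]%O.

(* z is the trajectory started from x when the clock at j rings at the times
   tau j 0 < tau j 1 < ..., using u j k for the resampling at time tau j k;
   xi is the left limit of z at that time. *)
Definition evolves (tau u : L -> nat -> R) (x : config L A)
    (z : R -> config L A) :=
  [/\ z 0 = x,
      forall j k, exists xi : config L A,
        (forall i, \forall s \near (tau j k)^'-, z s i = xi i) /\
        z (tau j k) j = resample j xi (u j k)
    & forall j (s t : R), 0 <= s -> s <= t ->
        (forall k, ~~ (s < tau j k <= t)) -> z t j = z s j].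

End transition_matrices.

(* Backward exploration from the set K at time t: the latest ring strictly
   before t at a site i of K enlarges K by N i. The predicate is inductive, so
   it holds iff time 0 is reached after finitely many steps. (At a fixed time
   there is almost surely no ring, so strictness is immaterial.) If K is
   infinite there may be no latest ring; then time 0 is not reached. *)
Inductive reaches0 (R : realType) (L : countType) (N : L -> set L)
    (tau : L -> nat -> R) : R -> set L -> Prop :=
| reaches0_stop t K :
    (forall i k, K i -> ~~ (0 < tau i k < t)) -> reaches0 N tau t K
| reaches0_step t K i k :
    K i -> 0 < tau i k < t ->
    (forall i' k', K i' -> 0 < tau i' k' < t -> tau i' k' <= tau i k) ->
    reaches0 N tau (tau i k) (K `|` N i) -> reaches0 N tau t K.

Section driving_noise.
Context (R : realType) d (T : measurableType d) (Pr : probability T R).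

Definition mutually_independent (I : choiceType) (X : I -> {RV Pr >-> R}) :=
  forall (J : {fset I}) (B : I -> set R), (forall i, measurable (B i)) ->
    Pr (\bigcap_(i in [set` J]) X i @^-1` B i) =
    (\prod_(i <- J) Pr (X i @^-1` B i))%E.

Variables (L : countType).

(* E j k: waiting time between the (k-1)-st and k-th ring at j.
   U j k: randomness used to resample the state of j at the k-th ring. *)
Variables (E U : L -> nat -> {RV Pr >-> R}).

Definition driving_noise :=
  [/\ forall j k B, measurable B ->
        distribution Pr (E j k) B = exponential_prob 1 B,
      forall j k B, measurable B ->
        distribution Pr (U j k) B = uniform_prob (@ltr01 R) B
    & mutually_independent (fun i : (L * nat) + (L * nat) =>
        match i with inl (j, k) => E j k | inr (j, k) => U j k end)].

Definition ring_time (w : T) (j : L) (k : nat) : R :=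
  \sum_(i < k.+1) E j i w.

Definition causal (N : L -> set L) :=
  forall (t : R) (j : L), 0 <= t ->
    {ae Pr, forall w, reaches0 N (ring_time w) t [set j]}.

Context (N : L -> set L) dA (A : finTBOrderType dA).
Variable P : forall j : L, (N j -> A) -> A -> R.

(* IPS(P) with initial law mu, realized on (config * T, mu \x Pr): the first
   coordinate is the initial configuration, which is independent of the
   clocks and of the resampling. *)
Definition is_IPS (mu : probability (config L A) R)
    (zeta : R -> config L A * T -> config L A) :=
  (forall t, 0 <= t -> measurable_fun [set: config L A * T] (zeta t)) /\
  {ae (mu \x Pr)%E, forall w,
    evolves P (ring_time w.2) (fun j k => U j k w.2) w.1 (fun t => zeta t w)}.

(* mu P_t, the law at time t of IPS(P) with initial law mu. In the causal case
   such a law exists and is unique (on measurable sets); `get` picks it. *)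
Definition evolve (mu : probability (config L A) R) (t : R) :
    probability (config L A) R :=
  get [set nu : probability (config L A) R |
    exists zeta, is_IPS mu zeta /\
      forall B, measurable B -> nu B = (mu \x Pr)%E (zeta t @^-1` B)].

Definition invariant_law (mu : probability (config L A) R) :=
  forall t, 0 <= t -> same_measure (evolve mu t) mu.

Definition attractive_law (mu : probability (config L A) R) :=
  forall nu, weakly_converges (evolve nu) mu.

Definition ergodic := exists mu, invariant_law mu /\ attractive_law mu.

(* \delta_a P_t *)
Definition evolve_const (a : A) (t : R) : probability (config L A) R :=
  evolve (\d_(const_config a : config L A)) t.

End driving_noise.

(* Main.v *)
Require Import Defs.
From HB Require Import structures.
From mathcomp Require Import all_boot all_order all_algebra finmap.
From mathcomp Require Import all_classical all_reals all_analysis measurable_realfun.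
From mathcomp Require Import ring lra.

Set Implicit Arguments.
Unset Strict Implicit.
Unset Printing Implicit Defensive.

Import Order.TTheory GRing.Theory Num.Theory.
Import numFieldNormedType.Exports.

Local Open Scope classical_set_scope.
Local Open Scope ring_scope.

(** The process is compared with itself, started from the extreme configurations, by means of its
    semigroup Q_t f (x), the expectation of f at time t from the initial configuration x. Three
    properties of this semigroup carry the proof: it is monotone (mean_state_monotone), it satisfies
    Q_(s + t) = Q_s Q_t (mean_state_add), and it has the Feller property
    (mean_state_window_continuous).

    Monotonicity is the place where weak monotonicity of the transition matrix is used. A single
    update need not preserve the order, because two ordered configurations may lie on different
    sides of a threshold. In continuous time, however, an update can be averaged with doing
    nothing: if S is the sum of the updates of m sites, then
    exp(t (S - m)) = exp(t ((S + m) - 2 m)), and S + m is a sum of averaged updates, each of which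
    is monotone (site_step_lazy_le). Thus finitely many sites have a monotone semigroup
    (semigroup_monotone).

    This concerns operators, whereas the process is given by its trajectories. The link is the
    decomposition at the first ring (integral_first_ring): since exponential clocks have no memory,
    the noise that is seen after the first ring is a copy of the original noise, independent of
    this ring. By induction the expectation on the event of exactly n rings is the n-th term of the
    exponential series (integral_rings_value), and summation over n shows that the system in which
    only finitely many sites are updated has the semigroup above (law_semigroup).

    Causality then takes the limit to infinitely many sites. The backward exploration from a site
    almost surely meets finitely many rings only, and by induction along it the letter at this site
    becomes constant as the volume grows, and depends on finitely many initial letters
    (reaches0_settled). For this the neighbourhoods have to be finite, which is itself a consequence
    of causality (finite_neighbourhood). The same induction shows that the process is unique
    (evolves_full_state), so that the law chosen in the definition of evolve is the one constructed
    here (evolve_spec). Dominated convergence transports the semigroup properties to the limit.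

    Now Q_(s + t) 1_B = Q_s Q_t 1_B and Q_t 1_B is at most its value at the top configuration when B
    is increasing, whence the first part for local increasing events, that is, events which depend on
    finitely many sites. Compactness of the space of configurations gives the rest. Domination on
    local increasing events implies domination on all increasing events (local_dominates).
    Monotone limits on local increasing events extend to all local events, where they form a
    finitely additive function, hence, by compactness and Caratheodory's theorem, a probability
    measure (local_limit). Convergence on local events is weak convergence (local_cvg_weakly). An
    invariant law, and more generally any law at time t, lies between the laws started from the two
    extreme configurations (fine_law_between); this bounds the invariant laws by the two limits and
    makes a common limit attractive. Finally the Feller property makes the limit invariant
    (extreme_invariant). *)

(** * Measure-theoretic preliminaries *)

Section density.
Local Open Scope ereal_scope.
Context d (X : measurableType d) (R : realType).
Context (m mu : {measure set X -> \bar R}) (g : X -> R).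
Hypotheses (mg : measurable_fun setT g) (g0 : forall x, (0 <= g x)%R).
Hypothesis mE : forall A, measurable A -> m A = \int[mu]_(x in A) (g x)%:E.

Import HBNNSimple.

Let density_indic (E : set X) : measurable E ->
  \int[m]_x (\1_E x)%:E = \int[mu]_x ((\1_E x)%:E * (g x)%:E).
Proof.
move=> mEE; rewrite integral_indic// setIT mE// integral_mkcond.
apply: eq_integral => x _; rewrite patchE indicE.
by case: ifP => xE; rewrite ?mul1e ?mul0e.
Qed.

Let meg : measurable_fun setT (EFin \o g).
Proof. exact/measurable_EFinP. Qed.

Let density_nnsfun (f : {nnsfun X >-> R}) :
  \int[m]_x (f x)%:E = \int[mu]_x ((f x)%:E * (g x)%:E).
Proof.
under eq_integral do rewrite fimfunE -fsumEFin//.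
rewrite ge0_integral_fsum//; last 2 first.
- by move=> r; exact/measurable_EFinP/measurableT_comp.
- by move=> n x _; rewrite EFinM nnfun_muleindic_ge0.
under [RHS]eq_integral.
  move=> x xD; rewrite fimfunE -fsumEFin// ge0_mule_fsuml; last first.
    by move=> r; rewrite EFinM nnfun_muleindic_ge0.
  over.
rewrite [RHS]ge0_integral_fsum//; last 2 first.
- move=> r; apply: emeasurable_funM => //.
  exact/measurable_EFinP/measurableT_comp.
- move=> n x _; apply: mule_ge0; last by rewrite lee_fin.
  by rewrite EFinM nnfun_muleindic_ge0.
apply: eq_fsbigr => r /[!inE] -[x0 _ fx0]; have r0 : (0 <= r)%R by rewrite -fx0.
under eq_integral do rewrite EFinM.
under [RHS]eq_integral do rewrite EFinM -muleA.
rewrite !ge0_integralZl//; first by rewrite density_indic.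
- by apply: emeasurable_funM => //; exact/measurable_EFinP.
- by move=> x _; rewrite mule_ge0// lee_fin.
- exact/measurable_EFinP.
Qed.

(** As for any monotone approximation argument: the identity holds for simple functions,
    which increase to f. *)
Lemma ge0_integral_density (f : X -> \bar R) :
  measurable_fun setT f -> (forall x, 0 <= f x) ->
  \int[m]_x f x = \int[mu]_x (f x * (g x)%:E).
Proof.
move=> mf f0; pose f_ := nnsfun_approx measurableT mf.
transitivity (lim (\int[m]_x (f_ n x)%:E @[n --> \oo])).
  rewrite -monotone_convergence//=.
  - apply: eq_integral => ? /[!inE] xD; apply/esym/cvg_lim => //=.
    exact: cvg_nnsfun_approx.
  - by move=> n; exact/measurable_EFinP/measurable_funTS.
  - by move=> n ? _; rewrite lee_fin.
  - by move=> ? _ ? ? mn; rewrite lee_fin; exact/lefP/nd_nnsfun_approx.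
rewrite [RHS](_ : _ = lim (\int[mu]_x ((f_ n x)%:E * (g x)%:E) @[n --> \oo])).
  by apply: congr_lim; apply/funext => n /=; exact: density_nnsfun.
rewrite -monotone_convergence//=.
- apply: eq_integral => x _; apply/esym/cvg_lim => //.
  by apply: cvgeZr => //; exact: cvg_nnsfun_approx.
- move=> n; apply: emeasurable_funM => //.
  exact/measurable_EFinP/measurable_funTS.
- by move=> n ? _; rewrite mule_ge0// lee_fin.
- move=> ? _ ? ? mn; rewrite lee_wpmul2r// lee_fin//.
  exact/lefP/nd_nnsfun_approx.
Qed.

End density.

Lemma ge0_integral_mrestr d (X : measurableType d) (R : realType)
  (m : {measure set X -> \bar R}) (D : set X) (mD : measurable D)
  (f : X -> \bar R) : measurable_fun setT f -> (forall x, 0 <= f x)%E ->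
  (\int[mrestr m mD]_x f x = \int[m]_(x in D) f x)%E.
Proof.
move=> mf f0; rewrite (@ge0_integral_density _ _ _ _ m (\1_D))//; last first.
- by move=> A mA; rewrite integral_indic// setIC.
rewrite [RHS]integral_mkcond; apply: eq_integral => x _.
by rewrite patchE indicE; case: ifP => _; rewrite ?mule1 ?mule0.
Qed.

Lemma product_probability1E d1 d2 (X : measurableType d1) (Y : measurableType d2)
  (R : realType) (P : probability X R) (Q : probability Y R) (A : set X) (B : set Y) :
  measurable A -> measurable B -> (P \x Q)%E (A `*` B) = (P A * Q B)%E.
Proof. by move=> mA mB; exact: product_measure1E. Qed.

(** * Infinite products of probability laws *)

Definition coords (R : realType) (I : choiceType) : Type := I -> R.

HB.instance Definition _ (R : realType) (I : choiceType) :=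
  Choice.copy (coords R I) (I -> R).
HB.instance Definition _ (R : realType) (I : choiceType) :=
  isPointed.Build (coords R I) (fun=> 0).

Definition box (R : realType) (I : choiceType) (J : {fset I}) (B : I -> set R) :
  set (coords R I) := [set w | forall i, i \in J -> B i (w i)].

Definition boxes (R : realType) (I : choiceType) : set (set (coords R I)) :=
  [set C | exists J B, (forall i : I, measurable (B i)) /\ C = box J B].

Definition real_product (R : realType) (I : choiceType) : measurableType _ :=
  g_sigma_algebraType (@boxes R I).

Section product_space.
Context (R : realType) (I : choiceType).
Local Notation Om := (real_product R I).

Lemma measurable_box (J : {fset I}) (B : I -> set R) :
  (forall i, measurable (B i)) -> measurable (box J B : set Om).
Proof. by move=> mB; apply: sub_sigma_algebra; exists J, B. Qed.

Lemma measurable_coord (i : I) : measurable_fun setT (fun w : Om => w i : R).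
Proof.
move=> _ B mB; rewrite setTI.
have -> : (fun w : Om => w i) @^-1` B = box [fset i]%fset (fun=> B).
  apply/seteqP; split => w /=; first by move=> Bw j; rewrite inE => /eqP ->.
  by apply; rewrite inE.
exact: measurable_box.
Qed.

Lemma measurable_fun_real_product d (X : measurableType d) (f : X -> Om) :
  (forall i, measurable_fun setT (fun x => f x i : R)) -> measurable_fun setT f.
Proof.
move=> mf; apply: (@measurability _ _ X Om setT f (@boxes R I) erefl).
move=> _ [_ [J [B [mB ->]]] <-]; rewrite setTI.
have -> : f @^-1` box J B = \bigcap_(i in [set` J]) ((fun x => f x i) @^-1` B i).
  by apply/seteqP; split => x.
apply: fin_bigcap_measurable => // i _.
by rewrite -[X in measurable X]setTI; exact: mf.
Qed.

Lemma setI_boxes : setI_closed (@boxes R I).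
Proof.
move=> _ _ [J [B [mB ->]]] [K [C [mC ->]]].
exists (J `|` K)%fset, (fun i => (if i \in J then B i else setT) `&`
   (if i \in K then C i else setT)); split.
  by move=> i; apply: measurableI; case: ifP.
apply/seteqP; split => [w [wB wC] i|w wBC].
  by rewrite inE => _; split; case: ifPn => // *; [exact: wB | exact: wC].
split => i iJ.
  have [] := wBC i; first by rewrite inE iJ.
  by rewrite iJ.
have [] := wBC i; first by rewrite inE iJ orbT.
by rewrite iJ.
Qed.

Lemma box_measure_unique (m1 m2 : {measure set Om -> \bar R}) :
  (forall J B, (forall i, measurable (B i)) -> m1 (box J B) = m2 (box J B)) ->
  (m1 setT < +oo)%E -> forall A, measurable A -> m1 A = m2 A.
Proof.
move=> m12 m1oo; apply: (@measure_unique _ _ Om (@boxes R I) (fun=> setT)) => //.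
- exact: setI_boxes.
- move=> _; exists fset0, (fun=> setT); split => //.
  by apply/seteqP; split.
- by rewrite bigcup_const.
- by move=> _ [J [B [mB ->]]]; exact: m12.
Qed.

Context (nu : I -> probability R R) (M : probability Om R).

Definition product_law := forall (J : {fset I}) (B : I -> set R),
  (forall i, measurable (B i)) -> M (box J B) = (\prod_(i <- J) nu i (B i))%E.

Definition set_coord (c : I) (w : Om) (s : R) : Om := fun i => if i == c then s else w i.

Lemma measurable_set_coord c d (X : measurableType d) (f : X -> Om) (g : X -> R) :
  measurable_fun setT f -> measurable_fun setT g ->
  measurable_fun setT (fun x => set_coord c (f x) (g x)).
Proof.
move=> mf mg; apply: measurable_fun_real_product => i; rewrite /set_coord.
by case: (i == c) => //; exact: (measurableT_comp (measurable_coord i)).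
Qed.

Hypothesis ML : product_law.

(** Redrawing one coordinate independently leaves a product law unchanged. This is how a
    single waiting time is singled out and integrated first. *)
Lemma integral_resample_coord (c : I) (G : Om -> \bar R) :
  measurable_fun setT G -> (forall w, 0 <= G w)%E ->
  (\int[M]_w G w = \int[nu c]_s \int[M]_w G (set_coord c w s))%E.
Proof.
move=> mG G0; pose phi (z : R * Om) := set_coord c z.2 z.1.
have mphi : measurable_fun setT phi.
  by apply: measurable_set_coord; [exact: measurable_snd|exact: measurable_fst].
transitivity (\int[pushforward (nu c \x M)%E phi]_w G w)%E.
  apply: eq_measure_integral => A mA _; apply: box_measure_unique => //; last first.
    by rewrite (le_lt_trans (probability_le1 _ _)) ?ltry.
  move=> J B mB; transitivity (\prod_(i <- J) nu i (B i))%E; first exact: ML.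
  rewrite /= /pushforward; apply/esym.
  have -> : phi @^-1` box J B =
      (if c \in J then B c else setT) `*` box (J `\ c)%fset B.
    apply/seteqP; split => [[s w] /= h|[s w] /= [h1 h2] i iJ].
      split=> /=.
        by case: ifPn => // cJ; have := h _ cJ; rewrite /phi /set_coord /= eqxx.
      move=> i; rewrite !inE => /andP[ic iJ]; have := h _ iJ.
      by rewrite /phi /set_coord /= (negbTE ic).
    rewrite /phi /set_coord /=; case: eqP => [ic|/eqP ic].
      by move: h1; rewrite -ic iJ.
    by apply: h2; rewrite !inE ic.
  rewrite product_probability1E; last 2 first.
  - by case: ifP.
  - exact: measurable_box.
  rewrite ML//.
  case: ifPn => cJ; first by rewrite [RHS](big_fsetD1 c).
  by rewrite probability_setT mul1e mem_fsetD1.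
rewrite ge0_integral_pushforward// preimage_setT fubini_tonelli1//.
  exact: measurableT_comp.
by move=> z; exact: G0.
Qed.

(** The memoryless property for a family of independent coordinates: given that those in D
    all exceed s, an event of probability q ^+ #|D|, their residuals are again distributed as
    the original coordinates. The injection sigma re-indexes the others, so that the statement
    can forget the coordinates which the first ring has used up. *)
Lemma integral_memoryless (D : {fset I}) (sigma : I -> I) (s : R) (q : {nonneg R})
  (h : Om -> \bar R) :
  injective sigma -> (forall i, i \in D -> sigma i = i) ->
  (forall i B, measurable B -> nu (sigma i) B = nu i B) ->
  (forall i B, i \in D -> measurable B ->
     nu i [set x | s < x /\ B (x - s)] = (q%:num%:E * nu i B)%E) ->
  measurable_fun setT h -> (forall w, 0 <= h w)%E ->
  (\int[M]_(w in [set w : Om | forall i, i \in D -> (s < w i)%R])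
     h (fun i => if i \in D then w i - s else w (sigma i))%R
   = (q%:num ^+ #|` D|)%:E * \int[M]_w h w)%E.
Proof.
move=> sigmaI sigmaD nu_sigma mem mh h0.
pose th (w : Om) : Om := fun i => if i \in D then w i - s else w (sigma i).
have mth : measurable_fun setT th.
  apply: measurable_fun_real_product => i; rewrite /th; case: (i \in D).
    by apply: measurable_funB => //; exact: measurable_coord.
  exact: measurable_coord.
set Ds := [set w : Om | _].
have mDs : measurable Ds.
  have -> : Ds = box D (fun=> `]s, +oo[%classic).
    apply/seteqP; split => w /= h1 i /h1.
      by rewrite /= in_itv/= andbT.
    by rewrite /= in_itv/= andbT.
  by apply: measurable_box => i.
have qn0 : 0 <= q%:num ^+ #|` D| by rewrite exprn_ge0.
transitivity (\int[pushforward (mrestr M mDs) th]_w h w)%E.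
  rewrite ge0_integral_pushforward// preimage_setT.
  apply/esym/(@ge0_integral_mrestr _ _ _ _ _ _ (h \o th)) => [|w].
    exact: measurableT_comp.
  exact: h0.
rewrite -[q%:num ^+ _]/((NngNum qn0)%:num) -ge0_integral_mscale//.
apply: eq_measure_integral => A mA _; apply: box_measure_unique => //; last first.
  rewrite /= /pushforward /mrestr.
  rewrite (@le_lt_trans _ _ 1%E) ?ltry//; apply: probability_le1.
  by apply: measurableI => //; rewrite -[X in measurable X]setTI; exact: mth.
move=> J B mB; transitivity (M (th @^-1` box J B `&` Ds)) => //.
transitivity ((q%:num ^+ #|` D|)%:E * M (box J B))%E => //.
pose B' k := if k \in J then B k else setT.
have mB' k : measurable (B' k) by rewrite /B'; case: ifP.
pose C k := if k \in D then [set x | s < x /\ B' k (x - s)] else B' k.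
have mC k : measurable (C k).
  rewrite /C; case: ifP => // _.
  have ms : measurable [set x : R | s < x].
    have -> : [set x : R | s < x] = `]s, +oo[%classic by rewrite set_itvE.
    exact: measurable_itv.
  apply: measurableI; first exact: ms.
  rewrite -[X in measurable X]setTI; apply: measurable_funB => //.
pose K := (D `|` J)%fset.
(* The box is pulled back along sigma: a constraint on coordinate i becomes one on
   coordinate sigma i, and inv finds i again. *)
pose inv k := if pselect (exists i, sigma i = k) is left e then projT1 (cid e) else k.
have invK i : inv (sigma i) = i.
  rewrite /inv; case: pselect => [e|[]]; last by exists i.
  by apply: sigmaI; case: cid.
have -> : th @^-1` box J B `&` Ds = box (sigma @` K)%fset (fun k => C (inv k)).
  apply/seteqP; split => [w [h1 h2] k|w hw].
    move=> /imfsetP[i /= iK ->]; rewrite invK /C /B'.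
    have [iD|iD] := boolP (i \in D); rewrite ?(sigmaD i iD).
      split; first exact: h2.
      by case: ifPn => // iJ; have := h1 _ iJ; rewrite /th iD.
    by case: ifPn => // iJ; have := h1 _ iJ; rewrite /th (negbTE iD).
  have h' i : i \in K -> C i (w (sigma i)).
    by move=> iK; have := hw (sigma i) (in_imfset _ _ iK); rewrite invK.
  split=> [i iJ|i iD].
    have := h' i; rewrite !inE iJ orbT => /(_ isT); rewrite /C /B' iJ /th.
    by have [iD|iD] := boolP (i \in D); rewrite ?(sigmaD i iD)//; case.
  have := h' i; rewrite !inE iD => /(_ isT); rewrite /C iD (sigmaD i iD).
  by case.
have -> : box J B = box K B'.
  apply/seteqP; split => [w hw i _|w hw i iJ]; rewrite /B'.
    by case: ifPn => // /hw.
  by have := hw i; rewrite !inE iJ orbT /B' iJ; exact.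
rewrite !ML// big_imfset//=; last by move=> i j _ _; exact: sigmaI.
under eq_bigr do rewrite invK (nu_sigma _ _ (mC _)).
transitivity (\prod_(k <- K) ((if k \in D then q%:num%:E else 1) * nu k (B' k)))%E.
  apply: eq_bigr => k _; rewrite /C.
  by case: ifP => kD; rewrite ?mul1e// mem.
rewrite big_split/= -big_mkcond/= big_fset_condE/=; congr (_ * _)%E.
have -> : [fset i | i in K & i \in D]%fset = D.
  by apply/fsetP => k; rewrite !inE; case: (k \in D); rewrite ?andbF.
elim: (enum_fset D) => [|k r IH]; first by rewrite big_nil expr0.
by rewrite big_cons IH /= exprS EFinM.
Qed.

End product_space.

(** * The exponential law *)

Section exponential_law.
Context (R : realType) (nu : probability R R).
Hypothesis nuE : forall B, measurable B -> nu B = exponential_prob 1 B.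

Lemma integral_exponential_law (f : R -> \bar R) :
  measurable_fun setT f -> (forall x, 0 <= f x)%E ->
  (\int[nu]_x f x = \int[lebesgue_measure]_x (f x * (exponential_pdf 1 x)%:E))%E.
Proof.
move=> mf f0; pose idR : R -> measurableTypeR R := idfun.
have mid : measurable_fun setT idR by exact: measurable_id.
transitivity (\int[pushforward nu idR]_x f x)%E.
  by rewrite ge0_integral_pushforward.
apply: (@ge0_integral_density _ (measurableTypeR R)) => //.
- exact: measurable_exponential_pdf.
- by move=> x; exact: exponential_pdf_ge0.
Qed.

Lemma exponential_law_set1 x : nu [set x] = 0%E.
Proof. by rewrite nuE// /exponential_prob integral_set1. Qed.

Lemma exponential_law_lt0 : nu `]-oo, 0[%classic = 0%E.
Proof.
rewrite nuE// /exponential_prob integral0_eq// => x /=.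
by rewrite in_itv/= => x0; rewrite lt0_exponential_pdf.
Qed.

Lemma exponential_law_le0 : nu `]-oo, 0]%classic = 0%E.
Proof.
rewrite -(@setUitv1 _ _ _ _ true)//.
rewrite measureU0//; last exact: exponential_law_set1.
exact: exponential_law_lt0.
Qed.

Lemma exponential_law_gt (y : R) : 0 <= y -> nu `]y, +oo[%classic = (expR (- y))%:E.
Proof.
rewrite le_eqVlt => /predU1P[<-|y0].
  rewrite -[X in nu X]setCK setCitvr probability_setC ?oppr0 ?expR0//.
  by rewrite exponential_law_le0 sube0.
have -> : `]y, +oo[%classic = ~` (`]-oo, 0[ `|` `[0, y])%classic :> set R.
  rewrite -itv_bndbnd_setU ?bnd_simp//; last exact: ltW.
  by rewrite setCitvl.
rewrite probability_setC; last exact: measurableU.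
set lo := `]-oo, 0[%classic; set hi := `[0, y]%classic.
have -> : (nu (lo `|` hi) = nu lo + nu hi)%E.
  apply: measureU => //; [exact: measurable_itv|exact: measurable_itv|].
  apply/seteqP; split => z //= []; rewrite /lo /hi/= !in_itv/= => + /andP[].
  by case: ltP.
rewrite exponential_law_lt0 add0e nuE; last exact: measurable_itv.
rewrite exponential_prob_itv0c//.
by rewrite mulN1r -!EFinB opprB addrC subrK.
Qed.

Lemma exponential_law_memoryless (s : R) (B : set R) : 0 <= s -> measurable B ->
  nu [set x | s < x /\ B (x - s)] = ((expR (- s))%:E * nu B)%E.
Proof.
move=> s0 mB.
have ms : measurable [set x : R | s < x].
  have -> : [set x : R | s < x] = `]s, +oo[%classic by rewrite set_itvE.
  exact: measurable_itv.
have mf : measurable_fun [set: R] (fun x => x - s).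
  exact: measurable_funB.
have e0 : 0 <= expR (- s) by exact: expR_ge0.
transitivity (pushforward (mrestr nu ms) (fun x => x - s) B).
  by rewrite /pushforward /mrestr setIC.
transitivity (mscale (NngNum e0) nu B) => //.
apply: (@measure_unique _ _ R (@RGenOInfty.G R) (fun k => `](- k%:R)%R, +oo[%classic)) => //.
- exact: RGenOInfty.measurableE.
- move=> _ _ [x ->] [y ->]; exists (Num.max x y).
  by apply/seteqP; split => z /=; rewrite !in_itv/= !andbT gt_max => /andP.
- by move=> k; eexists.
- rewrite -subTset => x _; exists (Num.truncn `|x|).+1 => //=; rewrite in_itv/= andbT.
  rewrite ltrNl (le_lt_trans (ler_norm _))// normrN truncnS_gt//.
- move=> _ [x ->]; transitivity (nu `](Num.max s (x + s)), +oo[%classic).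
    congr (nu _); apply/seteqP; split => z /=; rewrite !in_itv/= !andbT gt_max.
      by case => h1 h2; rewrite h2 -ltrBrDr h1.
    by move=> /andP[-> h]; rewrite ltrBrDr h.
  transitivity ((expR (- s))%:E * nu `]x, +oo[%classic)%E; last by [].
  have [x0|x0] := leP 0 x.
    rewrite max_r ?lerDr// !exponential_law_gt// ?addr_ge0//.
    by rewrite opprD expRD mulrC EFinM.
  rewrite max_l ?gerDr ?ltW// (exponential_law_gt s0).
  suff -> : nu `]x, +oo[%classic = 1%E by rewrite mule1.
  apply/eqP; rewrite eq_le probability_le1//=.
  rewrite -[1%E](_ : nu `]0, +oo[%classic = 1%E); last first.
    by rewrite exponential_law_gt// oppr0 expR0.
  apply: le_measure; rewrite ?inE//.
  by apply: subset_itvr; rewrite bnd_simp ltW.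
- move=> k; rewrite /pushforward /mrestr/=.
  rewrite (@le_lt_trans _ _ 1%E) ?ltry//; apply: probability_le1.
  apply: measurableI => //; rewrite -[X in measurable X]setTI.
  exact: mf.
Qed.

End exponential_law.

Lemma is_derive_iterated_power (R : realType) (t : R) (n : nat) (s : R) :
  is_derive s 1 (fun s : R => - ((t - s) ^+ n.+1 / n.+1`!%:R)) ((t - s) ^+ n / n`!%:R).
Proof.
have -> : (fun s : R => - ((t - s) ^+ n.+1 / n.+1`!%:R)) =
    (- n.+1`!%:R^-1) *: ((cst t - id) ^+ n.+1) :> (R -> R).
  apply/funext => z; rewrite -[RHS]/(- n.+1`!%:R^-1 * ((cst t - id) ^+ n.+1) z).
  rewrite mulNr mulrC; congr (- (_ * _)).
  by elim: n => [|k IH]; rewrite ?expr1// exprS IH [in RHS]exprS.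
apply: is_derive_eq; rewrite /GRing.scale /=.
rewrite factS natrM.
rewrite [(cst t - id) s](_ : _ = t - s)//.
have a0 : n.+1%:R != 0 :> R by rewrite pnatr_eq0.
have b0 : n`!%:R != 0 :> R by rewrite pnatr_eq0 -lt0n fact_gt0.
move: a0 b0; move: (n.+1%:R) (n`!%:R) => a b a0 b0.
by field; rewrite a0 b0.
Qed.

Lemma integral_iterated_power (R : realType) (t : R) (n : nat) : 0 <= t ->
  (\int[lebesgue_measure]_(s in `]0%R, t[) ((t - s) ^+ n / n`!%:R)%:E
   = (t ^+ n.+1 / n.+1`!%:R)%:E)%E.
Proof.
rewrite le_eqVlt => /predU1P[<-|t0].
  by rewrite set_itvoo0 integral_set0 expr0n/= mul0r.
pose F (s : R) := - ((t - s) ^+ n.+1 / n.+1`!%:R).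
have cF : continuous F.
  move=> s; apply: differentiable_continuous; apply/derivable1_diffP.
  exact: (@ex_derive _ _ _ _ _ _ _ (is_derive_iterated_power t n s)).
transitivity (\int[lebesgue_measure]_(s in `[0%R, t]) ((t - s) ^+ n / n`!%:R)%:E)%E.
  apply/esym/integral_itv_bndoo.
  apply: measurable_funTS; apply/measurable_EFinP.
  apply: measurable_funM => //; apply: measurable_funX.
  exact: measurable_funB.
rewrite (@continuous_FTC2 _ _ F)//.
- rewrite -EFinB; congr EFin; rewrite /F subrr subr0 expr0n/= mul0r oppr0.
  by rewrite sub0r opprK.
- apply: continuous_subspaceT => s; apply: cvgM; last exact: cvg_cst.
  apply: (@continuous_comp _ _ _ (fun s => t - s) (fun y => y ^+ n)).
    by apply: cvgB; [exact: cvg_cst|exact: cvg_id].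
  exact: exprn_continuous.
- split.
  + by move=> x _; exact: (@ex_derive _ _ _ _ _ _ _ (is_derive_iterated_power t n x)).
  + by apply: cvg_at_right_filter; exact: cF.
  + by apply: cvg_at_left_filter; exact: cF.
- move=> x _; rewrite derive1E.
  exact: (@derive_val _ _ _ _ _ _ _ (is_derive_iterated_power t n x)).
Qed.

(** * Measurability in a finite alphabet *)

Definition sites (L : countType) (n : nat) : seq L := pmap (@pickle_inv L) (iota 0 n).
Arguments sites : clear implicits.

Lemma mem_sites (L : countType) n (j : L) : (j \in sites L n) = (choice.pickle j < n)%N.
Proof.
rewrite mem_pmap; apply/mapP/idP => [[k]|jn].
  rewrite mem_iota add0n => /= kn /esym E; have := @pickle_invK L k.
  by rewrite E /= => ->.
by exists (choice.pickle j); rewrite ?mem_iota// pickleK_inv.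
Qed.

Lemma sites_uniq (L : countType) n : uniq (sites L n).
Proof.
apply: (@pmap_uniq _ _ _ (@choice.pickle L)); last exact: iota_uniq.
by move=> k; have := @pickle_invK L k.
Qed.

Section alphabet.
Context (R : realType) (L : countType) dA (A : finTBOrderType dA).
Local Notation config := (config L A).

(** Measurability for the discrete sigma-algebra of the finite alphabet. *)
Definition letter_measurable d (X : measurableType d) (f : X -> A) :=
  forall a, measurable [set x | f x = a].

(** The alphabet carries no sigma-algebra; a letter that depends on finitely many measurable
    conditions has measurable level sets. *)
Lemma letter_measurable_cases d (X : measurableType d) (I : finType)
  (b : X -> I -> bool) (g : {set I} -> A) :
  (forall i, measurable [set x | b x i]) ->
  letter_measurable (fun x => g [set i | b x i]%SET).
Proof.
move=> mb a.
have -> : [set x | g [set i | b x i]%SET = a] =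
   \bigcup_(S in [set S | g S = a])
     \bigcap_(i in [set: I]) (if i \in S then [set x | b x i] else ~` [set x | b x i]).
  apply/seteqP; split => [x /= <-|x [S /= <- h]].
    exists [set i | b x i]%SET => // i _; rewrite inE.
    by case: ifPn => // /negP.
  rewrite /=; congr g; apply/setP => i; rewrite inE.
  by have := h i Logic.I; case: ifPn => _ // /negP/negbTE.
apply: fin_bigcup_measurable; first exact: finite_finset.
move=> S _; apply: fin_bigcap_measurable; first exact: finite_finset.
by move=> i _; case: ifP => // _; exact: measurableC.
Qed.

Lemma letter_measurable_comp d d' (X : measurableType d) (Y : measurableType d')
  (f : Y -> A) (h : X -> Y) :
  letter_measurable f -> measurable_fun setT h -> letter_measurable (f \o h).
Proof.
by move=> mf mh a; have := mh measurableT _ (mf a); rewrite setTI.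
Qed.

Lemma measurable_site (j : L) : letter_measurable (fun x : config => x j).
Proof. by move=> a; apply: sub_sigma_algebra; exists j, a. Qed.

Lemma measurable_fun_config d (X : measurableType d) (f : X -> config) :
  (forall j, letter_measurable (fun x => f x j)) -> measurable_fun setT f.
Proof.
move=> mf; apply: (@measurability _ _ X config setT f (@cylinders L dA A) erefl).
by move=> _ [_ [j [a ->]] <-]; rewrite setTI; exact: mf.
Qed.

Lemma measurable_agree (s : seq L) (t : seq A) :
  measurable [set x : config | map x s = t].
Proof.
elim: s t => [|j s IH] [|a t].
- by rewrite (_ : [set _ | _] = setT)//; apply/seteqP; split.
- by rewrite (_ : [set _ | _] = set0)//; apply/seteqP; split.
- by rewrite (_ : [set _ | _] = set0)//; apply/seteqP; split.
rewrite (_ : [set _ | _] = [set x : config | x j = a] `&` [set x : config | map x s = t]).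
  by apply: measurableI; [exact: measurable_site|exact: IH].
by apply/seteqP; split => [x /= [] // | x /= [-> ->]].
Qed.

Definition local_set (s : seq L) (B : set config) :=
  forall y z, map y s = map z s -> B y -> B z.

Definition local_fun (T : Type) (s : seq L) (f : config -> T) :=
  forall y z, map y s = map z s -> f y = f z.

Lemma measurable_local_set (s : seq L) (B : set config) :
  local_set s B -> measurable B.
Proof.
move=> sB.
have -> : B = \bigcup_(t in [set t : (size s).-tuple A | exists2 y, B y & map y s = t])
     [set x : config | map x s = t].
  apply/seteqP; split => [x Bx|x [t [y By yt] /= xt]].
    by exists (map_tuple x (in_tuple s)) => //=; exists x.
  by apply: (sB y) => //; rewrite yt xt.
apply: fin_bigcup_measurable; first exact: finite_finset.
by move=> t _; exact: measurable_agree.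
Qed.

Lemma measurable_local_fun d (Y : measurableType d) (s : seq L) (f : config -> Y) :
  local_fun s f -> measurable_fun setT f.
Proof.
move=> sf _ B _; rewrite setTI; apply: (@measurable_local_set s).
by move=> y z yz; rewrite /= (sf y z yz).
Qed.

End alphabet.

(** * Resampling one site *)

Section resampling.
Context (R : realType) (L : countType) (N : L -> set L).
Context dA (A : finTBOrderType dA).
Variable P : forall j : L, (N j -> A) -> A -> R.
Hypothesis PT : is_transition_matrix P.
Local Notation config := (config L A).
Implicit Types (j : L) (a b : A).

Lemma trans_ge0 j (x : config) a : 0 <= trans P j x a.
Proof. by have [h _] := PT (fun i : N j => x (val i)); exact: h. Qed.

Lemma trans_sum j (x : config) : \sum_(a : A) trans P j x a = 1.
Proof. by have [_ h] := PT (fun i : N j => x (val i)); exact: h. Qed.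

Let cum j (x : config) a := \sum_(b : A | (b <= a)%O) trans P j x b.
Let cumlt j (x : config) a := \sum_(b : A | (b < a)%O) trans P j x b.

Let cum_le j (x : config) a b : (a <= b)%O -> cum j x a <= cum j x b.
Proof.
move=> ab; rewrite /cum [leRHS](bigID (fun c => (c <= a)%O))/=.
rewrite [X in _ <= X + _](eq_bigl (fun c => (c <= a)%O)); last first.
  by move=> c; case: (leP c a) => [ca|_]; rewrite ?andbF// (le_trans ca ab).
by rewrite lerDl sumr_ge0// => c _; exact: trans_ge0.
Qed.

Let cum_lt j (x : config) a b : (a < b)%O -> cum j x a <= cumlt j x b.
Proof.
move=> ab; rewrite /cum /cumlt [leRHS](bigID (fun c => (c <= a)%O))/=.
rewrite [X in _ <= X + _](eq_bigl (fun c => (c <= a)%O)); last first.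
  by move=> c; case: (leP c a) => [ca|_]; rewrite ?andbF// (le_lt_trans ca ab).
by rewrite lerDl sumr_ge0// => c _; exact: trans_ge0.
Qed.

Let cumE j (x : config) a : cum j x a = cumlt j x a + trans P j x a.
Proof.
rewrite /cum (bigD1 a)//= addrC; congr (_ + _).
by apply: eq_bigl => b; rewrite lt_neqAle andbC.
Qed.

Let cum_top j (x : config) : cum j x \top%O = 1.
Proof.
by rewrite -(trans_sum j x); apply: eq_bigl => b; rewrite lex1.
Qed.

(** Inverse transform sampling: each letter a is selected on an interval of length P_j(a | x). *)
Lemma resample_eqP j (x : config) (u : R) a : 0 < u <= 1 ->
  resample P j x u = a <-> cumlt j x a < u <= cum j x a.
Proof.
move=> /andP[u0 u1]; rewrite /resample.
case: Order.TotalTheory.arg_minP => [|c uc cmin].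
  by rewrite -/(cum j x \top%O) cum_top.
rewrite -/(cum j x c) in uc; split => [<-|/andP[au ua]].
  rewrite uc andbT ltNge; apply/negP => uc'.
  have [c0|c0] := eqVneq c \bot%O.
    move: uc'; rewrite /cumlt big1 ?leNgt ?u0// => b; rewrite c0.
    by rewrite ltNge le0x.
  (* the predecessor of c; the minimality of c bounds its cumulative sum from above *)
  pose m := [arg max_(b > \bot | (b < c)%O) b]%O.
  have := cmin m; rewrite /m; case: Order.TotalTheory.arg_maxP => [|b bc bmax].
    by rewrite lt0x.
  move=> /(_ _)/wrap[]; last by rewrite leNgt bc.
  rewrite -/(cum j x b); suff -> : cum j x b = cumlt j x c by [].
  apply: eq_bigl => b'; apply/idP/idP => [b'b|/bmax//].
  exact: le_lt_trans b'b bc.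
apply/eqP; rewrite eq_le cmin//= leNgt; apply/negP => ac.
have := le_trans uc (cum_lt j x ac).
by rewrite leNgt au.
Qed.

Lemma uniform_law_itv (nu : probability R R) (l r : R) :
  (forall B, measurable B -> nu B = uniform_prob (@ltr01 R) B) ->
  0 <= l -> l <= r -> r <= 1 -> nu `]l, r]%classic = (r - l)%:E.
Proof.
move=> nuE l0 lr r1; rewrite nuE; last exact: measurable_itv.
rewrite /uniform_prob (eq_integral (fun=> 1%E)); last first.
  move=> u /[!inE]/=; rewrite in_itv/= => /andP[lu ur].
  by rewrite /uniform_pdf (le_trans l0 (ltW lu)) (le_trans ur r1)/= subr0 invr1.
rewrite integral_cst//= mul1e lebesgue_measure_itv/= lte_fin.
move: lr; rewrite le_eqVlt => /predU1P[->|->//].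
by rewrite ltxx subrr.
Qed.

Lemma letter_measurable_resample_local d (X : measurableType d) j
    (z : X -> config) (u : X -> R) :
  (forall b, measurable_fun setT (fun x => trans P j (z x) b)) ->
  measurable_fun setT u ->
  letter_measurable (fun x => resample P j (z x) (u x)).
Proof.
move=> mz mu.
pose g (S : {set A}) := [arg min_(a < \top | a \in S) a]%O.
have -> : (fun x => resample P j (z x) (u x)) =
    (fun x => g [set a | u x <= cum j (z x) a]%SET).
  apply/funext => x; rewrite /resample /g; congr Order.arg_min.
  by apply/funext => a; rewrite inE.
apply: letter_measurable_cases => a.
have mc : measurable_fun setT (fun x => cum j (z x) a).
  rewrite /cum; under eq_fun do rewrite big_mkcond/=.
  by apply: measurable_sum => b; case: (b <= a)%O.
have := measurable_fun_ler mu mc => /(_ measurableT [set true] Logic.I).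
by rewrite setTI; congr measurable; apply/seteqP; split => x.
Qed.

Lemma resample_law (nu : probability R R) j (x : config) a :
  (forall B, measurable B -> nu B = uniform_prob (@ltr01 R) B) ->
  nu [set u | resample P j x u = a] = (trans P j x a)%:E.
Proof.
move=> nuE; set S := [set u | _].
have mS : measurable S.
  apply: (@letter_measurable_resample_local _ _ j (fun=> x) idfun); last exact: measurable_id.
  by move=> b; exact: measurable_cst.
have m01 : measurable (`]0, 1]%classic : set R) by exact: measurable_itv.
have nu01 : nu (~` `]0, 1]%classic) = 0%E.
  rewrite probability_setC// (uniform_law_itv nuE)// ?ler01// subr0.
  by rewrite subee.
rewrite -(setIT S) -(setUv (`]0, 1]%classic)) setIUr measureU; last 3 first.
- exact: measurableI.
- by apply: measurableI => //; exact: measurableC.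
- by rewrite setIACA setICr setI0.
rewrite [X in (_ + X)%E](_ : _ = 0%E) ?adde0; last first.
  apply/eqP; rewrite eq_le measure_ge0 andbT -nu01.
  by apply: le_measure; rewrite ?inE//; [apply: measurableI => //|]; exact: measurableC.
have -> : S `&` `]0, 1] = `]cumlt j x a, cum j x a]%classic.
  apply/seteqP; split => [u [Su]|u]; rewrite /= !in_itv/=.
    by move=> u01; apply/(resample_eqP j x a u01).
  move=> ua; have u01 : 0 < u <= 1.
    move/andP: ua => [au ua]; rewrite (le_trans ua) ?andbT; last first.
      by rewrite -(cum_top j x); apply: cum_le; exact: lex1.
    by apply: le_lt_trans au; rewrite sumr_ge0// => b _; exact: trans_ge0.
  by split => //; apply/(resample_eqP j x a u01).
apply: (etrans (uniform_law_itv nuE _ _ _)).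
- by rewrite sumr_ge0// => b _; exact: trans_ge0.
- by rewrite cumE lerDl trans_ge0.
- by rewrite -(cum_top j x); apply: cum_le; exact: lex1.
- by rewrite cumE addrC addKr.
Qed.

Lemma trans_local (j : L) : finite_set (N j) -> exists2 s : seq L, [set` s] = N j &
  forall y z : config, map y s = map z s -> trans P j y = trans P j z.
Proof.
move=> /finite_seqP[s sE]; exists s => // y z yz.
rewrite /trans; congr P; apply/funext => -[i iN]/=.
by move/eq_in_map : yz; apply; have := iN; rewrite inE sE.
Qed.

Lemma resample_local (j : L) (y z : config) (u : R) :
  (forall i, N j i -> y i = z i) -> resample P j y u = resample P j z u.
Proof.
move=> yz; suff E : trans P j y = trans P j z by rewrite /resample E.
rewrite /trans; congr P; apply/funext => -[i iN]/=.
by apply: yz; move: iN; rewrite inE.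
Qed.

Lemma letter_measurable_resample d (X : measurableType d) j (z : X -> config) (u : X -> R) :
  finite_set (N j) -> measurable_fun setT z -> measurable_fun setT u ->
  letter_measurable (fun x => resample P j (z x) (u x)).
Proof.
move=> /trans_local[s _ sP] mz mu; apply: letter_measurable_resample_local => // b.
apply: (measurableT_comp (f := fun z => trans P j z b)) => //.
by apply: (@measurable_local_fun _ _ _ _ _ s) => y y' /sP ->.
Qed.

End resampling.

(** * Stochastic order on the alphabet *)

(** Abel summation along the increasing enumeration of the alphabet: a weight all of whose
    upper tails are nonnegative integrates a nondecreasing function to at least its minimum
    times the total weight. *)
Lemma sum_sorted_tails (R : realType) dA (A : finTBOrderType dA) (w h : A -> R) a s :
  sorted <%O (a :: s) -> {homo h : x y / (x <= y)%O >-> x <= y} ->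
  (forall c, c \in a :: s -> 0 <= \sum_(x <- a :: s | (c <= x)%O) w x) ->
  h a * \sum_(x <- a :: s) w x <= \sum_(x <- a :: s) w x * h x.
Proof.
move=> + hm; elim: s a => [|b s IH] a; first by rewrite !big_seq1 mulrC.
move=> /= /andP[ab bs] tl.
have gea x : x \in b :: s -> (a < x)%O.
  rewrite inE => /predU1P[->//|xs]; apply: lt_trans ab _.
  by have /allP := order_path_min (@lt_trans _ A) bs; exact.
have {}IH := IH b bs.
rewrite big_cons [leRHS]big_cons mulrDr mulrC lerD2l.
have tl' c : c \in b :: s -> 0 <= \sum_(x <- b :: s | (c <= x)%O) w x.
  move=> cs; have := tl c; rewrite inE cs orbT => /(_ isT).
  by rewrite big_cons [(c <= a)%O]leNgt (gea c cs).
apply: le_trans (IH tl').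
have tb := tl' b (mem_head _ _).
suff E : \sum_(x <- b :: s | (b <= x)%O) w x = \sum_(x <- b :: s) w x.
  by rewrite ler_wpM2r -?E//; apply: hm; exact: ltW.
rewrite big_seq_cond [RHS]big_seq; apply: eq_bigl => x; rewrite inE.
case: eqVneq => [->|_]/=; first by rewrite lexx.
case xs : (x \in s) => //=.
by have /allP/(_ x xs)/ltW := order_path_min (@lt_trans _ A) bs.
Qed.

Lemma le_sum_tails (R : realType) dA (A : finTBOrderType dA) (p q h : A -> R) :
  {homo h : x y / (x <= y)%O >-> x <= y} ->
  (forall a, \sum_(b : A | (a <= b)%O) p b <= \sum_(b : A | (a <= b)%O) q b) ->
  \sum_b p b = \sum_b q b ->
  \sum_b p b * h b <= \sum_b q b * h b.
Proof.
move=> hm tl E; rewrite -subr_ge0 -sumrB.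
under eq_bigr do rewrite -mulrBl.
pose r := sort <=%O (enum A).
have big_r (F : A -> R) (Q : pred A) : \sum_(b | Q b) F b = \sum_(b <- r | Q b) F b.
  rewrite [RHS](perm_big (enum A)) ?perm_sort//= big_enum_cond.
  by apply: eq_bigl => b; rewrite inE.
have : sorted <%O r by rewrite sort_lt_sorted enum_uniq.
have r0 : forall c, c \in r -> 0 <= \sum_(x <- r | (c <= x)%O) (q x - p x).
  by move=> c _; rewrite -big_r sumrB subr_ge0.
have rs : \sum_(x <- r) (q x - p x) = 0 by rewrite -big_r sumrB E subrr.
rewrite big_r; case: (r) r0 rs => [|a s] r0 rs sr; first by rewrite big_nil.
by have := sum_sorted_tails sr hm r0; rewrite rs mulr0.
Qed.

(** * The semigroup of finitely many sites *)

Section series.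
Context (R : realType).

Lemma nneseries_expR (t : R) : 0 <= t ->
  (\sum_(n <oo) (t ^+ n / n`!%:R)%:E = (expR t)%:E)%E.
Proof.
move=> t0; rewrite expRE -EFin_lim; last first.
  rewrite /pseries/=; under eq_fun do rewrite mulrC.
  exact: is_cvg_series_exp_coeff.
apply/congr_lim/funext => n/=; rewrite /pseries/= /series/= -sumEFin//.
by under eq_bigr do rewrite mulrC.
Qed.

(** The Cauchy product of nonnegative series; both the semigroup property and the passage to
    the lazy generator are instances of it. *)
Lemma nneseries_cauchy (a : nat -> nat -> \bar R) : (forall k l, 0 <= a k l)%E ->
  (\sum_(k <oo) \sum_(l <oo) a k l
   = \sum_(n <oo) \sum_(k < n.+1) a k (n - k)%N)%E.
Proof.
move=> a0; pose b k n := if (k <= n)%N then a k (n - k)%N else 0%E.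
have b0 k n : (0 <= b k n)%E by rewrite /b; case: ifP.
transitivity (\sum_(k <oo) \sum_(n <oo) b k n)%E.
  apply: eq_eseriesr => k _.
  rewrite [RHS](@nneseries_split _ _ 0 k)// add0n.
  rewrite big_nat big1 ?add0e; last first.
    by move=> i /andP[_ ik]; rewrite /b leqNgt ik.
  rewrite -(@nneseries_addn _ (b k))//; apply: eq_eseriesr => l _.
  by rewrite /b leq_addl addnK.
rewrite nneseries_interchange//; apply: eq_eseriesr => n _.
rewrite [LHS](@nneseries_split _ _ 0 n.+1)// add0n.
rewrite [X in (_ + X)%E]eseries0 ?adde0; last first.
  by move=> k nk _; rewrite /b leqNgt nk.
by rewrite big_mkord; apply: eq_bigr => -[k kn] _ /=; rewrite /b -ltnS kn.
Qed.

(** The Poisson probability of n rings up to time t, deprived of its factor m ^+ n: that factor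
    is carried by the n-th iterate of the unnormalized generator. *)
Definition ring_weight (m t : R) (n : nat) := expR (- (m * t)) * (t ^+ n / n`!%:R).

Lemma ring_weight_ge0 m t n : 0 <= t -> 0 <= ring_weight m t n.
Proof. by move=> t0; rewrite mulr_ge0 ?expR_ge0// divr_ge0// exprn_ge0. Qed.

Lemma binomial_weights (s t : R) (n : nat) :
  \sum_(k < n.+1) (s ^+ k / k`!%:R) * (t ^+ (n - k) / (n - k)`!%:R) =
  (s + t) ^+ n / n`!%:R.
Proof.
rewrite addrC exprDn mulr_suml; apply: eq_bigr => -[k kn] _ /=.
rewrite -mulr_natl -(@bin_fact n k)// !natrM.
have c0 : 'C(n, k)%:R != 0 :> R by rewrite pnatr_eq0 -lt0n bin_gt0.
have k0 : k`!%:R != 0 :> R by rewrite pnatr_eq0 -lt0n fact_gt0.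
have n0 : (n - k)`!%:R != 0 :> R by rewrite pnatr_eq0 -lt0n fact_gt0.
by field; rewrite c0 k0 n0.
Qed.

Lemma ring_weight_conv m s t n :
  \sum_(k < n.+1) ring_weight m s k * ring_weight m t (n - k) =
  ring_weight m (s + t) n.
Proof.
rewrite /ring_weight mulrDr opprD expRD -binomial_weights mulr_sumr.
by apply: eq_bigr => k _; rewrite mulrACA.
Qed.

Lemma ring_weight_total (m t : R) : 0 <= m -> 0 <= t ->
  (\sum_(n <oo) (ring_weight m t n * m ^+ n)%:E = 1)%E.
Proof.
move=> m0 t0.
transitivity (\sum_(n <oo) ((expR (- (m * t)))%:E * (((m * t) ^+ n) / n`!%:R)%:E))%E.
  apply: eq_eseriesr => n _; rewrite -EFinM; congr EFin.
  by rewrite /ring_weight -mulrA exprMn; congr (_ * _); rewrite mulrAC [t ^+ n * _]mulrC.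
rewrite nneseriesZl; last first.
  by move=> n _; rewrite lee_fin divr_ge0// exprn_ge0// mulr_ge0.
by rewrite nneseries_expR ?mulr_ge0// -EFinM -expRD addNr expR0.
Qed.

End series.

Section finite_generator.
Context (R : realType) (L : countType) (N : L -> set L).
Context dA (A : finTBOrderType dA).
Variable P : forall j : L, (N j -> A) -> A -> R.
Hypothesis PT : is_transition_matrix P.
Local Notation config := (config L A).
Implicit Types (f g : config -> R) (F : seq L).

Definition set_site (x : config) (j : L) (a : A) : config :=
  fun i => if i == j then a else x i.

Lemma set_site_id x j : set_site x j (x j) = x.
Proof. by apply/funext => i; rewrite /set_site; case: eqP => [->|]. Qed.

Definition site_step j f : config -> R :=
  fun x => \sum_(a : A) trans P j x a * f (set_site x j a).

Definition gen_step F f : config -> R := fun x => \sum_(j <- F) site_step j f x.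

Lemma gen_step_ge0 F f : (forall x, 0 <= f x) -> forall x, 0 <= gen_step F f x.
Proof.
move=> f0 x; rewrite sumr_ge0// => j _; rewrite sumr_ge0// => a _.
by rewrite mulr_ge0// trans_ge0.
Qed.

Lemma gen_step_le F f g : (forall x, f x <= g x) ->
  forall x, gen_step F f x <= gen_step F g x.
Proof.
move=> fg x; rewrite ler_sum// => j _; rewrite ler_sum// => a _.
by rewrite ler_wpM2l// trans_ge0.
Qed.

Lemma gen_step_cst F c : gen_step F (fun=> c) = fun=> (size F)%:R * c.
Proof.
apply/funext => x; rewrite /gen_step.
under eq_bigr do rewrite /site_step -mulr_suml trans_sum// mul1r.
by rewrite big_const_seq count_predT iter_addr_0 mulr_natl.
Qed.

Lemma gen_step_sum F (I : Type) (r : seq I) (c : I -> R) (h : I -> config -> R) x :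
  gen_step F (fun y => \sum_(i <- r) c i * h i y) x =
  \sum_(i <- r) c i * gen_step F (h i) x.
Proof.
rewrite /gen_step; under [RHS]eq_bigr do rewrite mulr_sumr.
rewrite [RHS]exchange_big/=; apply: eq_bigr => j _; rewrite /site_step.
under [RHS]eq_bigr do rewrite mulr_sumr.
rewrite [RHS]exchange_big/=; apply: eq_bigr => a _.
by rewrite mulr_sumr; apply: eq_bigr => i _; rewrite mulrCA.
Qed.

Lemma iter_gen_ge0 F n f : (forall x, 0 <= f x) ->
  forall x, 0 <= iter n (gen_step F) f x.
Proof. by move=> f0; elim: n => //= n IH; exact: gen_step_ge0. Qed.

Lemma iter_gen_le F n f c : (forall x, f x <= c) ->
  forall x, iter n (gen_step F) f x <= (size F)%:R ^+ n * c.
Proof.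
move=> f1; elim: n => [|n IH] x /=; first by rewrite expr0 mul1r.
rewrite exprS -mulrA -[leRHS](_ : gen_step F (fun=> (size F)%:R ^+ n * c) x = _).
  exact: gen_step_le.
by rewrite gen_step_cst.
Qed.

Lemma iter_gen_cst F n c :
  iter n (gen_step F) (fun=> c) = fun=> (size F)%:R ^+ n * c.
Proof.
elim: n => [|n IH] /=; first by apply/funext => x; rewrite expr0 mul1r.
by rewrite IH gen_step_cst; apply/funext => x; rewrite exprS mulrA.
Qed.

(** The operator exp(t (S - m)), where S sums the single-site updates over F and m is the number
    of sites. Taking exp(- m t) out of the exponential leaves a series of nonnegative terms. *)
Definition semigroup_series F t f (x : config) : \bar R :=
  (\sum_(n <oo) (ring_weight (size F)%:R t n * iter n (gen_step F) f x)%:E)%E.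

Definition semigroup F t f : config -> R := fun x => fine (semigroup_series F t f x).

Definition unit_valued f := forall x, 0 <= f x <= 1.

Lemma unit_valued_ge0 f : unit_valued f -> forall x, 0 <= f x.
Proof. by move=> f01 x; have /andP[] := f01 x. Qed.

Section fixed_volume.
Variable F : seq L.
Local Notation S := (gen_step F).
Local Notation m := ((size F)%:R : R).

Let term_ge0 t n f x : 0 <= t -> unit_valued f ->
  (0 <= (ring_weight m t n * iter n S f x)%:E)%E.
Proof.
move=> t0 f01; rewrite lee_fin mulr_ge0 ?ring_weight_ge0//.
exact/iter_gen_ge0/unit_valued_ge0.
Qed.

Lemma semigroup_series_ge0 t f x : 0 <= t -> unit_valued f ->
  (0 <= semigroup_series F t f x)%E.
Proof. by move=> t0 f01; apply: nneseries_ge0 => n _ _; exact: term_ge0. Qed.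

Lemma semigroup_series_cst1 t x : 0 <= t -> semigroup_series F t (fun=> 1) x = 1%E.
Proof.
move=> t0; rewrite /semigroup_series -(@ring_weight_total _ m t)//.
by apply: eq_eseriesr => n _; rewrite iter_gen_cst mulr1.
Qed.

Lemma semigroup_series_le1 t f x : 0 <= t -> unit_valued f ->
  (semigroup_series F t f x <= 1)%E.
Proof.
move=> t0 f01; rewrite -(@semigroup_series_cst1 t x t0).
apply: lee_nneseries => [n _ _|n _]; first exact: term_ge0.
rewrite lee_fin ler_wpM2l ?ring_weight_ge0// iter_gen_cst.
by apply: iter_gen_le => y; have /andP[] := f01 y.
Qed.

Lemma semigroupE t f x : 0 <= t -> unit_valued f ->
  (semigroup F t f x)%:E = semigroup_series F t f x.
Proof.
move=> t0 f01; rewrite /semigroup fineK// ge0_fin_numE ?semigroup_series_ge0//.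
by rewrite (le_lt_trans (semigroup_series_le1 _ _ _)) ?ltry.
Qed.

Lemma unit_valued_semigroup t f : 0 <= t -> unit_valued f -> unit_valued (semigroup F t f).
Proof.
move=> t0 f01 x; rewrite -!lee_fin semigroupE//.
by rewrite semigroup_series_ge0// semigroup_series_le1.
Qed.

Lemma semigroup_compl t f x : 0 <= t -> unit_valued f ->
  (semigroup_series F t f x + semigroup_series F t (fun y => 1 - f y)%R x = 1)%E.
Proof.
move=> t0 f01; have f01' : unit_valued (fun y => 1 - f y).
  by move=> y; have /andP[f0 f1] := f01 y; rewrite subr_ge0 f1 gerBl.
rewrite -nneseriesD; [|by move=> n _ _; exact: term_ge0..].
rewrite -[RHS](@semigroup_series_cst1 t x t0); apply: eq_eseriesr => n _.
rewrite -EFinD -mulrDr; congr (_ * _)%:E; move: x.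
elim: n => [|n IH] x /=; first by rewrite addrC subrK.
transitivity (S (fun y => iter n S f y + iter n S (fun z => 1 - f z) y) x).
  rewrite /gen_step -big_split/=; apply: eq_bigr => j _.
  rewrite /site_step -big_split/=; apply: eq_bigr => a _.
  by rewrite mulrDr.
by congr (S _ x); apply/funext.
Qed.

Let gen_series (h : nat -> config -> R) (H : config -> R) :
  (forall l x, 0 <= h l x) -> (forall x, (H x)%:E = \sum_(l <oo) (h l x)%:E)%E ->
  forall x, (S H x)%:E = (\sum_(l <oo) (S (h l) x)%:E)%E.
Proof.
move=> h0 HE x.
under eq_eseriesr do rewrite -sumEFin.
rewrite nneseries_sum; last first.
  move=> j l _; rewrite lee_fin sumr_ge0// => a _.
  by rewrite mulr_ge0// trans_ge0.
rewrite /gen_step -sumEFin; apply: eq_bigr => j _.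
under [RHS]eq_eseriesr do rewrite -sumEFin.
rewrite nneseries_sum; last by move=> a l _; rewrite lee_fin mulr_ge0// trans_ge0.
rewrite -sumEFin; apply: eq_bigr => a _.
under eq_eseriesr do rewrite EFinM.
by rewrite nneseriesZl -?HE ?EFinM// => l _; rewrite lee_fin.
Qed.

(** exp(s (S - m)) exp(t (S - m)) is expanded as a Cauchy product, after S has been moved
    through the inner series. *)
Lemma semigroup_add s t f x : 0 <= s -> 0 <= t -> unit_valued f ->
  semigroup F (s + t) f x = semigroup F s (semigroup F t f) x.
Proof.
move=> s0 t0 f01; apply: EFin_inj.
rewrite !semigroupE ?addr_ge0//; last exact: unit_valued_semigroup.
have SQ k : forall y, ((iter k S (semigroup F t f) y)%:E =
    \sum_(l <oo) (ring_weight m t l * iter (k + l) S f y)%:E)%E.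
  elim: k => [|k IH] y; first by rewrite semigroupE.
  rewrite /=; rewrite (gen_series (h := fun l y => ring_weight m t l * iter (k + l) S f y)) //.
    apply: eq_eseriesr => l _; congr EFin.
    have := gen_step_sum F [:: l] (ring_weight m t) (fun l => iter (k + l) S f) y.
    rewrite big_seq1 => <-.
    by congr (gen_step F _ y); apply/funext => z; rewrite big_seq1.
  move=> l z; rewrite mulr_ge0 ?ring_weight_ge0//.
  exact/iter_gen_ge0/unit_valued_ge0.
rewrite /semigroup_series.
under [RHS]eq_eseriesr do rewrite EFinM SQ.
have h0 k l : (0 <= (ring_weight m s k)%:E * (ring_weight m t l * iter (k + l) S f x)%:E)%E.
  rewrite mule_ge0 ?lee_fin ?ring_weight_ge0// mulr_ge0 ?ring_weight_ge0//.
  exact/iter_gen_ge0/unit_valued_ge0.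
under [RHS]eq_eseriesr => k _.
  rewrite -nneseriesZl; last first.
    move=> l _; rewrite lee_fin mulr_ge0 ?ring_weight_ge0//.
    exact/iter_gen_ge0/unit_valued_ge0.
  over.
rewrite nneseries_cauchy//; apply: eq_eseriesr => n _.
rewrite -ring_weight_conv mulr_suml -sumEFin; apply: eq_bigr => -[k kn] _ /=.
by rewrite -EFinM subnKC//; congr EFin; rewrite -mulrA.
Qed.

(** Weak monotonicity says nothing about a threshold a that lies between x j and y j, and the
    update of a site alone need not be monotone. Adding the identity repairs this: at such a
    threshold the identity contributes 1 to the upper tail at y and 0 to the one at x, which
    outweighs whatever the update does. *)
Lemma site_step_lazy_le j f x y : weakly_monotone P ->
  (forall y z, config_le y z -> f y <= f z) -> config_le x y ->
  site_step j f x + f x <= site_step j f y + f y.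
Proof.
move=> PM fm xy.
have E z : site_step j f z + f z =
    \sum_(a : A) (trans P j z a + (a == z j)%:R) * f (set_site z j a).
  under eq_bigr do rewrite mulrDl.
  rewrite big_split/=; congr (_ + _).
  rewrite (bigD1 (z j))//= eqxx mul1r set_site_id big1 ?addr0// => a /negbTE ->.
  by rewrite mul0r.
rewrite !E.
have fy : {homo (fun a => f (set_site y j a)) : a b / (a <= b)%O >-> a <= b}.
  by move=> a b ab; apply: fm => i; rewrite /set_site; case: eqP.
apply: (@le_trans _ _ (\sum_(a : A) (trans P j x a + (a == x j)%:R) * f (set_site y j a))).
  apply: ler_sum => a _; rewrite ler_wpM2l ?addr_ge0 ?trans_ge0//.
  by apply: fm => i; rewrite /set_site; case: eqP => // _; exact: xy.
have tail z a : \sum_(b : A | (a <= b)%O) (trans P j z b + (b == z j)%:R) =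
    trans_up P j z a + (a <= z j)%O%:R.
  rewrite big_split/=; congr (_ + _).
  case: (boolP (a <= z j)%O) => az.
    rewrite (bigD1 (z j))//= eqxx big1 ?addr0// => b /andP[_ /negbTE ->//].
  by rewrite big1// => b ab; case: eqP ab az => // -> ->.
have up1 z a : 0 <= trans_up P j z a <= 1.
  rewrite sumr_ge0 => [|b _]; last exact: trans_ge0.
  rewrite -(trans_sum PT j z) [leRHS](bigID (fun b => (a <= b)%O))/= lerDl.
  by rewrite sumr_ge0// => b _; exact: trans_ge0.
apply: le_sum_tails => //.
  move=> a; rewrite !tail; have xyj := xy j.
  case: (leP a (x j)) => ax.
    by rewrite (le_trans ax xyj) lerD2r; apply: PM => //; left; rewrite ax (le_trans ax).
  case: (leP a (y j)) => ay.
    rewrite addr0 (le_trans (andP (up1 x a)).2)// lerDr.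
    by have /andP[] := up1 y a.
  by rewrite lerD2r; apply: PM => //; right.
have tot z : \sum_(b : A) (trans P j z b + (b == z j)%:R) = 2.
  rewrite big_split/= trans_sum// (bigD1 (z j))//= eqxx big1 ?addr0//.
  by move=> b /negbTE ->.
by rewrite !tot.
Qed.

(** Each site is either updated or left alone, at equal rates. *)
Definition lazy_step f : config -> R := fun x => S f x + m * f x.

Lemma iter_lazyE n f x : iter n lazy_step f x =
  \sum_(k < n.+1) 'C(n, k)%:R * m ^+ (n - k) * iter k S f x.
Proof.
elim: n x => [|n IH] x.
  by rewrite big_ord1 bin0 expr0 !mul1r.
rewrite /= /lazy_step IH.
have -> : S (iter n lazy_step f) x =
    \sum_(k < n.+1) ('C(n, k)%:R * m ^+ (n - k)) * iter k.+1 S f x.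
  have := gen_step_sum F (index_enum 'I_n.+1) (fun k : 'I_n.+1 => 'C(n, k)%:R * m ^+ (n - k))
    (fun k : 'I_n.+1 => iter k S f) x.
  by move=> <-; congr (S _ x); apply/funext => y; rewrite IH.
rewrite [RHS]big_ord_recl/= bin0 subn0 mul1r.
under [X in _ = _ + X]eq_bigr => k _.
  rewrite /bump/= add1n binS subSS natrD !mulrDl addrC; over.
rewrite [X in _ = _ + X]big_split/= [RHS]addrCA; congr (_ + _).
rewrite big_ord_recl/= bin0 subn0 mul1r mulrDr mulrA -exprS; congr (_ + _).
rewrite [RHS]big_ord_recr/= bin_small// !mul0r addr0 mulr_sumr.
apply: eq_bigr => -[k kn] _ /=; rewrite /bump/= add1n.
by rewrite -(subnSK kn) exprS -!mulrA [m * _]mulrCA.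
Qed.

(** S - m = (S + m) - 2 m: doubling the rate of the clocks and ignoring each ring with probability
    one half does not change the evolution. *)
Lemma semigroup_lazy t f x : 0 <= t -> unit_valued f ->
  semigroup_series F t f x =
  (\sum_(n <oo) (ring_weight (2 * m) t n * iter n lazy_step f x)%:E)%E.
Proof.
move=> t0 f01.
transitivity (\sum_(k <oo) \sum_(l <oo)
    ((ring_weight m t k * iter k S f x)%:E * (ring_weight m t l * m ^+ l)%:E))%E.
  apply: eq_eseriesr => k _.
  rewrite nneseriesZl ?ring_weight_total ?mule1// => l _.
  by rewrite lee_fin mulr_ge0 ?ring_weight_ge0// exprn_ge0.
rewrite nneseries_cauchy; last first.
  move=> k l; rewrite mule_ge0 ?term_ge0//.
  by rewrite lee_fin mulr_ge0 ?ring_weight_ge0// exprn_ge0.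
apply: eq_eseriesr => n _; rewrite iter_lazyE mulr_sumr -sumEFin.
apply: eq_bigr => -[k kn] _ /=; rewrite -EFinM; congr EFin.
rewrite /ring_weight (_ : 2 * m * t = m * t + m * t); last by ring.
rewrite opprD expRD -(@bin_fact n k)// !natrM.
have -> : t ^+ n = t ^+ k * t ^+ (n - k) by rewrite -exprD subnKC.
have c0 : 'C(n, k)%:R != 0 :> R by rewrite pnatr_eq0 -lt0n bin_gt0.
have k0 : k`!%:R != 0 :> R by rewrite pnatr_eq0 -lt0n fact_gt0.
have n0 : (n - k)`!%:R != 0 :> R by rewrite pnatr_eq0 -lt0n fact_gt0.
by field; rewrite c0 k0 n0.
Qed.

(** In the expansion of the exponential in powers of the lazy step every term is monotone. *)
Lemma semigroup_monotone t f x y : weakly_monotone P -> 0 <= t -> unit_valued f ->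
  (forall y z, config_le y z -> f y <= f z) -> config_le x y ->
  semigroup F t f x <= semigroup F t f y.
Proof.
move=> PM t0 f01 fm xy; rewrite -lee_fin !semigroupE// !semigroup_lazy//.
have lz n : (forall z, 0 <= iter n lazy_step f z) /\
    (forall y z, config_le y z -> iter n lazy_step f y <= iter n lazy_step f z).
  elim: n => [|n [IH0 IHm]]; first by split=> //; exact: unit_valued_ge0.
  have E z : iter n.+1 lazy_step f z =
      \sum_(j <- F) (site_step j (iter n lazy_step f) z + iter n lazy_step f z).
    rewrite big_split/= big_const_seq count_predT iter_addr_0.
    by rewrite /lazy_step mulr_natl.
  split=> [z|z z' zz']; last by rewrite !E ler_sum// => j _; exact: site_step_lazy_le.
  by rewrite /= /lazy_step addr_ge0 ?gen_step_ge0// mulr_ge0.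
apply: lee_nneseries => [n _ _|n _]; rewrite lee_fin.
  by rewrite mulr_ge0 ?ring_weight_ge0//; have [] := lz n.
by rewrite ler_wpM2l ?ring_weight_ge0//; apply: (lz n).2.
Qed.

End fixed_volume.

End finite_generator.

(** * First-ring decomposition of finitely many sites *)

Definition noise_index (L : choiceType) : choiceType := ((L * nat) + (L * nat))%type.

Section first_ring.
Context (R : realType) (L : countType) (N : L -> set L).
Context dA (A : finTBOrderType dA).
Variable P : forall j : L, (N j -> A) -> A -> R.
Local Notation config := (config L A).
Local Notation NI := (noise_index L).
Local Notation Om := (real_product R (noise_index L)).
Implicit Types (w : Om) (j l : L) (k n : nat) (F : seq L).

Definition gap w j k : R := w (inl (j, k)).
Definition dice w j k : R := w (inr (j, k)).
Definition ring w j k : R := \sum_(i < k.+1) gap w j i.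

Lemma ringS w j k : ring w j k.+1 = ring w j k + gap w j k.+1.
Proof. by rewrite /ring big_ord_recr. Qed.

Lemma ring0 w j : ring w j 0 = gap w j 0.
Proof. by rewrite /ring big_ord1. Qed.

Definition positive_gaps w := forall j k, 0 < gap w j k.

Lemma ring_ge w j k : positive_gaps w -> gap w j 0 <= ring w j k.
Proof.
move=> w0; elim: k => [|k IH]; first by rewrite ring0.
by rewrite ringS (le_trans IH)// lerDl ltW.
Qed.

(** Here v s is the configuration just before time s, so that a ring at time s is felt only
    later. Only the sites of F are updated. *)
Definition left_evolution (F : pred L) (t : R) (x : config) w (v : R -> config) :=
  forall (s : R) j, 0 < s <= t ->
    (exists k, [/\ F j, ring w j k < s, s <= ring w j k.+1
       & v s j = resample P j (v (ring w j k)) (dice w j k)]) \/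
    ((F j -> s <= ring w j 0) /\ v s j = x j).

(** The coordinates that run on after the first ring when this ring is at j: the first waiting
    times of the other sites of F. *)
Definition others F j : {fset NI} :=
  [fset (inl (l, 0%N) : NI) | l in [seq l <- F | l != j]]%fset.

Lemma mem_others F j (i : NI) : (i \in others F j) =
  if i is inl (l, k) then [&& l \in F, l != j & k == 0%N] else false.
Proof.
apply/imfsetP/idP => [[l /=]|].
  by rewrite mem_filter => /andP[lj lF] ->; rewrite lF lj.
case: i => [[l k]|//] /and3P[lF lj /eqP ->]; exists l => //=.
by rewrite mem_filter lj.
Qed.

Definition drop_first j (i : NI) : NI :=
  match i with
  | inl (l, k) => inl (l, if l == j then k.+1 else k)
  | inr (l, k) => inr (l, if l == j then k.+1 else k)
  end.

(** The noise seen from time s, when j rings for the first time: the other sites of F have waited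
    for s already, whereas j has used up its first waiting time and its first die. *)
Definition restart F j (s : R) w : Om :=
  fun i => if i \in others F j then w i - s else w (drop_first j i).

Definition rings_first F j w :=
  all (fun l => (l == j) || (gap w j 0 < gap w l 0)) F.

(** The value of f at time t on the event that exactly n rings occur in F before t, and 0 off it.
    The recursion over the first ring makes the expectation computable by induction, and the
    sum over the letters a turns the random letter into a parameter of the recursive call. *)
Fixpoint rings_value F (f : config -> R) n (t : R) (x : config) w : R :=
  match n with
  | 0%N => if all (fun j => t < gap w j 0) F then f x else 0
  | n'.+1 => \sum_(j <- F)
      if [&& 0 < gap w j 0, gap w j 0 < t & rings_first F j w]
      then \sum_(a : A) (resample P j x (dice w j 0) == a)%:R *
             rings_value F f n' (t - gap w j 0) (set_site x j a) (restart F j (gap w j 0) w)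
      else 0
  end.

Lemma sum_resample F j x u (h : A -> R) :
  \sum_(a : A) (resample P j x u == a)%:R * h a = h (resample P j x u).
Proof.
rewrite (bigD1 (resample P j x u))//= eqxx mul1r big1 ?addr0// => a.
by rewrite eq_sym => /negbTE ->; rewrite mul0r.
Qed.

Lemma rings_value_ge0 F f n t x w : (forall x, 0 <= f x) -> 0 <= rings_value F f n t x w.
Proof.
move=> f0; elim: n t x w => [|n IH] t x w /=; first by case: ifP.
apply: sumr_ge0 => j _; case: ifP => // _.
by apply: sumr_ge0 => a _; rewrite mulr_ge0.
Qed.

Lemma rings_first_uniq F j l w : j \in F -> l \in F ->
  rings_first F j w -> rings_first F l w -> j = l.
Proof.
move=> jF lF /allP/(_ _ lF) + /allP/(_ _ jF); case: eqP => //= _.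
by case: eqP => //= _ /lt_trans h /h; rewrite ltxx.
Qed.

(** The events that exactly n rings occur, for different n, are disjoint. *)
Lemma sum_rings_value_le1 F K t x w : uniq F -> \sum_(n < K) rings_value F (fun=> 1) n t x w <= 1.
Proof.
move=> uF; elim: K t x w => [|K IH] t x w; first by rewrite big_ord0.
rewrite big_ord_recl /=.
have E : \sum_(i < K) rings_value F (fun=> 1) (bump 0 i) t x w <=
   \sum_(j <- F) [&& 0 < gap w j 0, gap w j 0 < t & rings_first F j w]%:R.
  rewrite exchange_big/=; apply: ler_sum => j _.
  case: [&& 0 < gap w j 0, gap w j 0 < t & rings_first F j w]; last by rewrite big1.
  under eq_bigr do rewrite sum_resample//.
  exact: IH.
apply: le_trans (lerD (lexx _) E) _ => {E}.
have [h|h] := boolP (all (fun j => t < gap w j 0) F).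
  rewrite big_seq big1 ?addr0// => j jF.
  by rewrite [gap w j 0 < t]ltNge (ltW (allP h j jF)) andbF.
rewrite add0r; have [/hasP[j jF cj]|] :=
  boolP (has (fun j => [&& 0 < gap w j 0, gap w j 0 < t & rings_first F j w]) F).
  rewrite (bigD1_seq j)//= cj big_seq_cond big1 ?addr0// => l /andP[lF lj].
  case c : [&& 0 < gap w l 0, gap w l 0 < t & rings_first F l w] => //.
  case/and3P: c => _ _ fl; move: lj.
  by case/and3P: cj => _ _ fj; rewrite (rings_first_uniq lF jF fl fj) eqxx.
move=> /hasPn nh; rewrite big_seq big1// => j jF.
by rewrite (negbTE (nh j jF)).
Qed.

Lemma restart_positive F j w : positive_gaps w -> rings_first F j w ->
  positive_gaps (restart F j (gap w j 0) w).
Proof.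
move=> w0 fj l k; rewrite /gap /restart mem_others.
case: ifP => [/and3P[lF lj /eqP ->]|_]; last exact: w0.
by have /allP/(_ _ lF) := fj; rewrite (negbTE lj) /= subr_gt0.
Qed.

Lemma ring_restart F j l k w : l \in F -> l != j ->
  ring (restart F j (gap w j 0) w) l k = ring w l k - gap w j 0.
Proof.
move=> lF lj; elim: k => [|k IH].
  by rewrite !ring0 /gap /restart mem_others lF lj.
by rewrite !ringS IH /gap /restart mem_others !andbF/= (negbTE lj) addrAC.
Qed.

Lemma ring_restart_same F j k w :
  ring (restart F j (gap w j 0) w) j k = ring w j k.+1 - gap w j 0.
Proof.
have E i : gap (restart F j (gap w j 0) w) j i = gap w j i.+1.
  by rewrite /gap /restart mem_others eqxx/= andbF/= eqxx.
elim: k => [|k IH]; first by rewrite ringS !ring0 E addrAC subrr add0r.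
by rewrite ringS IH E [in RHS]ringS addrAC.
Qed.

Lemma restart_evolution F j t x w v : positive_gaps w -> j \in F ->
  rings_first F j w -> gap w j 0 < t ->
  left_evolution (mem F) t x w v ->
  left_evolution (mem F) (t - gap w j 0) (set_site x j (resample P j x (dice w j 0)))
    (restart F j (gap w j 0) w) (fun s => v (s + gap w j 0)).
Proof.
move=> w0 jF fj jt ev; set e := gap w j 0.
have e0 : 0 < e by exact: w0.
have vx : v e = x.
  apply/funext => l; case: (ev e l) => [|[k [lF kl _ _]]|[]//].
    by rewrite e0 ltW.
  have := le_lt_trans (ring_ge l k w0) kl.
  have [->|lj] := eqVneq l j; first by rewrite ltxx.
  have /allP/(_ _ lF) := fj; rewrite (negbTE lj) /= => h /(lt_trans h).
  by rewrite ltxx.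
move=> s l /andP[s0 st].
have st' : 0 < s + e <= t by rewrite addr_gt0//= -lerBrDr.
have [->|lj] := eqVneq l j.
  case: (ev (s + e) j st') => [[[|k] [_ k1 k2 E]]|[h _]].
  - right; split; first by rewrite ring_restart_same lerBrDr.
    by rewrite E ring0 -/e vx /set_site eqxx.
  - left; exists k; split=> //.
    + by rewrite ring_restart_same ltrBlDr.
    + by rewrite ring_restart_same lerBrDr.
    + rewrite E ring_restart_same subrK /dice /restart mem_others/=.
      by rewrite eqxx.
  - by move: (h jF); rewrite ring0 -/e gerDr leNgt s0.
case: (ev (s + e) l st') => [[k [lF k1 k2 E]]|[h E]].
  left; exists k; split => //.
  - by rewrite ring_restart// ltrBlDr.
  - by rewrite ring_restart// lerBrDr.
  - by rewrite E ring_restart// subrK /dice /restart mem_others/= (negbTE lj).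
right; split; last by rewrite E /set_site (negbTE lj).
by move=> lF; rewrite ring_restart// lerBrDr; exact: h.
Qed.

(** The recursion follows the trajectory: after the first ring the noise is the restarted one. *)
Lemma rings_value_evolution F f n t x w v : positive_gaps w -> 0 < t ->
  left_evolution (mem F) t x w v ->
  rings_value F f n t x w = rings_value F (fun=> 1) n t x w * f (v t).
Proof.
elim: n t x w v => [|n IH] t x w v w0 t0 ev /=.
  case: ifPn => [h|_]; last by rewrite mul0r.
  rewrite mul1r; congr f; apply/funext => l; apply/esym.
  case: (ev t l) => [|[k [lF kl _ _]]|[]//]; first by rewrite t0 lexx.
  have := le_lt_trans (ring_ge l k w0) kl.
  by rewrite ltNge (ltW (allP h l lF)).
rewrite mulr_suml [LHS]big_seq [RHS]big_seq; apply: eq_bigr => j jF.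
case: ifPn => [/and3P[_ jt fj]|_]; last by rewrite mul0r.
rewrite !sum_resample//.
have := restart_evolution w0 jF fj jt ev => /IH -> //.
- by rewrite subrK.
- exact: restart_positive.
- by rewrite subr_gt0.
Qed.

End first_ring.

Section finite_law.
Context (R : realType) (L : countType) (N : L -> set L).
Context dA (A : finTBOrderType dA).
Variable P : forall j : L, (N j -> A) -> A -> R.
Hypothesis PT : is_transition_matrix P.
Local Notation config := (config L A).
Local Notation NI := (noise_index L).
Local Notation Om := (real_product R (noise_index L)).

Lemma measurable_all d (X : measurableType d) (I : Type) (r : seq I) (b : X -> I -> bool) :
  (forall i, measurable_fun setT (b ^~ i)) -> measurable_fun setT (fun x => all (b x) r).
Proof.
move=> mb; elim: r => [|i r IH] /=; first exact: measurable_cst.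
exact: measurable_and.
Qed.

Lemma measurable_letter_eq d (X : measurableType d) (f : X -> A) (a : A) :
  letter_measurable f -> measurable_fun setT (fun x => f x == a).
Proof.
move=> mf; apply: (measurable_fun_bool true); rewrite setTI.
by rewrite (_ : _ @^-1` _ = [set x | f x = a])//; apply/seteqP; split => x /= /eqP.
Qed.

Lemma measurable_natr_bool d (X : measurableType d) (b : X -> bool) :
  measurable_fun setT b -> measurable_fun setT (fun x => (b x)%:R : R).
Proof.
move=> mb; rewrite (_ : (fun _ => _) = (fun x => if b x then 1 else 0)).
  exact: measurable_fun_ifT.
by apply/funext => x; case: (b x).
Qed.

Lemma letter_measurable_dice d (X : measurableType d) j (x : config) (u : X -> R) :
  measurable_fun setT u -> letter_measurable (fun y => resample P j x (u y)).
Proof.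
by move=> mu; apply: letter_measurable_resample_local => // b; exact: measurable_cst.
Qed.

Lemma measurable_restart d (X : measurableType d) F j (s : X -> R) (w : X -> Om) :
  measurable_fun setT s -> measurable_fun setT w ->
  measurable_fun setT (fun y => restart F j (s y) (w y)).
Proof.
move=> ms mw; apply: measurable_fun_real_product => i; rewrite /restart.
case: (i \in others F j).
  apply: measurable_funB => //; exact: (measurableT_comp (measurable_coord i)).
exact: (measurableT_comp (measurable_coord _)).
Qed.

Lemma measurable_rings_value d (X : measurableType d) F (f : config -> R) n x (t : X -> R) (w : X -> Om) :
  measurable_fun setT t -> measurable_fun setT w ->
  measurable_fun setT (fun y => rings_value P F f n (t y) x (w y)).
Proof.
elim: n x t w => [|n IH] x t w mt mw /=.
  apply: measurable_fun_ifT; [|exact: measurable_cst..].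
  apply: measurable_all => j; apply: measurable_fun_ltr => //.
  exact: (measurableT_comp (measurable_coord _)).
have mg i : measurable_fun setT (fun y => w y i : R).
  exact: (measurableT_comp (measurable_coord i)).
have mgap l k : measurable_fun setT (fun y => gap (w y) l k) by exact: mg.
apply: measurable_sum => j; apply: measurable_fun_ifT => //.
  apply: measurable_and.
    by apply: measurable_fun_ltr => //; exact: mgap.
  apply: measurable_and.
    by apply: measurable_fun_ltr => //; exact: mgap.
  apply: measurable_all => l; case: (l == j) => //=.
  by apply: measurable_fun_ltr; exact: mgap.
apply: measurable_sum => a; apply: measurable_funM.
  apply/measurable_natr_bool/measurable_letter_eq/letter_measurable_dice.
  exact: mg.
apply: IH; first by apply: measurable_funB => //; exact: mgap.
by apply: measurable_restart => //; exact: mgap.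
Qed.

Context (nu : NI -> probability R R) (M : probability Om R).
Hypothesis nu_gap : forall jk B, measurable B -> nu (inl jk) B = exponential_prob 1 B.
Hypothesis nu_dice : forall jk B, measurable B -> nu (inr jk) B = uniform_prob (@ltr01 R) B.
Hypothesis ML : product_law nu M.

Let surv (s : R) : {nonneg R} := NngNum (expR_ge0 (- s)).

Lemma integral_all_survive (D : {fset NI}) (sigma : NI -> NI) (s : R) (h : Om -> \bar R) :
  0 <= s -> injective sigma -> (forall i, i \in D -> sigma i = i) ->
  (forall i, i \in D -> exists jk, i = inl jk) ->
  (forall i B, measurable B -> nu (sigma i) B = nu i B) ->
  measurable_fun setT h -> (forall w, 0 <= h w)%E ->
  (\int[M]_(w in [set w : Om | forall i, i \in D -> (s < w i)%R])
     h (fun i => if i \in D then w i - s else w (sigma i))%R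
   = (expR (- (#|` D|%:R * s)))%:E * \int[M]_w h w)%E.
Proof.
move=> s0 sigmaI sigmaD Dl nu_sigma mh h0.
rewrite (integral_memoryless ML (q := surv s) sigmaI sigmaD nu_sigma) //.
  by rewrite -mulrN expRM_natl.
move=> i B /Dl[jk ->] mB; rewrite exponential_law_memoryless// => C mC.
exact: nu_gap.
Qed.

Lemma integral_no_ring (F : seq L) (t : R) : uniq F -> 0 <= t ->
  (\int[M]_w (if all (fun j => (t < gap w j 0)%R) F then 1 else 0)%:E
   = (expR (- ((size F)%:R * t)))%:E)%E.
Proof.
move=> uF t0.
pose D : {fset NI} := [fset (inl (l, 0%N) : NI) | l in F]%fset.
have memD i : i \in D -> exists jk, i = inl jk.
  by move=> /imfsetP[l /= lF ->]; exists (l, 0%N).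
have := @integral_all_survive D id t (fun=> 1%E) t0 (fun _ _ e => e) (fun _ _ => erefl)
   memD (fun _ _ _ => erefl) (measurable_cst _) (fun=> lee01).
have -> : #|` D| = size F.
  by rewrite /D card_imfset//= ?undup_id// => ? ? [].
rewrite [X in (_ * X)%E]integral_cst//= probability_setT !mule1 => <-.
rewrite [RHS]integral_mkcond; apply: eq_integral => w _; rewrite patchE.
case: ifPn => h.
  rewrite ifT// inE/= => i /imfsetP[l /= lF ->]; exact: (allP h).
rewrite ifF//; apply/negP; rewrite inE/= => h'.
move/negP: h; apply; apply/allP => l lF; apply: h'.
by apply/imfsetP; exists l.
Qed.

Lemma size_others (F : seq L) j : uniq F -> j \in F -> #|` others F j| = (size F).-1.
Proof.
move=> uF jF; rewrite /others card_imfset//= ?undup_id ?filter_uniq// => [|? ? []//].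
by have -> : [seq l <- F | l != j] = rem j F; rewrite ?rem_filter// size_filter
  -(count_predC (pred1 j) F) count_uniq_mem// jF.
Qed.

Lemma drop_first_inj (j : L) : injective (@drop_first L j).
Proof.
move=> [[l k]|[l k]] [[l' k']|[l' k']] //= [ll' ]; rewrite -ll'.
  by case: eqP => _ => [[->]|->].
by case: eqP => _ => [[->]|->].
Qed.

(** The site and the time of the first ring in F, the die used at this ring, and the noise that
    is seen afterwards are independent, and the latter is distributed as the original noise.
    The first waiting time and the first die at j are redrawn separately from the rest; then
    the other sites of F have to survive this waiting time. *)
Lemma integral_first_ring (F : seq L) j (H : R -> R -> Om -> \bar R) :
  uniq F -> j \in F ->
  measurable_fun setT (fun z : R * (R * Om) => H z.1 z.2.1 z.2.2) ->
  (forall s u w, 0 <= H s u w)%E ->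
  (forall s u w, s <= 0 -> H s u w = 0%E) ->
  (\int[M]_w (if rings_first F j w
               then H (gap w j 0) (dice w j 0) (restart F j (gap w j 0) w) else 0)
   = \int[nu (inl (j, 0%N))]_s ((expR (- ((size F).-1%:R * s)))%:E *
       \int[nu (inr (j, 0%N))]_u \int[M]_w H s u w))%E.
Proof.
move=> uF jF mH H0 Hneg.
pose c : NI := inl (j, 0%N); pose d : NI := inr (j, 0%N).
pose G (w : Om) := if rings_first F j w
   then H (gap w j 0) (dice w j 0) (restart F j (gap w j 0) w) else 0%E.
have mG dX (X : measurableType dX) (v : X -> Om) : measurable_fun setT v ->
    measurable_fun setT (fun y => G (v y)).
  move=> mv; have mg i : measurable_fun setT (fun y => v y i : R).
    exact: (measurableT_comp (measurable_coord i)).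
  apply: measurable_fun_ifT => //.
    apply: measurable_all => l; case: (l == j) => //=.
    by apply: measurable_fun_ltr; exact: mg.
  apply: (measurableT_comp (f := fun z : R * (R * Om) => H z.1 z.2.1 z.2.2)
     (g := fun y => (gap (v y) j 0, (dice (v y) j 0, restart F j (gap (v y) j 0) (v y))))) => //.
  apply/measurable_fun_pairP; split; first exact: mg.
  apply/measurable_fun_pairP; split; first exact: mg.
  by apply: measurable_restart => //; exact: mg.
have G0 w : (0 <= G w)%E by rewrite /G; case: ifP.
rewrite -[LHS]/(\int[M]_w G w)%E (integral_resample_coord ML c) //; last first.
  by apply: (mG _ _ idfun); exact: measurable_id.
apply: eq_integral => s _.
rewrite (integral_resample_coord ML d)//; last first.
  by apply: mG; apply: measurable_set_coord => //; exact: measurable_id.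
have [s0|s0] := leP s 0.
  rewrite [X in (_ * X)%E]integral0_eq; last first.
    by move=> u _; rewrite integral0_eq// => w _; exact: Hneg.
  rewrite mule0 integral0_eq// => u _; rewrite integral0_eq// => w _.
  by rewrite /G; case: ifP => // _; rewrite /gap /set_coord/= eqxx Hneg.
have mHs u : measurable_fun setT (H s u).
  apply: (measurableT_comp (f := fun z : R * (R * Om) => H z.1 z.2.1 z.2.2)
     (g := fun w => (s, (u, w)))) => //.
  apply/measurable_fun_pairP; split; first exact: measurable_cst.
  by apply/measurable_fun_pairP; split; [exact: measurable_cst|exact: measurable_id].
transitivity (\int[nu d]_u ((expR (- ((size F).-1%:R * s)))%:E * \int[M]_w H s u w))%E.
  apply: eq_integral => u _.
  rewrite -(size_others uF jF) -(@integral_all_survive _ (@drop_first L j))//.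
  - rewrite [RHS]integral_mkcond; apply: eq_integral => w _.
    rewrite patchE /G.
    have E : (rings_first F j (set_coord c (set_coord d w u) s) : Prop) <->
        [set w : Om | forall i, i \in others F j -> s < w i] w.
      split=> [/allP h i|h].
        rewrite mem_others; case: i => [[l k]|//] /and3P[lF lj /eqP ->].
        have := h l lF; rewrite (negbTE lj) /= /gap /set_coord/= eqxx.
        by rewrite [inl _ == _](_ : _ = false)//; apply/negbTE/eqP => -[E]; move: lj; rewrite E eqxx.
      apply/allP => l lF; case: eqP => //= /eqP lj.
      rewrite /gap /set_coord/= eqxx [inl _ == c](_ : _ = false); last first.
        by apply/negbTE/eqP => -[E]; move: lj; rewrite E eqxx.
      by apply: h; rewrite mem_others lF lj.
    case: ifPn => h; last by rewrite ifF//; apply/negbTE/negP => /set_mem/E; exact/negP.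
    rewrite ifT; last by apply/mem_set/E.
    rewrite /gap /dice /set_coord/= eqxx; congr H; first by rewrite eqxx.
    apply/funext => i; rewrite /restart; case: ifPn => iD.
      rewrite mem_others in iD; case: i iD => [[l k]|//] /and3P[lF lj _].
      rewrite [inl _ == c](_ : _ = false)//.
      by apply/negbTE/eqP => -[E']; move: lj; rewrite E' eqxx.
    case: i iD => [[l k]|[l k]] _ /=.
      rewrite [inl _ == c](_ : _ = false)//.
      by apply/negbTE/eqP => -[->]; rewrite eqxx.
    rewrite [inr _ == d](_ : _ = false)//.
    by apply/negbTE/eqP => -[->]; rewrite eqxx.
  - exact: ltW.
  - exact: drop_first_inj.
  - by move=> i; rewrite mem_others; case: i => [[l k]|//] /and3P[_ /negbTE /= ->].
  - by move=> i; rewrite mem_others; case: i => [jk|//] _; exists jk.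
  - by move=> [[l k]|[l k]] B mB /=; rewrite ?nu_gap ?nu_dice.
rewrite ge0_integralZl//.
- apply: (@measurable_fun_fubini_tonelli_F _ _ _ _ _ M (fun z : R * Om => H s z.1 z.2)) => //.
  apply: (measurableT_comp (f := fun z : R * (R * Om) => H z.1 z.2.1 z.2.2)
     (g := fun z => (s, z))) => //.
  by apply/measurable_fun_pairP; split; [exact: measurable_cst|exact: measurable_id].
- by move=> u _; exact: integral_ge0.
Qed.

(** One ring at rate m contributes the density of its time and one application of the generator;
    what is left is the integral of the previous power of t - s over the time s of the first
    ring. *)
Lemma integral_rings_value (F : seq L) (f : config -> R) n (t : R) (x : config) :
  uniq F -> (forall y, 0 <= f y) -> 0 <= t ->
  (\int[M]_w (rings_value P F f n t x w)%:E
   = (ring_weight (size F)%:R t n * iter n (gen_step P F) f x)%:E)%E.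
Proof.
move=> uF f0; elim: n t x => [|n IH] t x t0.
  rewrite /ring_weight expr0 divr1 mulr1 /= EFinM muleC -integral_no_ring//.
  rewrite -ge0_integralZl//.
  - apply: eq_integral => w _; rewrite -EFinM /=.
    by case: ifP => _; rewrite ?mulr1 ?mulr0.
  - apply/measurable_EFinP/measurable_fun_ifT; [|exact: measurable_cst..].
    apply: measurable_all => j; apply: measurable_fun_ltr => //.
    exact: measurable_coord.
  - by move=> w _; rewrite lee_fin; case: ifP.
  - by rewrite lee_fin.
pose H j a (s u : R) (w : Om) : R :=
  if (0 < s) && (s < t) then
    (resample P j x u == a)%:R * rings_value P F f n (t - s) (set_site x j a) w else 0.
have H0 j a s u w : 0 <= H j a s u w.
  by rewrite /H; case: ifP => // _; rewrite mulr_ge0// rings_value_ge0.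
have mH j a : measurable_fun setT (fun z : R * (R * Om) => H j a z.1 z.2.1 z.2.2).
  have m1 : measurable_fun setT (fun z : R * (R * Om) => z.1) by exact: measurable_fst.
  have m2 : measurable_fun setT (fun z : R * (R * Om) => z.2.1).
    exact: (measurableT_comp measurable_fst measurable_snd).
  have m3 : measurable_fun setT (fun z : R * (R * Om) => z.2.2).
    exact: (measurableT_comp measurable_snd measurable_snd).
  apply: measurable_fun_ifT => //.
    by apply: measurable_and; apply: measurable_fun_ltr.
  apply: measurable_funM.
    exact/measurable_natr_bool/measurable_letter_eq/letter_measurable_dice.
  by apply: measurable_rings_value => //; exact: measurable_funB.
transitivity (\sum_(j <- F) \sum_(a : A) \int[M]_w (if rings_first F j w
   then (H j a (gap w j 0) (dice w j 0) (restart F j (gap w j 0) w))%:E else 0))%E.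
  have mT j a : measurable_fun setT (fun w : Om => (if rings_first F j w
     then (H j a (gap w j 0) (dice w j 0) (restart F j (gap w j 0) w))%:E else 0)%E).
    apply: measurable_fun_ifT => //.
      apply: measurable_all => l; case: (l == j) => //=.
      by apply: measurable_fun_ltr; exact: measurable_coord.
    apply/measurable_EFinP.
    apply: (measurableT_comp (f := fun z : R * (R * Om) => H j a z.1 z.2.1 z.2.2)
     (g := fun w => (gap w j 0, (dice w j 0, restart F j (gap w j 0) w)))) => //.
    apply/measurable_fun_pairP; split; first exact: measurable_coord.
    apply/measurable_fun_pairP; split; first exact: measurable_coord.
    by apply: measurable_restart; [exact: measurable_coord|exact: measurable_id].
  have T0 j a w : (0 <= (if rings_first F j w
     then (H j a (gap w j 0) (dice w j 0) (restart F j (gap w j 0) w))%:E else 0))%E.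
    by case: ifP => // _; rewrite lee_fin.
  under [RHS]eq_bigr => j _.
    rewrite -ge0_integral_sum//; over.
  rewrite -ge0_integral_sum//; last 2 first.
  - by move=> j; exact: emeasurable_sum.
  - by move=> j w _; exact: sume_ge0.
  apply: eq_integral => w _ /=; rewrite -sumEFin; apply: eq_bigr => j _.
  case: (rings_first F j w); last by rewrite !andbF big1.
  rewrite andbT /H; case: (_ && _); last by rewrite big1.
  by rewrite sumEFin.
rewrite [iter _ _ _ x]/= /gen_step mulr_sumr -sumEFin.
rewrite [LHS]big_seq [RHS]big_seq; apply: eq_bigr => j jF.
rewrite /site_step mulr_sumr -sumEFin; apply: eq_bigr => a _.
rewrite (integral_first_ring (H := fun s u w => (H j a s u w)%:E))//; last first.
- by move=> s u w s0; rewrite /H ltNge s0.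
- by move=> s u w; rewrite lee_fin.
- by apply/measurable_EFinP; exact: mH.
set k := iter n (gen_step P F) f (set_site x j a).
have k0 : 0 <= k by exact: iter_gen_ge0.
transitivity (\int[nu (inl (j, 0%N))]_s ((if (0 < s) && (s < t) then
     expR (- ((size F).-1%:R * s)) * ring_weight (size F)%:R (t - s) n else 0)%:E
     * (trans P j x a * k)%:E))%E.
  apply: eq_integral => s _; rewrite /H; case: ifPn => [/andP[s0 st]|_]; last first.
    rewrite mul0e integral0_eq ?mule0// => u _; exact: integral0_eq.
  rewrite EFinM -muleA; congr (_ * _)%E.
  have mres : measurable [set u | resample P j x u = a].
    by apply: letter_measurable_dice; exact: measurable_id.
  transitivity (\int[nu (inr (j, 0%N))]_u ((\1_[set u | resample P j x u = a] u)%:E *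
     (ring_weight (size F)%:R (t - s) n * k)%:E))%E.
    apply: eq_integral => u _; rewrite -IH ?subr_ge0 ?(ltW st)//.
    rewrite -ge0_integralZl//.
    - apply: eq_integral => w _; rewrite indicE -EFinM; congr (_ * _)%:E.
      by congr (nat_of_bool _)%:R; apply/eqP/idP; rewrite inE.
    - by apply/measurable_EFinP; apply: measurable_rings_value => //; exact: measurable_id.
    - by move=> w _; rewrite lee_fin rings_value_ge0.
  rewrite ge0_integralZr//.
  - rewrite integral_indic// setIT.
    rewrite [X in (X * _)%E](_ : _ = (trans P j x a)%:E); last first.
      by apply: resample_law => // B mB; exact: nu_dice.
    by rewrite -!EFinM mulrCA mulrA.
  - exact/measurable_EFinP/measurable_indic.
  - by rewrite lee_fin mulr_ge0// ring_weight_ge0// subr_ge0 ltW.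
have mw : measurable_fun setT (fun s : R => if (0 < s) && (s < t) then
     expR (- ((size F).-1%:R * s)) * ring_weight (size F)%:R (t - s) n else 0).
  apply: measurable_fun_ifT => //.
    by apply: measurable_and; apply: measurable_fun_ltr.
  have me (g : R -> R) : measurable_fun setT g -> measurable_fun setT (fun s => expR (- g s)).
    move=> mg; apply: (measurableT_comp (f := expR) (g := fun s => - g s)).
      exact: measurable_expR.
    exact: measurableT_comp.
  have ml (b : R) : measurable_fun setT (fun s : R => b * s).
    exact: mulrl_measurable.
  have mt : measurable_fun setT (fun s : R => t - s) by exact: measurable_funB.
  apply: measurable_funM; first exact: (me _ (ml _)).
  apply: measurable_funM; first exact: (me _ (measurableT_comp (ml _) mt)).
  apply: measurable_funM => //; exact: measurable_funX.
rewrite ge0_integralZr//; last 3 first.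
- exact/measurable_EFinP.
- move=> s _; rewrite lee_fin; case: ifP => // /andP[_ st].
  by rewrite mulr_ge0 ?expR_ge0// ring_weight_ge0// subr_ge0 ltW.
- by rewrite lee_fin mulr_ge0// trans_ge0.
rewrite [RHS]EFinM; congr (_ * _)%E.
rewrite integral_exponential_law//; last 3 first.
- exact: nu_gap.
- exact/measurable_EFinP.
- move=> s; rewrite lee_fin; case: ifP => // /andP[_ st].
  by rewrite mulr_ge0 ?expR_ge0// ring_weight_ge0// subr_ge0 ltW.
transitivity (\int[lebesgue_measure]_(s in `]0%R, t[)
   ((expR (- ((size F)%:R * t)))%:E * ((t - s) ^+ n / n`!%:R)%:E))%E.
  rewrite [RHS]integral_mkcond; apply: eq_integral => s _; rewrite patchE.
  case: ifPn => st; last by rewrite mul0e ifF//; apply/negP; rewrite inE/= in_itv/=; exact/negP.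
  have /andP[s0 st'] := st.
  rewrite ifT; last by rewrite inE/= in_itv.
  rewrite exponential_pdfE ?ltW// mul1r -!EFinM; congr EFin.
  have -> : (size F)%:R = 1 + (size F).-1%:R :> R.
    have sF : size F = (size F).-1.+1 by case: (F) jF.
    by rewrite [X in X%:R = _]sF -natr1 addrC.
  move: ((size F).-1%:R : R) => b; rewrite /ring_weight.
  have -> : expR (- ((1 + b) * t)) =
      expR (- (b * s)) * expR (- ((1 + b) * (t - s))) * expR (- 1 * s).
    by rewrite -!expRD; congr expR; ring.
  by move: (_ / _) => c; ring.
rewrite ge0_integralZl//.
- by rewrite integral_iterated_power// -EFinM.
- apply/measurable_funTS/measurable_EFinP.
  apply: measurable_funM => //; apply: measurable_funX.
  exact: measurable_funB.
- move=> s /=; rewrite in_itv/= => /andP[_ st]; rewrite lee_fin divr_ge0//.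
  by rewrite exprn_ge0// subr_ge0 ltW.
Qed.

Context d (T : measurableType d) (Pr : probability T R) (W : T -> Om).
Hypothesis mW : measurable_fun setT W.
Hypothesis MW : forall B, measurable B -> M B = Pr (W @^-1` B).

Lemma integral_noise (g : Om -> \bar R) :
  measurable_fun setT g -> (forall w, 0 <= g w)%E ->
  (\int[Pr]_w g (W w) = \int[M]_w g w)%E.
Proof.
move=> mg g0; transitivity (\int[pushforward Pr W]_w g w)%E.
  by rewrite ge0_integral_pushforward.
by apply: eq_measure_integral => B mB _; exact/esym/MW.
Qed.

(** The expectation of f at time t is at least its part on the event that at most K rings occur
    in F, for every K. *)
Lemma semigroup_le_law (F : seq L) (f : config -> R) (t : R) (x : config) (V : T -> config) :
  uniq F -> unit_valued f -> 0 < t -> measurable_fun setT (f \o V) ->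
  {ae Pr, forall w, positive_gaps (W w) /\
     exists2 v, left_evolution P (mem F) t x (W w) v & v t = V w} ->
  (semigroup_series P F t f x <= \int[Pr]_w (f (V w))%:E)%E.
Proof.
move=> uF f01 t0 mf aev; have f0 := unit_valued_ge0 f01.
have t0' := ltW t0.
rewrite /semigroup_series; apply: lime_le.
  apply: is_cvg_nneseries => n _ _.
  by rewrite lee_fin mulr_ge0 ?ring_weight_ge0// iter_gen_ge0.
apply: nearW => K.
under eq_bigr do rewrite -integral_rings_value//.
have mphi n : measurable_fun setT (fun w : Om => (rings_value P F f n t x w)%:E).
  by apply/measurable_EFinP; apply: measurable_rings_value => //; exact: measurable_id.
have phi0 n w : (0 <= (rings_value P F f n t x w)%:E)%E by rewrite lee_fin rings_value_ge0.
under eq_bigr => n _ do rewrite -(integral_noise (mphi n) (phi0 n)).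
have mphiW n : measurable_fun setT (fun w : T => (rings_value P F f n t x (W w))%:E).
  exact: (measurableT_comp (mphi n) mW).
rewrite -ge0_integral_sum//.
apply: ae_ge0_le_integral => //.
- by move=> w _; apply: sume_ge0 => n _; exact: phi0.
- exact: emeasurable_sum.
- by move=> w _; rewrite lee_fin.
- exact/measurable_EFinP.
- apply: filterS aev => w [w0 [v ev vt]] _.
  rewrite sumEFin lee_fin big_mkord.
  under eq_bigr do rewrite (rings_value_evolution f _ w0 t0 ev).
  rewrite -mulr_suml vt ler_piMl//.
  exact: sum_rings_value_le1.
Qed.

(** The lower bound for both f and 1 - f, whose series add up to 1, forces equality. *)
Lemma law_semigroup (F : seq L) (f : config -> R) (t : R) (x : config) (V : T -> config) :
  uniq F -> unit_valued f -> 0 < t -> measurable_fun setT (f \o V) ->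
  {ae Pr, forall w, positive_gaps (W w) /\
     exists2 v, left_evolution P (mem F) t x (W w) v & v t = V w} ->
  (\int[Pr]_w (f (V w))%:E = semigroup_series P F t f x)%E.
Proof.
move=> uF f01 t0 mf aev; have t0' := ltW t0.
have f0 := unit_valued_ge0 f01.
have f01' : unit_valued (fun y => 1 - f y).
  by move=> y; have /andP[a b] := f01 y; rewrite subr_ge0 b gerBl.
have mf' : measurable_fun setT ((fun y => 1 - f y) \o V) by exact: measurable_funB.
have lo := semigroup_le_law uF f01 t0 mf aev.
have hi := semigroup_le_law uF f01' t0 mf' aev.
have S := semigroup_compl PT F x t0' f01.
have I : (\int[Pr]_w (f (V w))%:E + \int[Pr]_w (1 - f (V w))%:E = 1)%E.
  rewrite -ge0_integralD//.
  - rewrite (eq_integral (fun=> 1%E)); last by move=> w _; rewrite -EFinD addrC subrK.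
    by rewrite integral_cst// mul1e; exact: probability_setT.
  - by move=> w _; rewrite lee_fin.
  - exact/measurable_EFinP.
  - by move=> w _; rewrite lee_fin; have /andP[] := f01' (V w).
  - exact/measurable_EFinP.
move: S I lo hi; rewrite -!semigroupE//.
have : (0 <= \int[Pr]_w (f (V w))%:E)%E by apply: integral_ge0 => w _; rewrite lee_fin.
have : (0 <= \int[Pr]_w (1 - f (V w))%:E)%E.
  by apply: integral_ge0 => w _; rewrite lee_fin; have /andP[] := f01' (V w).
case: (\int[Pr]_w (f (V w))%:E)%E => [a| |]//; case: (\int[Pr]_w (1 - f (V w))%:E)%E => [b| |]//.
rewrite -!EFinD !lee_fin => _ _ [S] [I] lo hi; congr EFin; lra.
Qed.

End finite_law.

(** * Constructing the evolution from the noise *)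

Section eventual_value.
Context dA (A : finTBOrderType dA).

(** The limit of a sequence of letters that is eventually constant, with default value \bot. With
    it the state can be defined for every realization of the noise, measurably, and be studied
    only for the good ones. *)
Definition eventual_value (u : nat -> A) : A :=
  xget \bot%O [set a | exists n0, forall n, (n0 <= n)%N -> u n = a].

Lemma eventual_valueE (u : nat -> A) n0 a : (forall n, (n0 <= n)%N -> u n = a) -> eventual_value u = a.
Proof.
move=> ua; rewrite /eventual_value; case: xgetP => [b _ [n1 ub]|]; last first.
  by move=> /(_ a) []; exists n0.
by rewrite -(ub (maxn n0 n1)) ?leq_maxr// ua ?leq_maxl.
Qed.

End eventual_value.

Section construction.
Context (R : realType) (L : countType) (N : L -> set L).
Context dA (A : finTBOrderType dA).
Variable P : forall j : L, (N j -> A) -> A -> R.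
Local Notation config := (config L A).
Local Notation Om := (real_product R (noise_index L)).
Implicit Types (w : Om) (j i : L) (k n d : nat) (x y : config).

(** Only the rings strictly before s count, as the states below are left-continuous versions. *)
Definition ring_count w j (s : R) : nat :=
  xget 0%N [set k | s <= ring w j k /\ forall l, (l < k)%N -> ring w j l < s].

(** The state just before time s is computed backwards in time: the last ring at j reveals when the
    letter at j was drawn, and from which configuration. The number d bounds the depth of the
    recursion, and F the set of sites that ring. *)
Fixpoint depth_state (F : pred L) d (s : R) x w : config :=
  match d with
  | 0%N => x
  | d'.+1 => fun j => if F j then
      match ring_count w j s with
      | 0%N => x j
      | k.+1 => resample P j (depth_state F d' (ring w j k) x w) (dice w j k)
      end else x j
  end.

Definition finite_state (F : seq L) (s : R) x w : config :=
  fun j => eventual_value (fun d => depth_state (mem F) d s x w j).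

Definition full_state (s : R) x w : config :=
  fun j => eventual_value (fun n => finite_state (sites L n) s x w j).

(** The trajectories of the process change at the ring times, hence are right-continuous; they are
    the right limits of the left-continuous version. *)
Definition right_state (s : R) x w : config :=
  fun j => eventual_value (fun n => full_state (s + n.+1%:R^-1) x w j).

Definition finitely_many_rings w := forall j (t : R), exists k, t <= ring w j k.

Definition distinct_rings w := forall i j k n, i != j -> ring w i k != ring w j n.

Section counting.
Variable w : Om.
Hypotheses (w0 : positive_gaps w) (wf : finitely_many_rings w).

Lemma ring_lt j k n : (k < n)%N -> ring w j k < ring w j n.
Proof.
elim: n => // n IH; rewrite ltnS leq_eqVlt => /predU1P[->|/IH h].
  by rewrite ringS ltrDl.
by apply: lt_trans h _; rewrite ringS ltrDl.
Qed.

Lemma ring_le j k n : (k <= n)%N -> ring w j k <= ring w j n.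
Proof. by rewrite leq_eqVlt => /predU1P[->//|/ring_lt/ltW]. Qed.

Lemma ring_gt0 j k : 0 < ring w j k.
Proof. by apply: lt_le_trans (ring_ge _ _ w0); exact: w0. Qed.

Lemma ring_countP j s : s <= ring w j (ring_count w j s) /\
  forall l, (l < ring_count w j s)%N -> ring w j l < s.
Proof.
rewrite /ring_count; case: xgetP => [k _ []//|none].
have ex : exists k, s <= ring w j k by exact: wf.
case: (ex_minnP ex) => k sk kmin; exfalso; apply: (none k); split=> // l lk.
by rewrite ltNge; apply/negP => /kmin; rewrite leqNgt lk.
Qed.

Lemma ring_count_eq j s k : s <= ring w j k ->
  (forall l, (l < k)%N -> ring w j l < s) -> ring_count w j s = k.
Proof.
move=> sk kl; have [h1 h2] := ring_countP j s.
apply/eqP; rewrite eqn_leq; apply/andP; split; rewrite leqNgt; apply/negP.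
  by move=> /h2; rewrite ltNge sk.
by move=> /kl; rewrite ltNge h1.
Qed.

Lemma ring_count_lt j s k : (k < ring_count w j s)%N = (ring w j k < s).
Proof.
have [h1 h2] := ring_countP j s; apply/idP/idP; first exact: h2.
apply: contraTT; rewrite -leqNgt -leNgt => h.
by apply: le_trans h1 _; exact: ring_le.
Qed.

Lemma ring_count_ring j k : ring_count w j (ring w j k) = k.
Proof. by apply: ring_count_eq => // l; exact: ring_lt. Qed.

Lemma ring_count_homo j s t : s <= t -> (ring_count w j s <= ring_count w j t)%N.
Proof.
move=> st; case E : (ring_count w j s) => [//|k].
by rewrite ring_count_lt; apply: lt_le_trans st; rewrite -ring_count_lt E.
Qed.

Lemma ring_count_no_ring j s t : s <= t -> (forall k, ~~ (s <= ring w j k < t)) ->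
  ring_count w j s = ring_count w j t.
Proof.
move=> st h; apply/eqP; rewrite eqn_leq ring_count_homo//= leqNgt; apply/negP.
rewrite ring_count_lt => kt; have := h (ring_count w j s).
by rewrite kt andbT (ring_countP j s).1.
Qed.

Lemma depth_state_count F d s t x j : ring_count w j s = ring_count w j t ->
  depth_state F d s x w j = depth_state F d t x w j.
Proof. by case: d => //= d ->. Qed.

(** Every recursive call goes back beyond at least one ring in F, so that the total number of
    rings is a sufficient depth. *)
Lemma depth_state_stable (F : seq L) c s x d : uniq F ->
  (\sum_(j <- F) ring_count w j s <= c)%N -> (c <= d)%N ->
  depth_state (mem F) d s x w = depth_state (mem F) c s x w.
Proof.
move=> uF; elim: c s d => [|c IH] s d sc cd.
  case: d {cd} => // d /=; apply/funext => j; case: ifPn => // jF.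
  move: sc; rewrite leqn0 sum_nat_seq_eq0 => /allP/(_ _ jF)/= /eqP -> //.
case: d cd => // d; rewrite ltnS => cd /=; apply/funext => j.
case: ifPn => // jF; case E : (ring_count w j s) => [//|k].
congr (resample P j _ _); apply: IH => //.
rewrite -ltnS; apply: leq_trans sc.
rewrite (bigD1_seq j)//= [X in (_ < X)%N](bigD1_seq j)//= ring_count_ring E.
rewrite -addSn leq_add//; apply: leq_sum => i _.
by apply/ring_count_homo/ltW; rewrite -ring_count_lt E.
Qed.

Lemma finite_stateE (F : seq L) s x : uniq F -> exists c, forall d, (c <= d)%N ->
  finite_state F s x w = depth_state (mem F) d s x w.
Proof.
move=> uF; pose c := (\sum_(j <- F) ring_count w j s)%N; exists c => d cd.
apply/funext => j; rewrite (depth_state_stable x uF (leqnn c) cd).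
by apply: (@eventual_valueE _ _ _ c) => d' cd'; rewrite (depth_state_stable x uF (leqnn c) cd').
Qed.

Lemma finite_state_eq (F : seq L) s x j : uniq F -> finite_state F s x w j =
  if j \in F then
    match ring_count w j s with
    | 0%N => x j
    | k.+1 => resample P j (finite_state F (ring w j k) x w) (dice w j k)
    end else x j.
Proof.
move=> uF; have [c cE] := finite_stateE s x uF.
rewrite (cE c.+1)//=; case: ifPn => // jF.
case E : (ring_count w j s) => [//|k].
have [c' cE'] := finite_stateE (ring w j k) x uF.
rewrite (cE' (maxn c c')) ?leq_maxr//.
have := cE (maxn c c').+1; rewrite (cE c.+1)// => /(_ (leq_trans (leq_maxl _ _) (leqnSn _))).
by move=> /(congr1 (fun y => y j)); rewrite /= jF E.
Qed.

Lemma finite_state_count F s t x j : ring_count w j s = ring_count w j t ->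
  finite_state F s x w j = finite_state F t x w j.
Proof.
move=> E; rewrite /finite_state; congr eventual_value; apply/funext => d.
exact: depth_state_count.
Qed.

Lemma full_state_count s t x j : ring_count w j s = ring_count w j t ->
  full_state s x w j = full_state t x w j.
Proof.
move=> E; rewrite /full_state; congr eventual_value; apply/funext => d.
exact: finite_state_count.
Qed.

Lemma finite_state_evolution (F : seq L) t x : uniq F ->
  left_evolution P (mem F) t x w (fun s => finite_state F s x w).
Proof.
move=> uF s j _; rewrite finite_state_eq//.
case: ifPn => [jF|/negbTE jF]; last by right; split => //=; rewrite jF.
case E : (ring_count w j s) => [|k].
  by right; split => // _; have [] := ring_countP j s; rewrite E.
left; exists k; split => //; first by rewrite -ring_count_lt E.
by have [] := ring_countP j s; rewrite E.
Qed.

End counting.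

(** * Backward exploration *)

(** Integer times are enough, see reaches0_sub; this leaves countably many almost sure
    conditions. *)
Definition regular_noise w := [/\ positive_gaps w, distinct_rings w
  & forall (n : nat) j, reaches0 N (ring w) n%:R [set j]].

Lemma reaches0_later w s t K : s <= t ->
  (forall j n, K j -> 0 < ring w j n < t -> ring w j n < s) ->
  reaches0 N (ring w) s K -> reaches0 N (ring w) t K.
Proof.
move=> + + h; case: h => {s K} [s K h|s K j n Kj /andP[j0 js] jmax r] st ts.
  apply: reaches0_stop => j n Kj; apply: contra (h j n Kj) => jt.
  by rewrite (ts j n Kj jt) andbT; case/andP: jt.
apply: (@reaches0_step _ _ _ _ _ _ j n) => //; first by rewrite j0 (lt_le_trans js).
move=> j' n' Kj' jt'; apply: jmax => //.
by rewrite (ts j' n' Kj' jt') andbT; case/andP: jt'.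
Qed.

(** An exploration from an earlier time and a smaller set only meets rings that the larger
    exploration meets as well, and skips those outside its set. *)
Lemma reaches0_sub w t K : positive_gaps w -> distinct_rings w ->
  reaches0 N (ring w) t K ->
  forall t' K', t' <= t -> K' `<=` K -> reaches0 N (ring w) t' K'.
Proof.
move=> w0 wd; elim=> {t K} [t K h|t K i k Ki /andP[i0 it] imax _ IH] t' K' tt' KK'.
  apply: reaches0_stop => j n /KK' Kj; apply: contra (h j n Kj) => /andP[-> h'].
  exact: lt_le_trans h' tt'.
have [t'i|it'] := leP t' (ring w i k).
  by apply: IH => // j /KK'; left.
have max' j n : K' j -> 0 < ring w j n < t' -> ring w j n <= ring w i k.
  move=> /KK' Kj /andP[j0 jt]; apply: imax => //.
  by rewrite j0 (lt_le_trans jt).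
have [K'i|nK'i] := pselect (K' i).
  apply: (@reaches0_step _ _ _ _ _ _ i k) => //; first by rewrite i0.
  by apply: IH => // j [/KK'|]; [left|right].
have ne j n : K' j -> ring w j n != ring w i k.
  move=> K'j; have [ji|] := eqVneq j i; last exact: wd.
  by move: K'j; rewrite ji => /nK'i.
apply: (@reaches0_later w (ring w i k)) => //; first exact: ltW.
  move=> j n K'j jt; have := max' j n K'j jt.
  by rewrite le_eqVlt (negbTE (ne j n K'j)).
by apply: IH => // j /KK'; left.
Qed.

Lemma reaches0_finite w t K : positive_gaps w -> reaches0 N (ring w) t K ->
  forall j, K j -> exists k, t <= ring w j k.
Proof.
move=> w0; elim=> {t K} [t K h|t K i k Ki it imax _ IH] j Kj.
  exists 0%N; have := h j 0%N Kj; rewrite ring_gt0//= -leNgt//.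
have [n hn] := IH j (or_introl Kj); exists n.+1; rewrite leNgt; apply/negP => h.
have := imax j n.+1 Kj; rewrite ring_gt0// h => /(_ isT); rewrite leNgt.
by rewrite (le_lt_trans hn)// ring_lt.
Qed.

Lemma regular_noise_finite w : regular_noise w -> finitely_many_rings w.
Proof.
move=> [w0 _ wr] j t; have [k hk] := reaches0_finite w0 (wr (Num.truncn `|t|).+1 j) erefl.
exists k; apply: le_trans hk; apply: le_trans (ler_norm t) _.
exact/ltW/truncnS_gt.
Qed.

Lemma regular_noise_reaches w t j : regular_noise w -> reaches0 N (ring w) t [set j].
Proof.
move=> [w0 wd wr]; apply: (reaches0_sub w0 wd (wr (Num.truncn `|t|).+1 j)) => //.
apply: le_trans (ler_norm t) _; exact/ltW/truncnS_gt.
Qed.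

(** The initial configurations are allowed to differ outside a window: the site j has stabilized
    along the finite volumes, to a value that depends on finitely many initial letters. *)
Definition settled w t j n0 := forall n y y', (n0 <= n)%N ->
  map y (sites L n0) = map y' (sites L n0) ->
  finite_state (sites L n) t y w j = finite_state (sites L n0) t y' w j.

Lemma agree_sites (y y' : config) m n : (m <= n)%N ->
  map y (sites L n) = map y' (sites L n) -> map y (sites L m) = map y' (sites L m).
Proof.
move=> mn /eq_in_map h; apply/eq_in_map => j; rewrite mem_sites => jm.
by apply: h; rewrite mem_sites (leq_trans jm).
Qed.

Lemma agree_site (y y' : config) n j : (choice.pickle j < n)%N ->
  map y (sites L n) = map y' (sites L n) -> y j = y' j.
Proof. by move=> jn /eq_in_map; apply; rewrite mem_sites. Qed.

Hypothesis Nfin : forall j, finite_set (N j).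

Lemma settled_upto w t (i : L) : (forall j, N i j -> exists n0, settled w t j n0) ->
  exists n0, forall j, N i j -> exists2 m, (m <= n0)%N & settled w t j m.
Proof.
move=> h; have /finite_seqP[s sE] := Nfin i.
have {}h j : j \in s -> exists n0, settled w t j n0.
  by move=> js; apply: h; rewrite sE.
suff [n0 hn] : exists n0, forall j, j \in s -> exists2 m, (m <= n0)%N & settled w t j m.
  by exists n0 => j; rewrite sE; exact: hn.
elim: s h {sE} => [|j s IH] h; first by exists 0%N.
have [n1 h1] := IH (fun i is_ => h i (mem_behead (s := j :: s) is_)).
have [n2 h2] := h j (mem_head _ _).
exists (maxn n1 n2) => l; rewrite inE => /predU1P[->|/h1[m mn sm]].
  by exists n2 => //; rewrite leq_maxr.
by exists m => //; rewrite (leq_trans mn)// leq_maxl.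
Qed.

(** Induction along the exploration. At the latest ring in K, say at site i, all the neighbours of
    i are settled, hence the update at i draws the same letter in all large volumes. *)
Lemma reaches0_settled w t K : regular_noise w -> reaches0 N (ring w) t K ->
  forall j, K j -> exists n0, settled w t j n0.
Proof.
move=> wok; have [w0 wd wr] := wok; have wf := regular_noise_finite wok.
elim=> {t K} [t K h|t K i k Ki it imax _ IH] j Kj.
  exists (choice.pickle j).+1 => n y y' nn yy'.
  have E : ring_count w j t = 0%N.
    by apply: ring_count_eq => //; have := h j 0%N Kj; rewrite ring_gt0//= -leNgt.
  rewrite !finite_state_eq ?sites_uniq// E !if_same.
  exact: agree_site yy'.
have [->|ji] := eqVneq j i; last first.
  have [n0 s0] := IH j (or_introl Kj); exists n0 => n y y' nn yy'.
  have E : ring_count w j t = ring_count w j (ring w i k).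
    apply/esym/ring_count_no_ring => //; first by case/andP: it => _ /ltW.
    move=> n'; apply/negP => /andP[h1 h2].
    have := imax j n' Kj; rewrite ring_gt0// h2 => /(_ isT) h3.
    by have := wd j i n' k ji; rewrite eq_le h1 h3.
  by rewrite (finite_state_count (sites L n) y E) (finite_state_count (sites L n0) y' E) (s0 n y y').
have [n0 hn0] := settled_upto (fun j Nj => IH j (or_intror Nj)).
pose n1 := maxn n0 (choice.pickle i).+1.
exists n1 => n y y' nn yy'.
have E : ring_count w i t = k.+1.
  apply: ring_count_eq => //.
    rewrite leNgt; apply/negP => h; have := imax i k.+1 Ki.
    by rewrite ring_gt0// h leNgt ring_lt// => /(_ isT).
  move=> l; rewrite ltnS => lk; case/andP: it => _; apply: le_lt_trans.
  exact: ring_le.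
rewrite !finite_state_eq ?sites_uniq// E !mem_sites leq_maxr (leq_trans (leq_maxr _ _) nn).
apply: resample_local => l Nl; have [m mn sm] := hn0 l Nl.
have mn1 : (m <= n1)%N by rewrite (leq_trans mn)// leq_maxl.
rewrite (sm n y y' (leq_trans mn1 nn) (agree_sites mn1 yy')).
by rewrite (sm n1 y' y' mn1 erefl).
Qed.

Lemma regular_noise_settled w t j : regular_noise w -> exists n0, settled w t j n0.
Proof.
by move=> wok; exact: (reaches0_settled wok (regular_noise_reaches t j wok)).
Qed.

Lemma settled_full w t j n0 n y y' : settled w t j n0 -> (n0 <= n)%N ->
  map y (sites L n0) = map y' (sites L n0) ->
  finite_state (sites L n) t y w j = full_state t y' w j.
Proof.
move=> s0 nn yy'; rewrite (s0 n y y' nn yy'); apply/esym.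
by apply: (@eventual_valueE _ _ _ n0) => m mn; exact: s0.
Qed.

(** The backward recursion passes to the infinite volume, as the finitely many neighbours of j
    are settled at the last ring of j. *)
Lemma full_state_eq w s x j : regular_noise w -> full_state s x w j =
  match ring_count w j s with
  | 0%N => x j
  | k.+1 => resample P j (full_state (ring w j k) x w) (dice w j k)
  end.
Proof.
move=> wok; have [w0 wd wr] := wok; have wf := regular_noise_finite wok.
have [n0 s0] := regular_noise_settled s j wok.
case E : (ring_count w j s) => [|k].
  rewrite -(settled_full s0 (leqnn n0) (erefl (map x _))).
  by rewrite finite_state_eq ?sites_uniq// E if_same.
have [n1 hn1] := settled_upto (fun i (_ : N j i) => regular_noise_settled (ring w j k) i wok).
pose n := maxn n0 (maxn n1 (choice.pickle j).+1).
rewrite -(settled_full s0 (leq_maxl _ _ : n0 <= n)%N (erefl (map x _))).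
rewrite finite_state_eq ?sites_uniq// E mem_sites.
rewrite (_ : _ < n)%N; last by rewrite /n !leq_max leqnn !orbT.
apply: resample_local => i Ni; have [m mn sm] := hn1 i Ni.
apply: (settled_full sm) => //.
by rewrite (leq_trans mn)// /n !leq_max leqnn orbT.
Qed.

End construction.

(** * Existence and uniqueness of the evolution *)

Section evolution.
Context (R : realType) (L : countType) (N : L -> set L).
Context dA (A : finTBOrderType dA).
Variable P : forall j : L, (N j -> A) -> A -> R.
Hypothesis Nfin : forall j, finite_set (N j).
Local Notation config := (config L A).
Local Notation Om := (real_product R (noise_index L)).
Local Notation full_state := (full_state P).
Local Notation right_state := (right_state P).
Variables (w : Om) (wok : regular_noise N w).
Implicit Types (j i : L) (k n : nat) (s t : R) (x : config).

Let w0 : positive_gaps w. Proof. by case: wok. Qed.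
Let wf : finitely_many_rings w. Proof. exact: regular_noise_finite wok. Qed.

Lemma right_state_before s t x j : t < s -> (forall k, ~~ (t < ring w j k < s)) ->
  right_state t x w j = full_state s x w j.
Proof.
move=> ts h.
have [n0 hn0] : exists n0, forall n, (n0 <= n)%N -> t + n.+1%:R^-1 <= s.
  have st : 0 < s - t by rewrite subr_gt0.
  exists (Num.truncn (s - t)^-1) => n nn.
  rewrite -lerBrDl -[leRHS]invrK lef_pV2 ?posrE ?invr_gt0//.
  apply/ltW/(lt_le_trans (truncnS_gt _)).
  by rewrite ler_nat ltnS.
apply: (@eventual_valueE _ _ _ n0) => n nn.
apply: full_state_count; apply: (ring_count_no_ring w0 wf); first exact: hn0.
move=> k; apply: contra (h k) => /andP[h1 ->]; rewrite andbT.
by apply: lt_le_trans h1; rewrite ltrDl invr_gt0.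
Qed.

Lemma next_ring j t : exists2 s, t < s & forall k, ~~ (t < ring w j k < s).
Proof.
have ex : exists k, t < ring w j k.
  by have [k hk] := wf j (t + 1); exists k; apply: lt_le_trans hk; rewrite ltrDl.
case: (ex_minnP ex) => k tk kmin; exists (ring w j k) => // l.
apply/negP => /andP[/kmin kl]; rewrite ltNge => /negP; apply.
exact: ring_le.
Qed.

Lemma previous_ring j t : 0 < t ->
  exists2 s, 0 <= s < t & forall k, ~~ (s < ring w j k < t).
Proof.
move=> t0; case E : (ring_count w j t) => [|k].
  exists 0; first by rewrite lexx.
  move=> k; apply/negP => /andP[_].
  by rewrite -(ring_count_lt w0 wf) E.
exists (ring w j k).
  by rewrite ltW ?ring_gt0//= -(ring_count_lt w0 wf) E.
move=> l; apply/negP => /andP[kl lt].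
move: lt; rewrite -(ring_count_lt w0 wf) E ltnS => /(ring_le w0 j).
by rewrite leNgt kl.
Qed.

Lemma right_state_evolves (x : config) :
  evolves P (ring w) (dice w) x (fun t => right_state t x w).
Proof.
split.
- apply/funext => j; rewrite (@right_state_before (ring w j 0))//.
  + by rewrite full_state_eq// ring_count_ring.
  + exact: ring_gt0.
  + by move=> k; rewrite negb_and -!leNgt (ring_le w0)// orbT.
- move=> j k; exists (full_state (ring w j k) x w); split.
    move=> i; have [r /andP[r0 rj] hr] := previous_ring i (ring_gt0 w0 j k).
    near=> s; apply: right_state_before; first by near: s; exact: nbhs_left_lt.
    move=> l; apply: contra (hr l) => /andP[sl ->]; rewrite andbT.
    apply: lt_trans sl; near: s; exact: nbhs_left_gt.
  rewrite (@right_state_before (ring w j k.+1))//.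
  + by rewrite full_state_eq// ring_count_ring.
  + exact: ring_lt.
  + move=> l; apply/negP => /andP[h1 h2].
    move: h1; rewrite ltNge => /negP; apply; apply: ring_le => //.
    rewrite leqNgt; apply/negP => /(ring_le w0 j).
    by rewrite leNgt h2.
- move=> j s t s0 st h; have [t' tt' ht] := next_ring j t.
  rewrite (right_state_before x tt' ht) (@right_state_before t')//.
    exact: le_lt_trans tt'.
  move=> k; apply/negP => /andP[sk kt']; have [kt|tk] := leP (ring w j k) t.
    by have := h k; rewrite sk kt.
  by have := ht k; rewrite tk kt'.
Unshelve. all: end_near. Qed.

(** Uniqueness of the trajectory, again by induction along the exploration: the letter at j just
    before time t was drawn from the left limit at the last ring of j, which agrees with the
    constructed configuration on the neighbours of j. *)
Lemma evolves_full_state (x : config) (z : R -> config) :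
  evolves P (ring w) (dice w) x z ->
  forall t j s, 0 <= s -> s < t -> (forall k, ~~ (s < ring w j k < t)) ->
  z s j = full_state t x w j.
Proof.
move=> [z0 zr zc] t j; have [_ wd wr] := wok.
suff H K : reaches0 N (ring w) t K -> forall j, K j -> forall s, 0 <= s -> s < t ->
    (forall k, ~~ (s < ring w j k < t)) -> z s j = full_state t x w j.
  by apply: (H _ (regular_noise_reaches t j wok)).
elim=> {t K j} [t K h|t K i k Ki it imax _ IH] j Kj s s0 st hs.
  rewrite full_state_eq// (_ : ring_count w j t = 0%N); last first.
    by apply: ring_count_eq => //; have := h j 0%N Kj; rewrite ring_gt0//= -leNgt.
  rewrite -z0; apply: (zc j 0 s) => // k.
  by apply: contra (h j k Kj) => /andP[-> /le_lt_trans]; exact.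
have [i0 kt] := andP it.
have [ji|ji] := eqVneq j i.
  subst j; have ks : ring w i k <= s.
    by rewrite leNgt; apply/negP => sk; have := hs k; rewrite sk kt.
  have -> : z s i = z (ring w i k) i.
    apply: zc => //; first exact: ltW.
    move=> l; apply/negP => /andP[kl ls]; have := imax i l Ki.
    by rewrite ring_gt0// (le_lt_trans ls st) leNgt kl => /(_ isT).
  have [xi [xil ->]] := zr i k.
  rewrite full_state_eq// (_ : ring_count w i t = k.+1); last first.
    apply: ring_count_eq => //.
      rewrite leNgt; apply/negP => h; have := imax i k.+1 Ki.
      by rewrite ring_gt0// h leNgt ring_lt// => /(_ isT).
    by move=> l; rewrite ltnS => lk; apply: le_lt_trans kt; exact: ring_le.
  apply: resample_local => l Nl.
  have [r /andP[r0 rk] hr] := previous_ring l i0.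
  have [s' /=[]] : exists s', z s' l = xi l /\ r < s' < ring w i k.
    apply: (@filter_ex _ (ring w i k)^'-); near=> s'; split.
      by near: s'; exact: xil.
    by apply/andP; split; near: s'; [exact: nbhs_left_gt|exact: nbhs_left_lt].
  move=> <- /andP[rs' s'k]; apply: IH => //; first by right.
    exact: le_trans r0 (ltW rs').
  by move=> l'; apply: contra (hr l') => /andP[sl ->]; rewrite andbT (lt_trans rs').
have E : ring_count w j t = ring_count w j (ring w i k).
  apply/esym/(ring_count_no_ring w0 wf); first exact: ltW.
  move=> n'; apply/negP => /andP[h1 h2].
  have := imax j n' Kj; rewrite ring_gt0// h2 => /(_ isT) h3.
  by have := wd j i n' k ji; rewrite eq_le h1 h3.
rewrite (full_state_count P x E).
have [sk|ks] := ltP s (ring w i k).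
  apply: IH => //; first by left.
  by move=> l; apply: contra (hs l) => /andP[-> /lt_trans]; exact.
have [r /andP[r0 rk] hr] := previous_ring j i0.
rewrite -(IH j (or_introl Kj) r r0 rk hr).
apply: zc => //; first exact: le_trans (ltW rk) ks.
move=> l; apply/negP => /andP[rl ls].
have := imax j l Kj; rewrite ring_gt0// (le_lt_trans ls st) => /(_ isT).
rewrite le_eqVlt (negbTE (wd j i l k ji))/= => lk.
by have := hr l; rewrite rl lk.
Unshelve. all: end_near. Qed.

(** The left-continuous version is the state itself at a time when no clock rings. *)
Lemma evolves_no_ring (x : config) (z : R -> config) (t : R) :
  evolves P (ring w) (dice w) x z -> 0 < t ->
  (forall j k, ring w j k != t) -> z t = full_state t x w.
Proof.
move=> ev t0 nt; apply/funext => j.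
have [s /andP[s0 st] hs] := previous_ring j t0.
rewrite -(evolves_full_state ev s0 st hs); case: ev => _ _; apply => //.
  exact: ltW.
move=> k; apply/negP => /andP[sk]; rewrite le_eqVlt (negbTE (nt j k))/= => kt.
by have := hs k; rewrite sk kt.
Qed.

End evolution.

(** * Measurability of the evolution *)

Section measurability.
Context (R : realType) (L : countType) (N : L -> set L).
Context dA (A : finTBOrderType dA).
Variable P : forall j : L, (N j -> A) -> A -> R.
Hypothesis Nfin : forall j, finite_set (N j).
Local Notation config := (config L A).
Local Notation Om := (real_product R (noise_index L)).
Context d (X : measurableType d).

Lemma measurable_ring (w : X -> Om) j k :
  measurable_fun setT w -> measurable_fun setT (fun y => ring (w y) j k).
Proof.
move=> mw; apply: measurable_sum => i.
exact: (measurableT_comp (measurable_coord _)).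
Qed.

Lemma measurable_set_le (f g : X -> R) : measurable_fun setT f -> measurable_fun setT g ->
  measurable [set y | f y <= g y].
Proof.
move=> mf mg; have := measurable_fun_ler mf mg measurableT (Logic.I : measurable [set true]).
by rewrite setTI; congr measurable; apply/seteqP; split.
Qed.

Lemma measurable_set_lt (f g : X -> R) : measurable_fun setT f -> measurable_fun setT g ->
  measurable [set y | f y < g y].
Proof.
move=> mf mg; have := measurable_fun_ltr mf mg measurableT (Logic.I : measurable [set true]).
by rewrite setTI; congr measurable; apply/seteqP; split.
Qed.

Lemma measurable_ring_count (w : X -> Om) (s : X -> R) j k :
  measurable_fun setT w -> measurable_fun setT s ->
  measurable [set y | ring_count (w y) j (s y) = k].
Proof.
move=> mw ms.
pose C k := [set y | s y <= ring (w y) j k] `&`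
  \bigcap_(l in [set l | (l < k)%N]) [set y | ring (w y) j l < s y].
have mC n : measurable (C n).
  apply: measurableI; first by apply: measurable_set_le => //; exact: measurable_ring.
  apply: bigcap_measurableType => // l _.
  by apply: measurable_set_lt => //; exact: measurable_ring.
have C1 m n y : C m y -> C n y -> m = n.
  move=> [m1 m2] [n1 n2]; apply/eqP; rewrite eqn_leq; apply/andP.
  split; rewrite leqNgt; apply/negP.
    by move=> /m2; rewrite /= ltNge n1.
  by move=> /n2; rewrite /= ltNge m1.
have -> : [set y | ring_count (w y) j (s y) = k] =
    C k `|` (if k == 0%N then ~` (\bigcup_n C n) else set0).
  apply/seteqP; split => [y /=|y /=]; rewrite /ring_count; case: xgetP => [n _ Cn|none].
  - by move=> nk; left; rewrite -nk.
  - by move=> <-; right; rewrite eqxx => -[n _ [n1 n2]]; exact: (none n).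
  - case => [|]; first exact: C1.
    by case: eqP => // _ []; exists n.
  - case => [[k1 k2]|]; first by have := none k; case.
    by case: eqP.
apply: measurableU => //; case: ifP => // _.
by apply: measurableC; exact: bigcup_measurable.
Qed.

Lemma letter_measurable_eventual_value (u : nat -> X -> A) :
  (forall n, letter_measurable (u n)) -> letter_measurable (fun y => eventual_value (u ^~ y)).
Proof.
move=> mu a.
pose C b := \bigcup_m \bigcap_(n in [set n | (m <= n)%N]) [set y | u n y = b].
have mC b : measurable (C b).
  by apply: bigcup_measurable => m _; apply: bigcap_measurableType => // n _; exact: mu.
have CP b y : C b y <-> exists n0, forall n, (n0 <= n)%N -> u n y = b.
  by split => [[m _ h]|[m h]]; exists m.
have -> : [set y | eventual_value (u ^~ y) = a] =
    C a `|` (if a == \bot%O then ~` (\bigcup_(b in setT) C b) else set0).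
  apply/seteqP; split => [y /=|y /=].
    have [[b Cb]|none] := pselect (exists b, C b y).
      by have /CP[n0 h] := Cb; rewrite (eventual_valueE h) => <-; left.
    move=> <-; right; rewrite /eventual_value; case: xgetP => [b _ /CP Cb|_].
      by case: none; exists b.
    by rewrite eqxx => -[b _ Cb]; apply: none; exists b.
  case => [/CP[n0 h]|]; first exact: eventual_valueE h.
  case: eqP => // -> none; rewrite /eventual_value; case: xgetP => // b _ /CP Cb.
  by case: none; exists b.
apply: measurableU => //; case: ifP => // _; apply: measurableC.
by apply: fin_bigcup_measurable => //; exact: finite_finset.
Qed.

Lemma letter_measurable_depth_state (F : pred L) n (s : X -> R) (x : X -> config) (w : X -> Om) j :
  measurable_fun setT s -> measurable_fun setT x -> measurable_fun setT w ->
  letter_measurable (fun y => depth_state P F n (s y) (x y) (w y) j).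
Proof.
move=> ms mx mw; elim: n s ms j => [|n IH] s ms j /=.
  exact: (letter_measurable_comp (measurable_site j)).
case: (F j); last exact: (letter_measurable_comp (measurable_site j)).
move=> a.
pose v k y := match k with 0%N => x y j
  | k'.+1 => resample P j (depth_state P F n (ring (w y) j k') (x y) (w y)) (dice (w y) j k') end.
have -> : [set y | match ring_count (w y) j (s y) with 0%N => x y j
    | k.+1 => resample P j (depth_state P F n (ring (w y) j k) (x y) (w y)) (dice (w y) j k)
    end = a] = \bigcup_k ([set y | ring_count (w y) j (s y) = k] `&` [set y | v k y = a]).
  apply/seteqP; split => [y /= h|y /= [k _ [E]]]; last by rewrite E.
  by exists (ring_count (w y) j (s y)).
apply: bigcup_measurable => k _; apply: measurableI; first exact: measurable_ring_count.
case: k => [|k]; first exact: (letter_measurable_comp (measurable_site j)).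
apply: (letter_measurable_resample
  (z := fun y => depth_state P F n (ring (w y) j k) (x y) (w y))
  (u := fun y => dice (w y) j k) P (Nfin j) _ _ a).
  by apply: measurable_fun_config => i; apply: IH; exact: measurable_ring.
exact: (measurableT_comp (measurable_coord _)).
Qed.

Lemma measurable_finite_state (F : seq L) (s : X -> R) (x : X -> config) (w : X -> Om) :
  measurable_fun setT s -> measurable_fun setT x -> measurable_fun setT w ->
  measurable_fun setT (fun y => finite_state P F (s y) (x y) (w y)).
Proof.
move=> ms mx mw; apply: measurable_fun_config => j.
by apply: letter_measurable_eventual_value => n; exact: letter_measurable_depth_state.
Qed.

Lemma measurable_full_state (s : X -> R) (x : X -> config) (w : X -> Om) :
  measurable_fun setT s -> measurable_fun setT x -> measurable_fun setT w ->
  measurable_fun setT (fun y => full_state P (s y) (x y) (w y)).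
Proof.
move=> ms mx mw; apply: measurable_fun_config => j.
apply: letter_measurable_eventual_value => n.
apply: (letter_measurable_comp (f := fun z : config => z j)
  (h := fun y => finite_state P (sites L n) (s y) (x y) (w y))).
  exact: measurable_site.
exact: measurable_finite_state.
Qed.

Lemma measurable_right_state (s : X -> R) (x : X -> config) (w : X -> Om) :
  measurable_fun setT s -> measurable_fun setT x -> measurable_fun setT w ->
  measurable_fun setT (fun y => right_state P (s y) (x y) (w y)).
Proof.
move=> ms mx mw; apply: measurable_fun_config => j.
apply: letter_measurable_eventual_value => n.
apply: (letter_measurable_comp (f := fun z : config => z j)
  (h := fun y => full_state P (s y + n.+1%:R^-1) (x y) (w y))).
  exact: measurable_site.
by apply: measurable_full_state => //; exact: measurable_funD.
Qed.

End measurability.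

(** * Almost sure properties of the noise *)

Lemma ae_forall_countable d (X : measurableType d) (R : realType)
  (m : {measure set X -> \bar R}) (I : countType) (Q : I -> X -> Prop) :
  (forall i, {ae m, forall x, Q i x}) -> {ae m, forall x, forall i, Q i x}.
Proof.
move=> h.
have : {ae m, forall x n, if choice.unpickle n is Some i then Q i x else True}.
  apply/ae_foralln => n; case: choice.unpickle => [i|]; first exact: h.
  exact: aeW.
by apply: filterS => x h' i; have := h' (choice.pickle i); rewrite choice.pickleK.
Qed.

Lemma ae_preimage d d' (X : measurableType d) (Y : measurableType d') (R : realType)
  (m : {measure set X -> \bar R}) (f : X -> Y) (m' : {measure set Y -> \bar R}) (Q : Y -> Prop) :
  measurable_fun setT f -> (forall B, measurable B -> m' B = m (f @^-1` B)) ->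
  {ae m', forall y, Q y} -> {ae m, forall x, Q (f x)}.
Proof.
move=> mf mm' [Z [mZ Z0 QZ]]; exists (f @^-1` Z); split.
- by rewrite -[X in measurable X]setTI; exact: mf.
- by rewrite -mm'.
- by move=> x /= nQ; apply: QZ.
Qed.

Section almost_surely.
Context (R : realType) (L : countType).
Local Notation NI := (noise_index L).
Local Notation Om := (real_product R (noise_index L)).
Context (nu : NI -> probability R R) (M : probability Om R).
Hypothesis nu_gap : forall jk B, measurable B -> nu (inl jk) B = exponential_prob 1 B.
Hypothesis ML : product_law nu M.

(** Redraw the first waiting time at j, whose law has no atoms, with all else fixed. *)
Lemma ae_coord_neq (j : L) (g : Om -> R) : measurable_fun setT g ->
  (forall w s, g (set_coord (inl (j, 0%N)) w s) = g w) ->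
  {ae M, forall w, gap w j 0 != g w}.
Proof.
move=> mg gu; pose c : NI := inl (j, 0%N).
pose Z := [set w : Om | gap w j 0 = g w].
have mD dX (X : measurableType dX) (f h : X -> R) : measurable_fun setT f ->
    measurable_fun setT h -> measurable [set x | f x = h x].
  move=> mf mh; rewrite (_ : [set x | _] = [set x | f x <= h x] `&` [set x | h x <= f x]).
    by apply: measurableI; exact: measurable_set_le.
  by apply/seteqP; split => [x /= ->|x /= [a b]]; [rewrite lexx|apply/eqP; rewrite eq_le a b].
have mZ : measurable Z by apply: mD => //; exact: measurable_coord.
exists Z; split => //; last by move=> w /= /negP; rewrite negbK => /eqP.
have -> : M Z = (\int[M]_w (\1_Z w)%:E)%E by rewrite integral_indic// setIT.
rewrite (integral_resample_coord ML c)//; last first.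
  exact/measurable_EFinP/measurable_indic.
pose F (z : R * Om) : \bar R := (\1_[set z : R * Om | z.1 = g z.2] z)%:E.
have mF : measurable_fun setT F.
  apply/measurable_EFinP/measurable_indic; apply: mD; first exact: measurable_fst.
  exact: (measurableT_comp mg measurable_snd).
transitivity (\int[nu c]_s \int[M]_w F (s, w))%E.
  apply: eq_integral => s _; apply: eq_integral => w _; congr EFin.
  rewrite /F !indicE; congr (nat_of_bool _)%:R; apply/idP/idP; rewrite !inE /Z/=.
    by rewrite gu /gap /set_coord eqxx.
  by rewrite gu /gap /set_coord eqxx.
transitivity (\int[M]_w \int[nu c]_s F (s, w))%E.
  by apply: (@fubini_tonelli _ _ _ _ _ (nu c) M F) => // z; rewrite /F lee_fin.
apply: integral0_eq => w _.
transitivity (\int[nu c]_s (\1_[set g w] s)%:E)%E; first by [].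
by rewrite integral_indic// setIT; exact: (exponential_law_set1 (nu_gap _)).
Qed.

Let rest (j : L) k (w : Om) := ring w j k - gap w j 0.

Let rest_set_coord j k w s : rest j k (set_coord (inl (j, 0%N)) w s) = rest j k w.
Proof.
elim: k => [|k IH]; first by rewrite /rest !ring0 !subrr.
rewrite /rest !ringS addrAC -/(rest j k _) IH [in RHS]addrAC; congr (_ + _).
by rewrite /gap /set_coord ifF//; apply/negbTE/eqP => -[].
Qed.

Let measurable_rest j k : measurable_fun setT (rest j k).
Proof.
apply: measurable_funB; last exact: measurable_coord.
apply: measurable_sum => i; exact: measurable_coord.
Qed.

Lemma ae_ring_neq (t : R) : {ae M, forall w, forall j k, ring w j k != t}.
Proof.
apply: ae_forall_countable => j; apply: ae_forall_countable => k.
have := @ae_coord_neq j (fun w => t - rest j k w).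
have mg : measurable_fun setT (fun w => t - rest j k w).
  by apply: measurable_funB => //; exact: measurable_rest.
move=> /(_ mg) h; have : {ae M, forall w, gap w j 0 != t - rest j k w}.
  by apply: h => w s; rewrite rest_set_coord.
apply: filterS => w; apply: contra => /eqP; rewrite /rest => <-.
by apply/eqP; rewrite opprB addrC subrK.
Qed.

Lemma ae_distinct_rings : {ae M, forall w, distinct_rings w}.
Proof.
apply: ae_forall_countable => i; apply: ae_forall_countable => j.
apply: ae_forall_countable => k; apply: ae_forall_countable => n.
have [ij|ij] := eqVneq i j; first exact: aeW.
have mg : measurable_fun setT (fun w : Om => ring w j n - rest i k w).
  apply: measurable_funB; last exact: measurable_rest.
  apply: measurable_sum => l; exact: measurable_coord.
have : {ae M, forall w, gap w i 0 != ring w j n - rest i k w}.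
  apply: (ae_coord_neq mg) => w s; rewrite rest_set_coord; congr (_ - _).
  apply: eq_bigr => l _; rewrite /gap /set_coord ifF//.
  by apply/negbTE/eqP => -[ji]; move: ij; rewrite ji eqxx.
apply: filterS => w h _; apply: contra h => /eqP; rewrite /rest => <-.
by apply/eqP; rewrite opprB addrC subrK.
Qed.

Lemma ae_positive_gaps : {ae M, forall w, positive_gaps w}.
Proof.
apply: ae_forall_countable => j; apply: ae_forall_countable => k.
pose c : NI := inl (j, k).
exists (box [fset c]%fset (fun=> `]-oo, 0]%classic)); split.
- by apply: measurable_box => _; exact: measurable_itv.
- apply: (etrans (ML _ _)); first by move=> _; exact: measurable_itv.
  by rewrite big_seq_fset1; exact: (exponential_law_le0 (nu_gap _)).
- move=> w /= /negP; rewrite -leNgt => h i; rewrite inE => /eqP ->.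
  by rewrite /= in_itv.
Qed.

(** The probability that k given clocks are silent up to time t is exp(- k t), which vanishes as k
    grows. *)
Lemma ae_infinite_rings (S : set L) : infinite_set S ->
  {ae M, forall w : Om, forall s, 0 < s -> exists2 i, S i & gap w i 0 <= s}.
Proof.
move=> Sinf.
suff h (n : nat) : {ae M, forall w : Om, ~ forall i, S i -> n.+1%:R^-1 < gap w i 0}.
  have : {ae M, forall w : Om, forall n : nat, ~ forall i, S i -> n.+1%:R^-1 < gap w i 0}.
    by apply/ae_foralln => n; exact: h.
  apply: filterS => w hw s s0.
  apply: contrapT => none; apply: (hw (Num.truncn s^-1)) => i Si.
  apply: (@lt_trans _ _ s).
    by rewrite -[ltRHS]invrK ltf_pV2 ?posrE ?invr_gt0// truncnS_gt.
  by rewrite ltNge; apply/negP => g; apply: none; exists i.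
set t : R := n.+1%:R^-1; have t0 : 0 < t by rewrite invr_gt0.
pose Z (F : seq L) := [set w : Om | all (fun i => t < gap w i 0) F].
have mZ F : measurable (Z F).
  have := @measurable_all _ Om L F (fun w i => t < gap w i 0).
  move=> /(_ _ measurableT [set true] (Logic.I : measurable [set true])).
  rewrite setTI; move=> h.
  rewrite (_ : Z F = (fun w : Om => all (fun i => t < gap w i 0) F) @^-1` [set true])//.
  by apply: h => i; apply: measurable_fun_ltr => //; exact: measurable_coord.
have MZ F : uniq F -> M (Z F) = (expR (- ((size F)%:R * t)))%:E.
  move=> uF; rewrite -(integral_no_ring nu_gap ML uF (ltW t0)).
  transitivity (\int[M]_w (\1_(Z F) w)%:E)%E.
    by rewrite integral_indic// setIT.
  apply: eq_integral => w _; rewrite indicE; congr EFin.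
  have -> : (w \in Z F) = all (fun i => t < gap w i 0) F.
    by apply/idP/idP; rewrite inE.
  by case: all.
pose Q k := Z [seq i <- sites L k | i \in S].
exists (\bigcap_k Q k); split.
- by apply: bigcap_measurableType => // k _; exact: mZ.
- apply/eqP; rewrite eq_le measure_ge0 andbT.
  apply/lee_addgt0Pr => e e0; rewrite add0e.
  have [m hm] : exists m : nat, expR (- (m%:R * t)) <= e.
    exists (Num.truncn (e^-1 / t)).+1.
    rewrite expRN -[leRHS]invrK lef_pV2 ?posrE ?invr_gt0 ?expR_gt0//.
    apply: (@le_trans _ _ ((Num.truncn (e^-1 / t)).+1%:R * t)).
      rewrite -ler_pdivrMr//; exact/ltW/truncnS_gt.
    apply: le_trans (expR_ge1Dx _); by rewrite lerDr.
  have [B BS Bm] := infinite_set_fset m Sinf.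
  pose k := (\max_(i <- enum_fset B) choice.pickle i).+1.
  have BQ : Q k `<=` Z (enum_fset B).
    move=> w /allP h; apply/allP => i iB; apply: h.
    rewrite mem_filter mem_sites ltnS leq_bigmax_seq// andbT inE.
    exact: BS.
  apply: (@le_trans _ _ (M (Z (enum_fset B)))).
    apply: le_measure; rewrite ?inE//; first by apply: bigcap_measurableType => // l _; exact: mZ.
    by move=> w Qw; apply: BQ; exact: Qw.
  rewrite MZ ?fset_uniq// lee_fin; apply: le_trans hm.
  by rewrite ler_expR lerN2 ler_pM2r// ler_nat.
- move=> w /= /contrapT h k _; apply/allP => i; rewrite mem_filter => /andP[/set_mem Si _].
  exact: h.
Qed.

End almost_surely.

(** * The interacting particle system *)

Lemma image_law d d' (X : measurableType d) (Y : measurableType d') (R : realType)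
  (m : probability X R) (f : X -> Y) : measurable_fun setT f ->
  exists nu : probability Y R, forall B, nu B = m (f @^-1` B).
Proof.
move=> mf; pose mixin := isMeasurableFun.Build _ _ _ _ _ mf.
pose pack : {mfun X >-> Y} := HB.pack f mixin.
by exists (distribution m pack).
Qed.

Lemma ge0_integral_image_law d d' (X : measurableType d) (Y : measurableType d') (R : realType)
  (m : {measure set X -> \bar R}) (m' : {measure set Y -> \bar R}) (f : X -> Y) (g : Y -> \bar R) :
  measurable_fun setT f -> (forall B, measurable B -> m' B = m (f @^-1` B)) ->
  measurable_fun setT g -> (forall y, 0 <= g y)%E ->
  (\int[m']_y g y = \int[m]_x g (f x))%E.
Proof.
move=> mf mm' mg g0; transitivity (\int[pushforward m f]_y g y)%E; last first.
  by rewrite ge0_integral_pushforward.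
by apply: eq_measure_integral => B mB _; exact: mm'.
Qed.

Section noise.
Context (R : realType) d (T : measurableType d) (Pr : probability T R) (L : countType).
Context (E U : L -> nat -> {RV Pr >-> R}).
Local Notation NI := (noise_index L).
Local Notation Om := (real_product R (noise_index L)).

Definition noise (w : T) : Om :=
  fun i => match i with inl (j, k) => E j k w | inr (j, k) => U j k w end.

Lemma measurable_noise : measurable_fun setT noise.
Proof. by apply: measurable_fun_real_product => -[[j k]|[j k]]; exact: measurable_funP. Qed.

Lemma ring_noise (w : T) : ring (noise w) = ring_time E w.
Proof. by []. Qed.

Definition driving_law (i : NI) : probability R R :=
  distribution Pr (match i with inl (j, k) => E j k | inr (j, k) => U j k end).

Lemma noise_product_law : driving_noise E U -> exists M : probability Om R,
  (forall B, M B = Pr (noise @^-1` B)) /\ product_law driving_law M.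
Proof.
move=> [_ _ ind]; have [M ME] := image_law Pr measurable_noise.
exists M; split=> // J B mB; rewrite ME.
have -> : (\prod_(i <- J) driving_law i (B i))%E = _ := esym (ind J B mB).
by congr (Pr _); apply/seteqP; split => w /= h i /h; rewrite /noise; case: i => -[].
Qed.

End noise.

Section process.
Context (R : realType) d (T : measurableType d) (Pr : probability T R).
Context dA (A : finTBOrderType dA) (L : countType) (N : L -> set L).
Context (P : forall j : L, (N j -> A) -> A -> R).
Context (E U : L -> nat -> {RV Pr >-> R}).
Hypotheses (PT : is_transition_matrix P) (dn : driving_noise E U) (cs : causal E N).
Local Notation config := (config L A).
Local Notation noise := (noise E U).
Local Notation Om := (real_product R (noise_index L)).

Let law_gap jk B : measurable B -> driving_law E U (inl jk) B = exponential_prob 1 B.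
Proof. by case: jk => j k mB; case: dn => h _ _; exact: h. Qed.

Let law_dice jk B : measurable B -> driving_law E U (inr jk) B = uniform_prob (@ltr01 R) B.
Proof. by case: jk => j k mB; case: dn => _ h _; exact: h. Qed.

Let ae_noise (Q : Om -> Prop) :
  (forall M : probability Om R, product_law (driving_law E U) M -> {ae M, forall w, Q w}) ->
  {ae Pr, forall w, Q (noise w)}.
Proof.
move=> h; have [M [ME ML]] := noise_product_law dn.
by apply: (ae_preimage (measurable_noise E U) _ (h M ML)) => B _; exact: ME.
Qed.

(** The explored set only grows, so that an exploration which has absorbed S can end only before
    the first ring in S. *)
Lemma reaches0_first_ring (w : Om) s K S : positive_gaps w -> reaches0 N (ring w) s K ->
  S `<=` K -> 0 < s -> exists2 s', 0 < s' & forall i, S i -> s' <= gap w i 0.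
Proof.
move=> w0; elim=> {s K} [s K h|s K i k Ki /andP[i0 _] _ _ IH] SK s0.
  exists s => // i /SK Ki; have := h i 0%N Ki.
  by rewrite ring_gt0//= -leNgt ring0.
by apply: IH => // j /SK; left.
Qed.

(** Causality enforces finiteness. If j rings before time 1, the exploration from j must absorb
    N j; if this set were infinite, it would almost surely contain clocks that ring arbitrarily
    early, and time 0 would never be reached. But j rings before time 1 with positive
    probability. *)
Lemma finite_neighbourhood (j : L) : finite_set (N j).
Proof.
apply: contrapT => Ninf; have [M [ME ML]] := noise_product_law dn.
have a1 := ae_noise (fun M ML => ae_infinite_rings law_gap ML Ninf).
have a2 := ae_noise (fun M ML => ae_positive_gaps law_gap ML).
have a3 := cs j (@ler01 R).
have lt1 : {ae Pr, forall w, 2^-1 < gap (noise w) j 0}.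
  apply: filterS3 a1 a2 a3 => w h1 w0 h3; rewrite ltNge; apply/negP => g1.
  move: h3; rewrite -/(ring_time E w) -(ring_noise E U).
  have g1' : ring (noise w) j 0 < 1.
    by rewrite ring0 (le_lt_trans g1)// invf_lt1 ?ltr1n.
  move e1 : 1 => s; move eK : [set j] => K r.
  case: r e1 eK => {s K} [s K h|s K i k Ki /andP[i0 i1] _ r] e1 eK; subst s K.
    have := h j 0%N erefl; rewrite ring_gt0//= g1'//.
  have [s' s'0 hs'] := reaches0_first_ring w0 r (@subsetUr _ _ _) i0.
  have ij : i = j by [].
  subst i; have [|i Ni] := h1 (s' / 2); first by rewrite divr_gt0.
  rewrite leNgt => /negP; apply.
  by apply: lt_le_trans (hs' i Ni); rewrite ltr_pdivrMr// ltr_pMr// ltr1n.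
have := integral_no_ring law_gap ML (erefl : uniq [:: j]) (ltW (_ : 0 < 2^-1 :> R)).
rewrite invr_gt0 ltr0n => /(_ isT).
rewrite -(integral_noise (measurable_noise E U) (fun B _ => ME B)); last 2 first.
- apply/measurable_EFinP/measurable_fun_ifT; [|exact: measurable_cst..].
  apply: measurable_all => i; apply: measurable_fun_ltr => //.
  exact: measurable_coord.
- by move=> w; rewrite lee_fin; case: ifP.
have mg : measurable_fun setT (fun w : T => (if all (fun i => 2^-1 < gap (noise w) i 0) [:: j]
    then 1 else 0)%:E : \bar R).
  apply/measurable_EFinP/measurable_fun_ifT; [|exact: measurable_cst..].
  apply: measurable_all => i; apply: measurable_fun_ltr => //.
rewrite (ae_eq_integral (fun=> 1%E)) => [|//|//|//|]; last first.
  by apply: filterS lt1 => w h _ /=; rewrite h.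
rewrite [LHS](_ : _ = 1%E); last by rewrite integral_cst// mul1e; exact: probability_setT.
move=> -[] h; have : expR (- (1 * 2^-1)) < 1 :> R.
  by rewrite expR_lt1 mul1r oppr_lt0 invr_gt0 ltr0n.
by rewrite -h ltxx.
Qed.

Lemma ae_regular_noise : {ae Pr, forall w, regular_noise N (noise w)}.
Proof.
have a1 := ae_noise (fun M ML => ae_positive_gaps law_gap ML).
have a2 := ae_noise (fun M ML => ae_distinct_rings law_gap ML).
have a3 : {ae Pr, forall w, forall (n : nat) (j : L), reaches0 N (ring_time E w) n%:R [set j]}.
  apply/ae_foralln => n; apply: ae_forall_countable => j.
  by apply: cs; rewrite ler0n.
by apply: filterS3 a1 a2 a3 => w h1 h2 h3; split.
Qed.

Let ae_snd (mu : probability config R) (Q : T -> Prop) :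
  {ae Pr, forall w, Q w} -> {ae (mu \x Pr)%E, forall z, Q z.2}.
Proof.
apply: ae_preimage; first exact: measurable_snd.
move=> B mB; rewrite (_ : snd @^-1` B = setT `*` B); last first.
  by apply/seteqP; split => [[x w]|[x w] []].
transitivity (mu setT * Pr B)%E; first by rewrite probability_setT mul1e.
by apply/esym/product_probability1E.
Qed.

Lemma is_IPS_right_state (mu : probability config R) :
  is_IPS E U P mu (fun t z => right_state P t z.1 (noise z.2)).
Proof.
split.
  move=> t _; apply: (measurable_right_state (s := fun=> t) (x := fst)
    (w := fun z => noise z.2) P finite_neighbourhood) => //.
  exact: (measurableT_comp (measurable_noise E U) measurable_snd).
apply: filterS (ae_snd mu ae_regular_noise) => -[x w] /= wok.
exact: (right_state_evolves P finite_neighbourhood wok x).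
Qed.

Lemma is_IPS_full_state (mu : probability config R) zeta t : 0 <= t ->
  is_IPS E U P mu zeta ->
  {ae (mu \x Pr)%E, forall z, zeta t z = full_state P t z.1 (noise z.2)}.
Proof.
move=> t0 [_ ev]; have aok := ae_snd mu ae_regular_noise.
move: t0; rewrite le_eqVlt => /predU1P[<-|t0].
  apply: filterS2 aok ev => -[x w] /= wok [z0 _ _]; rewrite z0.
  have [w0 _ _] := wok; apply/funext => j; rewrite full_state_eq//; last exact: finite_neighbourhood.
  rewrite (_ : ring_count _ j 0 = 0%N)//.
  by apply: ring_count_eq => //; [exact: regular_noise_finite wok|rewrite ltW ?ring_gt0].
have an := ae_snd mu (ae_noise (fun M ML => ae_ring_neq law_gap ML t)).
apply: filterS3 aok an ev => -[x w] /= wok nt ev.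
exact: (evolves_no_ring (P := P) finite_neighbourhood wok ev t0 nt).
Qed.

(** All realizations of the process agree almost surely at time t with the constructed one, so
    that the law which evolve chooses is the law of the latter. *)
Lemma evolve_spec (mu : probability config R) t B : 0 <= t -> measurable B ->
  evolve E U P mu t B = (mu \x Pr)%E [set z | B (full_state P t z.1 (noise z.2))].
Proof.
move=> t0 mB; rewrite /evolve; set S := [set nu | _].
have mfull : measurable_fun setT (fun z : config * T => full_state P t z.1 (noise z.2)).
  apply: (measurable_full_state (s := fun=> t) (x := fst)
    (w := fun z => noise z.2) P finite_neighbourhood) => //.
  exact: (measurableT_comp (measurable_noise E U) measurable_snd).
have [zeta [ips ->//]] : S (get S).
  apply: getPex; have ips := is_IPS_right_state mu.
  have [nu nuE] := image_law (mu \x Pr)%E (ips.1 t t0).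
  by exists nu; exists (fun t z => right_state P t z.1 (noise z.2)); split => // C _.
have mz := ips.1 t t0.
have m1 : measurable (zeta t @^-1` B) by rewrite -[X in measurable X]setTI; exact: mz.
have m2 : measurable [set z : config * T | B (full_state P t z.1 (noise z.2))].
  by have := mfull measurableT B mB; rewrite setTI.
have [Z [mZ Z0 hZ]] := is_IPS_full_state t0 ips.
have le_ae (B1 B2 : set (config * T)) : measurable B1 -> measurable B2 ->
    B1 `<=` B2 `|` Z -> ((mu \x Pr) B1 <= (mu \x Pr) B2)%E.
  move=> mB1 mB2 B12; apply: (@le_trans _ _ ((mu \x Pr) (B2 `|` Z))%E).
    by apply: le_measure; rewrite ?inE//; exact: measurableU.
  apply: le_trans (measureU2 _ _ _) _ => //.
  by rewrite [X in (_ + X <= _)%E]Z0 adde0.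
apply/eqP; rewrite eq_le; apply/andP; split; apply: le_ae => // z /= Bz.
  have [e|ne] := pselect (zeta t z = full_state P t z.1 (noise z.2)).
    by left; rewrite /= -e.
  by right; apply: hZ.
have [e|ne] := pselect (zeta t z = full_state P t z.1 (noise z.2)).
  by left; rewrite /= e.
by right; apply: hZ.
Qed.

End process.

(** * The space of configurations *)

Section topology.
Context (L : countType) dA (A : finTBOrderType dA).
Local Notation config := (config L A).
Local Notation ptws := {ptws L -> discrete_topology A}.

Definition is_local (B : set config) := exists m, local_set (sites L m) B.

Lemma cvg_sites (F : set_system ptws) (p : ptws) : Filter F ->
  F --> p <-> forall m, \forall x \near F, map (x : config) (sites L m) = map (p : config) (sites L m).
Proof.
move=> FF.
have cvgP : F --> p <-> forall j : L, \forall x \near F, x j = p j.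
  rewrite (@pointwise_cvgP (discrete_topology L) (discrete_topology A) F p).
  split => h j; first by have /discrete_cvg := h j.
  by apply/discrete_cvg; exact: h.
rewrite cvgP; split => [h m|h j].
  elim: (sites L m) => [|j s IH]; first exact: nearW.
  by apply: filterS2 (h j) IH => x /= -> ->.
by apply: filterS (h (choice.pickle j).+1) => x /agree_site; apply.
Qed.

Lemma near_sites (p : ptws) m :
  \forall x \near p, map (x : config) (sites L m) = map (p : config) (sites L m).
Proof.
have h : nbhs p --> p by exact: cvg_id.
by have := (@cvg_sites _ p (nbhs_filter p)).1 h m.
Qed.

Lemma nbhs_sites (p : ptws) (V : set ptws) : nbhs p V ->
  exists m, forall x : ptws, map (x : config) (sites L m) = map (p : config) (sites L m) -> V x.
Proof.
move=> pV; apply: contrapT => none.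
have {}none m : exists x : ptws, map (x : config) (sites L m) = map (p : config) (sites L m) /\ ~ V x.
  apply: contrapT => h; apply: none; exists m => x xp; apply: contrapT => nV.
  by apply: h; exists x.
have [xs hxs] := choice none.
have : (fun n => xs n) @ \oo --> p.
  apply/cvg_sites => m; exists m => // n /= mn.
  exact: agree_sites mn (hxs n).1.
by move=> /(_ V pV) [n _ /(_ n (leqnn n))]; have [_] := hxs n.
Qed.

Lemma ptws_compact : compact [set: ptws].
Proof.
have := @tychonoff L (fun=> discrete_topology A) (fun=> setT)
  (fun=> @finite_compact (discrete_topology A) setT (@finite_finset A setT)).
by congr compact; apply/seteqP.
Qed.

(** Tychonoff: the space of configurations is compact. *)
Lemma cluster_config (xs : nat -> config) : exists p : config, forall m k, exists n,
  (k <= n)%N /\ map (xs n) (sites L m) = map p (sites L m).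
Proof.
have := @ptws_compact ((xs : nat -> ptws) @ \oo) _ filterT.
move=> [p [_ clp]]; exists p => m k.
have FA : ((xs : nat -> ptws) @ \oo) (xs @` [set n | (k <= n)%N]).
  by exists k => // n kn; exists n.
have [x [[n kn <-] h]] := clp _ _ FA (near_sites p m).
by exists n.
Qed.

Lemma is_local_le m n (B : set config) : (m <= n)%N ->
  local_set (sites L m) B -> local_set (sites L n) B.
Proof. by move=> mn lB y z /(agree_sites mn); exact: lB. Qed.

(** Local sets are closed in a compact space. *)
Lemma local_compact (C : nat -> set config) : (forall n, is_local (C n)) ->
  (forall n, C n.+1 `<=` C n) -> (forall n, C n !=set0) -> (\bigcap_n C n) !=set0.
Proof.
move=> lC dC nC; have [xs hxs] := choice nC.
have dec m n : (m <= n)%N -> C n `<=` C m.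
  move=> /subnK <-; elim: (n - m)%N => // k IH; rewrite addSn.
  by apply: subset_trans IH; exact: dC.
have [p hp] := cluster_config xs; exists p => k _.
have [m lm] := lC k; have [n [kn e]] := hp m k.
by apply: (lm _ _ e); apply: dec kn _ _.
Qed.

Lemma is_local0 : is_local set0.
Proof. by exists 0%N. Qed.

Lemma is_localC B : is_local B -> is_local (~` B).
Proof. by move=> [m lB]; exists m => y z yz nB; apply: contra_not nB; apply: lB. Qed.

Lemma is_localU B C : is_local B -> is_local C -> is_local (B `|` C).
Proof.
move=> [m lB] [n lC]; exists (maxn m n) => y z yz [yB|yC]; [left|right].
  exact: (is_local_le (leq_maxl _ _) lB yz).
exact: (is_local_le (leq_maxr _ _) lC yz).
Qed.

Lemma is_localI B C : is_local B -> is_local C -> is_local (B `&` C).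
Proof.
by move=> lB lC; rewrite -[X in is_local X]setCK setCI; apply/is_localC/is_localU; exact: is_localC.
Qed.

Lemma is_localD B C : is_local B -> is_local C -> is_local (B `\` C).
Proof. by move=> lB lC; rewrite setDE; apply: is_localI => //; exact: is_localC. Qed.

Lemma is_local_site j (S : set A) : is_local [set x : config | S (x j)].
Proof.
exists (choice.pickle j).+1 => y z yz /=.
by rewrite (agree_site (leqnn _) yz).
Qed.

Lemma is_local_measurable B : is_local B -> measurable B.
Proof. by move=> [m lB]; exact: measurable_local_set lB. Qed.

Context (R : realType).

(** Uniform continuity, in terms of finite windows. *)
Definition window_continuous (f : config -> R) := forall e, 0 < e -> exists m, forall y z,
  map y (sites L m) = map z (sites L m) -> `|f y - f z| <= e.

Lemma continuous_window (f : ptws -> R) : continuous f -> window_continuous f.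
Proof.
move=> cf e e0.
(* If f oscillates by more than e on every window, some p has windows of every size around it
   on which f oscillates by more than e. *)
pose C m := [set y : config | forall k, (k <= m)%N ->
  exists z z' : config, [/\ map z (sites L k) = map y (sites L k),
    map z' (sites L k) = map y (sites L k) & e < `|f z - f z'|]].
have lC m : is_local (C m).
  exists m => y y' yy' Cy k km; have [z [z' [h1 h2 h3]]] := Cy k km.
  by exists z, z'; rewrite -(agree_sites km yy').
have [[m Cm]|none] := pselect (exists m, C m = set0).
  exists m => y z yz; rewrite leNgt; apply/negP => h.
  suff : C m y by rewrite Cm.
  by move=> k km; exists y, z; split => //; rewrite -(agree_sites km yz).
have [||p Cp] := local_compact lC.
- by move=> n y Cy k kn; apply: Cy; exact: leqW.
- by move=> n; apply/set0P/eqP => Cn; apply: none; exists n.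
have e20 : 0 < e / 2 by rewrite divr_gt0.
have pV : nbhs (p : ptws) [set x : ptws | `|f p - f x| < e / 2].
  by move/cvgrPdist_lt : (cf p) => /(_ _ e20).
have [k hk] := nbhs_sites pV.
have [z [z' [/hk h1 /hk h2]]] := Cp k Logic.I k (leqnn k).
rewrite ltNge => /negP []; rewrite -(subrKA (f p)).
apply: le_trans (ler_normD _ _) _; rewrite [leRHS](splitr e).
by rewrite lerD// ltW// distrC.
Qed.

Lemma local_continuous (m : nat) (f : ptws -> R) : local_fun (sites L m) f -> continuous f.
Proof.
move=> lf p V /nbhs_singleton Vfp.
have h : nbhs p [set x : ptws | f x = f p].
  by apply: (@filterS _ _ (nbhs_filter p)) (near_sites p m) => x; exact: lf.
by apply: (@filterS _ _ (nbhs_filter p)) h => x /= fx; rewrite /= fx.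
Qed.

Definition increasing (B : set config) := forall y z, B y -> config_le y z -> B z.

(** To see the letter a at the site j is to see at least a but not more than a. So the
    configurations prescribed on a window form a set obtained from increasing local sets by
    proper differences, and a local set is a finite disjoint union of these. *)
Lemma increasing_induction (Phi : set config -> Prop) :
  (forall B, is_local B -> increasing B -> Phi B) ->
  (forall B C, is_local B -> is_local C -> C `<=` B -> Phi B -> Phi C -> Phi (B `\` C)) ->
  (forall B C, is_local B -> is_local C -> B `&` C = set0 -> Phi B -> Phi C -> Phi (B `|` C)) ->
  forall B, is_local B -> Phi B.
Proof.
move=> Pinc PD PU.
have lag (s : seq L) (t : seq A) : is_local [set x : config | map x s = t].
  elim: s t => [|j s IH] [|a t].
  - by exists 0%N.
  - by exists 0%N.
  - by exists 0%N.
  rewrite (_ : [set _ | _] = [set x : config | x j = a] `&` [set x : config | map x s = t]).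
    by apply: is_localI => //; exact: (is_local_site j [set a]).
  by apply/seteqP; split => [x /= []|x /= [-> ->]].
have P0 : Phi set0 by apply: Pinc => //; exact: is_local0.
have Ppt (s : seq L) (t : seq A) B : is_local B -> increasing B ->
    Phi (B `&` [set x : config | map x s = t]).
  elim: s t B => [|j s IH] [|a t] B lB iB.
  - by rewrite (_ : [set _ | _] = setT) ?setIT; [exact: Pinc|apply/seteqP; split].
  - by rewrite (_ : [set _ | _] = set0) ?setI0//; apply/seteqP; split.
  - by rewrite (_ : [set _ | _] = set0) ?setI0//; apply/seteqP; split.
  pose G := B `&` [set x : config | (a <= x j)%O].
  pose H := B `&` [set x : config | (a < x j)%O].
  have lG : is_local G by apply: is_localI => //; exact: (is_local_site j [set b | (a <= b)%O]).
  have lH : is_local H by apply: is_localI => //; exact: (is_local_site j [set b | (a < b)%O]).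
  have iG : increasing G.
    by move=> y z [By ay] yz; split; [exact: iB By yz|exact: le_trans ay (yz j)].
  have iH : increasing H.
    by move=> y z [By ay] yz; split; [exact: iB By yz|exact: lt_le_trans ay (yz j)].
  rewrite (_ : _ `&` _ = (G `&` [set x : config | map x s = t]) `\` (H `&` [set x : config | map x s = t])).
    apply: PD; [exact: is_localI|exact: is_localI| |exact: IH|exact: IH].
    by move=> x [[Bx /ltW ax] xt].
  apply/seteqP; split => [x [Bx /= [xa xt]]|x [[[Bx ax] xt] nH]].
    by split; [rewrite /G /= xa|move=> [[_]] /=; rewrite xa ltxx].
  split => //=; congr (_ :: _) => //; apply/eqP; rewrite eq_le ax andbT leNgt.
  by apply/negP => h; apply: nH.
move=> B [m lB].
pose Tm : finType := (size (sites L m)).-tuple A.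
pose ok (t : Tm) := `[< exists2 y, B y & map y (sites L m) = t >].
pose G (r : seq Tm) := [set x : config | exists2 t : Tm, t \in r & map x (sites L m) = t].
have -> : B = G (seq.filter ok (enum Tm)).
  apply/seteqP; split => [x Bx|x [t]].
    exists (map_tuple x (in_tuple (sites L m))) => //=.
    by rewrite mem_filter mem_enum andbT; apply/asboolP; exists x.
  by rewrite mem_filter => /andP[/asboolP[y By yt] _] xt; apply: (lB y) => //; rewrite yt xt.
suff h r : uniq r -> Phi (G r) /\ is_local (G r).
  by have [] := h _ (filter_uniq ok (enum_uniq Tm)).
elim: r => [_|t r IH /=].
  rewrite (_ : G [::] = set0); first by split => //; exact: is_local0.
  by apply/seteqP; split => x // [].
move=> /andP[tr /IH[Pr lr]].
have -> : G (t :: r) = [set x : config | map x (sites L m) = t] `|` G r.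
  apply/seteqP; split => x => [[u]|[xt|[u ur xu]]].
  - by rewrite inE => /predU1P[->|ur] xu; [left|right; exists u].
  - by exists t => //; rewrite inE eqxx.
  - by exists u => //; rewrite inE ur orbT.
split; last exact: is_localU.
apply: PU => //.
  apply/seteqP; split => // x [/= xt [u ur xu]].
  by move: tr; rewrite (_ : t = u) ?ur//; apply: val_inj; rewrite /= -xt -xu.
by rewrite -[X in Phi X]setTI; apply: Ppt => //; rewrite -setC0; exact/is_localC/is_local0.
Qed.

End topology.

(** * The semigroup of the infinite system *)

Section settled_window.
Context (R : realType) (L : countType) (N : L -> set L).
Context dA (A : finTBOrderType dA).
Variable P : forall j : L, (N j -> A) -> A -> R.
Hypothesis Nfin : forall j, finite_set (N j).
Local Notation config := (config L A).
Local Notation Om := (real_product R (noise_index L)).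

(** The window n0 serves both as stage of stabilization and as window of dependence. *)
Lemma settled_window (w : Om) (t : R) (s : seq L) : regular_noise N w ->
  exists n0, forall n (y y' : config), (n0 <= n)%N ->
    map y (sites L n0) = map y' (sites L n0) ->
    map (finite_state P (sites L n) t y w) s = map (full_state P t y' w) s.
Proof.
move=> wok; elim: s => [|j s [n1 h1]]; first by exists 0%N.
have [n2 h2] := regular_noise_settled P Nfin t j wok.
exists (maxn n1 n2) => n y y' nn yy' /=; congr (_ :: _).
  apply: (settled_full h2); first exact: leq_trans (leq_maxr _ _) nn.
  exact: agree_sites (leq_maxr _ _) yy'.
apply: h1; first exact: leq_trans (leq_maxl _ _) nn.
exact: agree_sites (leq_maxl _ _) yy'.
Qed.

Lemma full_state_local (w : Om) (t : R) (s : seq L) : regular_noise N w ->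
  exists n0, forall (y y' : config), map y (sites L n0) = map y' (sites L n0) ->
    map (full_state P t y w) s = map (full_state P t y' w) s.
Proof.
move=> wok; have [n0 h] := settled_window t s wok.
exists n0 => y y' yy'; rewrite -(h n0 y y' (leqnn _) yy').
by rewrite (h n0 y y (leqnn _) erefl).
Qed.

End settled_window.

Section bounded.
Context d (T : measurableType d) (R : realType) (Pr : probability T R).
Implicit Types g h : T -> R.

Lemma unit_integral_itv g : measurable_fun setT g -> (forall w, 0 <= g w <= 1) ->
  (0 <= \int[Pr]_w (g w)%:E <= 1)%E.
Proof.
move=> mg g01; apply/andP; split.
  by apply: integral_ge0 => w _; rewrite lee_fin; case/andP: (g01 w).
rewrite -[leRHS](_ : \int[Pr]_w 1 = 1)%E; last first.
  by rewrite integral_cst// mul1e; exact: probability_setT.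
apply: ge0_le_integral => //.
- by move=> w _; rewrite lee_fin; case/andP: (g01 w).
- exact/measurable_EFinP.
- by move=> w _; rewrite lee_fin; case/andP: (g01 w).
Qed.

Lemma unit_integral_fin g : measurable_fun setT g -> (forall w, 0 <= g w <= 1) ->
  (\int[Pr]_w (g w)%:E)%E \is a fin_num.
Proof.
move=> mg g01; have /andP[h0 h1] := unit_integral_itv mg g01.
by rewrite ge0_fin_numE// (le_lt_trans h1) ?ltry.
Qed.

Lemma unit_integral_cvg (g_ : nat -> T -> R) g :
  (forall n, measurable_fun setT (g_ n)) -> measurable_fun setT g ->
  (forall n w, 0 <= g_ n w <= 1) ->
  {ae Pr, forall w, g_ n w @[n --> \oo] --> g w} ->
  (\int[Pr]_w (g_ n w)%:E @[n --> \oo] --> \int[Pr]_w (g w)%:E)%E.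
Proof.
move=> mg_ mg g01 cg.
have [] := @dominated_convergence _ _ _ Pr setT measurableT
  (fun n w => (g_ n w)%:E) (fun w => (g w)%:E) (fun=> 1%E) => //.
- by move=> n; exact/measurable_EFinP.
- exact/measurable_EFinP.
- by apply: filterS cg => w h _; apply: cvg_EFin => //; exact: nearW.
- exact: finite_measure_integrable_cst.
- by apply: aeW => w n _; rewrite lee_fin ger0_norm; have /andP[] := g01 n w.
Qed.

Lemma unit_integral_fine_cvg (g_ : nat -> T -> R) g :
  (forall n, measurable_fun setT (g_ n)) -> measurable_fun setT g ->
  (forall n w, 0 <= g_ n w <= 1) -> (forall w, 0 <= g w <= 1) ->
  {ae Pr, forall w, g_ n w @[n --> \oo] --> g w} ->
  fine (\int[Pr]_w (g_ n w)%:E)%E @[n --> \oo] --> fine (\int[Pr]_w (g w)%:E)%E.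
Proof.
move=> mg_ mg g_01 g01 cg; apply: fine_cvg.
by rewrite fineK ?unit_integral_fin//; exact: unit_integral_cvg.
Qed.

End bounded.

Section limit_semigroup.
Context (R : realType) d (T : measurableType d) (Pr : probability T R).
Context dA (A : finTBOrderType dA) (L : countType) (N : L -> set L).
Context (P : forall j : L, (N j -> A) -> A -> R).
Context (E U : L -> nat -> {RV Pr >-> R}).
Hypotheses (PT : is_transition_matrix P) (dn : driving_noise E U) (cs : causal E N).
Local Notation config := (config L A).
Local Notation noise := (noise E U).
Local Notation Om := (real_product R (noise_index L)).
Implicit Types (f : config -> R) (x y : config) (s t : R).

Let Nfin := finite_neighbourhood dn cs.

(** The semigroup of the infinite system. *)
Definition mean_state t f x : R := fine (\int[Pr]_w (f (full_state P t x (noise w)))%:E)%E.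

Lemma measurable_full_noise t x : measurable_fun setT (fun w => full_state P t x (noise w)).
Proof.
apply: (measurable_full_state (s := fun=> t) (x := fun=> x) (w := noise) P Nfin) => //.
exact: measurable_noise.
Qed.

Lemma measurable_finite_noise F t (x : T -> config) : measurable_fun setT x ->
  measurable_fun setT (fun w => finite_state P F t (x w) (noise w)).
Proof.
move=> mx.
apply: (measurable_finite_state (s := fun=> t) (x := x) (w := noise) P Nfin F) => //.
exact: measurable_noise.
Qed.

Lemma mean_stateE t f x : measurable_fun setT f -> unit_valued f ->
  ((mean_state t f x)%:E = \int[Pr]_w (f (full_state P t x (noise w)))%:E)%E.
Proof.
move=> mf f01; rewrite fineK// unit_integral_fin//.
exact: (measurableT_comp mf (measurable_full_noise _ _)).
Qed.

Lemma unit_valued_mean_state t f : measurable_fun setT f -> unit_valued f ->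
  unit_valued (mean_state t f).
Proof.
move=> mf f01 x; rewrite -!lee_fin mean_stateE//.
apply: unit_integral_itv => //.
exact: (measurableT_comp mf (measurable_full_noise _ _)).
Qed.

Lemma semigroup_series0 (F : seq L) f x : unit_valued f -> semigroup_series P F 0 f x = (f x)%:E.
Proof.
move=> f01; rewrite /semigroup_series nneseries_recl//; last first.
  move=> n; rewrite lee_fin mulr_ge0 ?ring_weight_ge0// iter_gen_ge0//.
  exact: unit_valued_ge0.
rewrite [X in (_ + X)%E]eseries0 ?adde0; last first.
  by case=> // n _ _; rewrite /ring_weight expr0n/= mul0r mulr0 mul0r.
by rewrite /ring_weight mulr0 oppr0 expR0 expr0 divr1 !mul1r.
Qed.

Lemma finite_law (F : seq L) t f x : uniq F -> 0 <= t -> measurable_fun setT f ->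
  unit_valued f ->
  (\int[Pr]_w (f (finite_state P F t x (noise w)))%:E)%E = semigroup_series P F t f x.
Proof.
move=> uF t0 mf f01.
have mfs : measurable_fun setT (f \o (fun w => finite_state P F t x (noise w))).
  by apply: measurableT_comp => //; exact: measurable_finite_noise.
have ok := ae_regular_noise dn cs.
move: t0; rewrite le_eqVlt => /predU1P[t0|t0].
  subst t; rewrite semigroup_series0//.
  rewrite (ae_eq_integral (fun=> (f x)%:E)) => [|//||//|]; last 2 first.
  - exact/measurable_EFinP.
  - apply: filterS ok => w wok _; congr ((f _)%:E).
    have [w0 _ _] := wok; apply/funext => j.
    rewrite (finite_state_eq P w0 (regular_noise_finite wok))// (_ : ring_count _ j 0 = 0%N) ?if_same//.
    by apply: ring_count_eq => //; [exact: regular_noise_finite wok|rewrite ltW ?ring_gt0].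
  rewrite integral_cst//= [X in (_ * X)%E](_ : _ = 1%E) ?mule1//.
  exact: probability_setT.
have [M [ME ML]] := noise_product_law dn.
have law_gap jk B : measurable B -> driving_law E U (inl jk) B = exponential_prob 1 B.
  by case: jk => j k mB; case: dn => h _ _; exact: h.
have law_dice jk B : measurable B -> driving_law E U (inr jk) B = uniform_prob (@ltr01 R) B.
  by case: jk => j k mB; case: dn => _ h _; exact: h.
apply: (law_semigroup PT law_gap law_dice ML (measurable_noise E U) (fun B _ => ME B)) => //.
apply: filterS ok => w wok; have [w0 _ _] := wok; split => //.
exists (fun s => finite_state P F s x (noise w)) => //.
by apply: finite_state_evolution => //; exact: regular_noise_finite wok.
Qed.

Lemma measurable_semigroup (F : seq L) t f : uniq F -> 0 <= t -> measurable_fun setT f ->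
  unit_valued f -> measurable_fun setT (semigroup P F t f).
Proof.
move=> uF t0 mf f01; apply/measurable_EFinP.
rewrite (_ : _ \o _ = fun x => (\int[Pr]_w (f (finite_state P F t x (noise w)))%:E)%E).
  apply: (@measurable_fun_fubini_tonelli_F _ _ _ _ _ Pr
    (fun z : config * T => (f (finite_state P F t z.1 (noise z.2)))%:E)).
    apply/measurable_EFinP; apply: (measurableT_comp mf).
    apply: (measurable_finite_state (s := fun=> t) (x := fst)
      (w := fun z => noise z.2) P Nfin F) => //.
    exact: (measurableT_comp (measurable_noise E U) measurable_snd).
  by move=> z; rewrite lee_fin unit_valued_ge0.
by apply/funext => x /=; rewrite semigroupE// finite_law.
Qed.

Lemma measurable_mean_state t f : measurable_fun setT f -> unit_valued f ->
  measurable_fun setT (mean_state t f).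
Proof.
move=> mf f01; apply/measurable_EFinP.
rewrite (_ : _ \o _ = fun x => (\int[Pr]_w (f (full_state P t x (noise w)))%:E)%E).
  apply: (@measurable_fun_fubini_tonelli_F _ _ _ _ _ Pr
    (fun z : config * T => (f (full_state P t z.1 (noise z.2)))%:E)).
    apply/measurable_EFinP; apply: (measurableT_comp mf).
    apply: (measurable_full_state (s := fun=> t) (x := fst)
      (w := fun z => noise z.2) P Nfin) => //.
    exact: (measurableT_comp (measurable_noise E U) measurable_snd).
  by move=> z; rewrite lee_fin unit_valued_ge0.
by apply/funext => x /=; rewrite mean_stateE.
Qed.

Lemma integral_evolve (mu : probability config R) t f : 0 <= t -> measurable_fun setT f ->
  unit_valued f ->
  (\int[evolve E U P mu t]_x (f x)%:E = \int[mu]_x (mean_state t f x)%:E)%E.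
Proof.
move=> t0 mf f01.
have mz : measurable_fun setT (fun z : config * T => full_state P t z.1 (noise z.2)).
  apply: (measurable_full_state (s := fun=> t) (x := fst)
    (w := fun z => noise z.2) P Nfin) => //.
  exact: (measurableT_comp (measurable_noise E U) measurable_snd).
rewrite (ge0_integral_image_law (m := (mu \x Pr)%E) mz); last 3 first.
- by move=> B mB; exact: evolve_spec.
- exact/measurable_EFinP.
- by move=> x; rewrite lee_fin unit_valued_ge0.
rewrite fubini_tonelli1; last 2 first.
- by apply/measurable_EFinP; exact: (measurableT_comp mf mz).
- by move=> z; rewrite lee_fin unit_valued_ge0.
by apply: eq_integral => x _; rewrite mean_stateE.
Qed.

Definition window_cvg (xs : nat -> config) x := forall m, exists n0, forall n, (n0 <= n)%N ->
  map (xs n) (sites L m) = map x (sites L m).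

(** The initial configuration may vary with the volume. This is what allows the limit to pass
    through the composition of two semigroups in mean_state_add. *)
Lemma semigroup_cvg t f (r : seq L) xs x : 0 <= t -> local_fun r f -> unit_valued f ->
  window_cvg xs x -> semigroup P (sites L n) t f (xs n) @[n --> \oo] --> mean_state t f x.
Proof.
move=> t0 rf f01 xsx; have mf := measurable_local_fun rf.
rewrite (_ : (fun n => _) = fun n => fine (\int[Pr]_w
    (f (finite_state P (sites L n) t (xs n) (noise w)))%:E)%E); last first.
  by apply/funext => n; rewrite finite_law// sites_uniq.
apply: unit_integral_fine_cvg => //.
- by move=> n; apply: (measurableT_comp mf); exact: measurable_finite_noise.
- exact: (measurableT_comp mf (measurable_full_noise _ _)).
apply: filterS (ae_regular_noise dn cs) => w wok.
have [n0 hn0] := settled_window P Nfin t r wok.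
have [n1 hn1] := xsx n0.
apply: cvg_near_cst; near=> n; apply: rf.
have nn0 : (n0 <= n)%N by near: n; exact: nbhs_infty_ge.
have nn1 : (n1 <= n)%N by near: n; exact: nbhs_infty_ge.
exact: hn0 nn0 (hn1 n nn1).
Unshelve. all: end_near. Qed.

Lemma mean_state_add s t f (r : seq L) x : 0 <= s -> 0 <= t -> local_fun r f ->
  unit_valued f -> mean_state (s + t) f x = mean_state s (mean_state t f) x.
Proof.
move=> s0 t0 rf f01; have mf := measurable_local_fun rf.
have cst_cvg : window_cvg (fun=> x) x by move=> m; exists 0%N.
have c1 := semigroup_cvg (addr_ge0 s0 t0) rf f01 cst_cvg.
suff c2 : semigroup P (sites L n) (s + t) f x @[n --> \oo] --> mean_state s (mean_state t f) x.
  exact: (cvg_unique _ c1 c2).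
rewrite (_ : (fun n => _) = fun n => fine (\int[Pr]_w
    (semigroup P (sites L n) t f (finite_state P (sites L n) s x (noise w)))%:E)%E); last first.
  apply/funext => n; rewrite semigroup_add// finite_law ?sites_uniq//.
    by apply: measurable_semigroup => //; exact: sites_uniq.
  exact: unit_valued_semigroup.
apply: unit_integral_fine_cvg.
- move=> n; apply: (measurableT_comp (measurable_semigroup (sites_uniq L n) t0 mf f01)).
  exact: measurable_finite_noise.
- apply: (measurableT_comp (measurable_mean_state t mf f01)).
  exact: measurable_full_noise.
- by move=> n w; exact: unit_valued_semigroup.
- by move=> w; exact: unit_valued_mean_state.
apply: filterS (ae_regular_noise dn cs) => w wok.
apply: (semigroup_cvg t0 rf f01) => m.
have [n0 hn0] := settled_window P Nfin s (sites L m) wok.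
by exists n0 => n nn; exact: hn0.
Qed.

Lemma mean_state_monotone t f (r : seq L) x y : weakly_monotone P -> 0 <= t ->
  local_fun r f -> unit_valued f -> (forall y z, config_le y z -> f y <= f z) ->
  config_le x y -> mean_state t f x <= mean_state t f y.
Proof.
move=> PM t0 rf f01 fm xy.
have cst_cvg z : window_cvg (fun=> z) z by move=> m; exists 0%N.
apply: (ler_cvg_to (semigroup_cvg t0 rf f01 (cst_cvg x)) (semigroup_cvg t0 rf f01 (cst_cvg y))).
by apply: nearW => n; exact: semigroup_monotone.
Qed.

(** The Feller property. Two initial configurations that agree on the n-th window almost surely
    lead to the same values of f at time t once n is large; dominated convergence excludes a
    sequence of pairs whose images stay apart. *)
Lemma mean_state_window_continuous t f (r : seq L) : 0 <= t -> local_fun r f -> unit_valued f ->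
  window_continuous (mean_state t f).
Proof.
move=> t0 rf f01 e e0; have mf := measurable_local_fun rf.
apply: contrapT => none.
have {}none m : exists yz : config * config,
    map yz.1 (sites L m) = map yz.2 (sites L m) /\
    e < `|mean_state t f yz.1 - mean_state t f yz.2|.
  apply: contrapT => h; apply: none; exists m => y z yz.
  by rewrite leNgt; apply/negP => h'; apply: h; exists (y, z).
have [xs hxs] := choice none.
pose st x w := f (full_state P t x (noise w)).
pose g n w := `|st (xs n).1 w - st (xs n).2 w|.
have mst x : measurable_fun setT (st x).
  exact: (measurableT_comp mf (measurable_full_noise _ _)).
have mg n : measurable_fun setT (g n).
  by apply: measurableT_comp => //; exact: measurable_funB.
have g01 n w : 0 <= g n w <= 1.
  rewrite normr_ge0/= ler_norml; have /andP[a b] := f01 (full_state P t (xs n).1 (noise w)).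
  have /andP[c d'] := f01 (full_state P t (xs n).2 (noise w)).
  by rewrite /st; apply/andP; split; lra.
have : fine (\int[Pr]_w (g n w)%:E)%E @[n --> \oo] --> fine (\int[Pr]_w 0%:E)%E.
  apply: unit_integral_fine_cvg => //; first by move=> w; rewrite lexx ler01.
  apply: filterS (ae_regular_noise dn cs) => w wok.
  have [n0 hn0] := full_state_local P Nfin t r wok.
  apply: cvg_near_cst; near=> n.
  suff E' : st (xs n).1 w = st (xs n).2 w by rewrite /g E' subrr normr0.
  apply: rf; apply: hn0.
  have nn0 : (n0 <= n)%N by near: n; exact: nbhs_infty_ge.
  exact: agree_sites nn0 (hxs n).1.
rewrite integral0 => /cvgrPdist_lt/(_ e e0) [n _ /(_ n (leqnn n))].
rewrite /= sub0r normrN => lt_e.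
have bnd x y : st x = st (xs n).1 /\ st y = st (xs n).2 \/ st x = st (xs n).2 /\ st y = st (xs n).1 ->
    mean_state t f x <= mean_state t f y + fine (\int[Pr]_w (g n w)%:E)%E.
  move=> xy; rewrite -lee_fin EFinD !mean_stateE// fineK; last exact: unit_integral_fin.
  have st0 z w : 0 <= st z w by exact: unit_valued_ge0.
  rewrite -ge0_integralD//; last 4 first.
  - by move=> w _; rewrite lee_fin; exact: st0.
  - by apply/measurable_EFinP; exact: mst.
  - by move=> w _; rewrite lee_fin; have /andP[] := g01 n w.
  - exact/measurable_EFinP.
  apply: ge0_le_integral => //.
  - by move=> w _; rewrite lee_fin; exact: st0.
  - by apply/measurable_EFinP; exact: mst.
  - by apply: emeasurable_funD; apply/measurable_EFinP; [exact: mst|exact: mg].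
  - move=> w _; rewrite -EFinD lee_fin -/(st x w) -/(st y w) -lerBlDl.
    by case: xy => -[-> ->]; rewrite /g ?ler_norm// distrC ler_norm.
have [_ he] := hxs n; move: lt_e; apply/negP; rewrite -leNgt ger0_norm; last first.
  by rewrite fine_ge0//; have /andP[] := unit_integral_itv Pr (mg n) (g01 n).
apply: le_trans (ltW he) _; rewrite ler_norml lerBlDl bnd/=; last by left.
by rewrite lerNl opprB lerBlDl bnd//; right.
Unshelve. all: end_near. Qed.

End limit_semigroup.

(** * Probability measures on configurations *)

Section local_algebra.
Context (L : countType) dA (A : finTBOrderType dA).

(** A copy of the space of configurations which carries the algebra of local sets, in order that
    Caratheodory's theorem can be applied to it. *)
Definition local_config : Type := config L A.

HB.instance Definition _ := Pointed.on local_config.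

Lemma setU_local : setU_closed (@is_local L dA A).
Proof. by move=> B C; exact: is_localU. Qed.

Lemma setC_local : setC_closed (@is_local L dA A).
Proof. by move=> B; exact: is_localC. Qed.

HB.instance Definition _ := @isAlgebraOfSets.Build default_measure_display local_config
  (@is_local L dA A) (@is_local0 L dA A) setU_local setC_local.

End local_algebra.

Section caratheodory.
Context (R : realType) (L : countType) dA (A : finTBOrderType dA).
Local Notation config := (config L A).
Local Notation is_local := (@is_local L dA A).

Lemma local_measure_unique (mu nu : probability config R) :
  (forall B, is_local B -> mu B = nu B) -> same_measure mu nu.
Proof.
move=> mn B mB; apply: (@measure_unique _ _ config is_local (fun=> setT)) => //.
- apply/seteqP; split => C mC.
    apply: (smallest_sub _ _ mC); first exact: smallest_sigma_algebra.
    by move=> _ [j [a ->]]; apply: sub_sigma_algebra; exact: (is_local_site j [set a]).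
  apply: (smallest_sub _ _ mC); first exact: smallest_sigma_algebra.
  by move=> D /is_local_measurable.
- by move=> C D; exact: is_localI.
- by move=> _; rewrite -setC0; apply: is_localC; exact: is_local0.
- by rewrite bigcup_const.
- by move=> _; rewrite (le_lt_trans (probability_le1 _ _)) ?ltry.
Qed.

Lemma local_bigsetU (F : nat -> set config) n : (forall i, is_local (F i)) ->
  is_local (\big[setU/set0]_(i < n) F i).
Proof. by move=> lF; apply: big_ind => //; [exact: is_local0|exact: is_localU]. Qed.

(** By compactness a local set that is the union of disjoint local sets is the union of finitely
    many of them. Hence finite additivity on local sets is already countable additivity, and
    Caratheodory's theorem provides the measure, together with its expression as an infimum
    over coverings by local sets. *)
Lemma local_extension (p : set config -> \bar R) :
  (forall B, 0 <= p B)%E -> p set0 = 0%E -> p setT = 1%E ->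
  (forall B C, is_local B -> is_local C -> B `&` C = set0 -> p (B `|` C) = (p B + p C)%E) ->
  exists mu : probability config R, (forall B, is_local B -> mu B = p B) /\
    forall B, mu B = @mu_ext _ (local_config L A) R p B.
Proof.
move=> p_ge0 p0 pT padd.
have psum (F : nat -> set config) n : (forall i, is_local (F i)) -> trivIset setT F ->
    (\sum_(0 <= i < n) p (F i) = p (\big[setU/set0]_(i < n) F i))%E.
  move=> lF tF; elim: n => [|n IH]; first by rewrite big_nil big_ord0 p0.
  rewrite big_nat_recr//= IH big_ord_recr padd//; first exact: local_bigsetU.
  rewrite -bigcup_mkord; apply/seteqP; split => // x [[i /= im Fi] Fn].
  have e : i = n by apply: tF => //; exists x.
  by move: im; rewrite e ltnn.
have padd_sigma : @semi_sigma_additive _ R (local_config L A) p.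
  move=> F lF tF lU.
  (* what the first n sets leave uncovered *)
  pose C n := (\bigcup_i F i) `\` \big[setU/set0]_(i < n) F i.
  have [n Cn] : exists n, C n = set0.
    apply: contrapT => none; have [|||x Cx] := @local_compact _ _ _ C.
    - by move=> n; apply: is_localD => //; exact: local_bigsetU.
    - by move=> n; apply: setDS; rewrite big_ord_recr; left.
    - by move=> n; apply/set0P/eqP => Cn; apply: none; exists n.
    have [[i _ Fi] _] := Cx 0%N Logic.I.
    have [_ []] := Cx i.+1 Logic.I.
    by rewrite big_ord_recr; right.
  apply: cvg_near_cst; near=> k; rewrite psum//; congr p.
  have nk : (n <= k)%N by near: k; exact: nbhs_infty_ge.
  apply/seteqP; split; first by rewrite -bigcup_mkord => x [i _ Fi]; exists i.
  move=> x Ux; apply: contrapT => nx; suff : C n x by rewrite Cn.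
  split => //; apply: contra_not nx; rewrite -!bigcup_mkord => -[i /= im Fi].
  by exists i => //=; exact: leq_trans nk.
pose mixin := isMeasure.Build _ (local_config L A) R p p0 p_ge0 padd_sigma.
pose m : {measure set (local_config L A) -> \bar R} := HB.pack (p : set (local_config L A) -> \bar R) mixin.
have ml B : is_local B -> @mu_ext _ (local_config L A) R p B = p B.
  exact: (@measurable_mu_extE _ R (local_config L A) m).
have sub (B : set config) : measurable B -> <<s is_local >> B.
  apply: smallest_sub; first exact: smallest_sigma_algebra.
  by move=> _ [j [a ->]]; apply: sub_sigma_algebra; exact: (is_local_site j [set a]).
pose q (B : set config) := @mu_ext _ (local_config L A) R p B.
have q0 : q set0 = 0%E by exact: (measure0 (measure_extension m)).
have q_ge0 B : (0 <= q B)%E by exact: (measure_ge0 (measure_extension m)).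
have q_sigma : semi_sigma_additive q.
  move=> F mF tF mU.
  exact: (@measure_semi_sigma_additive _ _ _ (measure_extension m) F
    (fun i => sub _ (mF i)) tF (sub _ mU)).
pose mixinq := isMeasure.Build _ config R q q0 q_ge0 q_sigma.
pose mq : {measure set config -> \bar R} := HB.pack q mixinq.
have qT : mq setT = 1%E.
  by rewrite /= /q ml ?pT// -setC0; apply: is_localC; exact: is_local0.
pose mixinP := Measure_isProbability.Build _ _ _ mq qT.
pose mu : probability config R := HB.pack q mixinq mixinP.
by exists mu.
Unshelve. all: end_near. Qed.

(** A probability measure is the extension of its own restriction to local sets, hence is the
    infimum over coverings. *)
Lemma local_cover (nu : probability config R) (B : set config) (e : R) : 0 < e ->
  measurable B -> exists F : nat -> set config,
    [/\ forall n, is_local (F n), B `<=` \bigcup_n F n &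
        (\sum_(n <oo) nu (F n) <= nu B + e%:E)%E].
Proof.
move=> e0 mB.
have [||||mu [mul muE]] := @local_extension nu.
- by move=> C; exact: measure_ge0.
- exact: measure0.
- exact: probability_setT.
- by move=> C D lC lD CD; apply: measureU => //; exact: is_local_measurable.
have mn : nu B = @mu_ext _ (local_config L A) R nu B.
  by rewrite -muE; apply: local_measure_unique => // C lC; rewrite mul.
have fin : @mu_ext _ (local_config L A) R nu B \is a fin_num by rewrite -mn; exact: fin_num_measure.
have [_ [F [lF BF] <-] /ltW h] := lb_ereal_inf_adherent e0 fin.
by exists F; split => //; rewrite mn.
Qed.

Definition up_closure (B : set config) := [set x | exists2 y, B y & config_le y x].

Lemma local_up_closure B : is_local B -> is_local (up_closure B).
Proof.
move=> [m lB]; exists m => x x' xx' [y By yx].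
exists (fun j => if j \in sites L m then y j else x' j).
  by apply: lB By; apply/eq_in_map => j ->.
move=> j; case: ifP => // jm; rewrite (le_trans (yx j))//.
by have /eq_in_map/(_ j jm) -> := xx'.
Qed.

Lemma increasing_up_closure B : increasing (up_closure B).
Proof.
by move=> x z [y By yx] xz; exists y => // j; exact: le_trans (yx j) (xz j).
Qed.

(** Up to a small mass, an increasing event B contains a closed set, the intersection of a
    decreasing sequence of local sets K n. The up-closures of the K n are increasing and local,
    and by compactness their intersection still lies in B. *)
Lemma local_dominates (mu nu : probability config R) :
  (forall B, is_local B -> increasing B -> (mu B <= nu B)%E) -> stoch_dominates nu mu.
Proof.
move=> h B [mB iB]; apply/lee_addgt0Pr => e e0.
have [F [lF BF sF]] := local_cover mu e0 (measurableC mB).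
pose K n := ~` \big[setU/set0]_(i < n) F i.
have lK n : is_local (K n) by apply: is_localC; exact: local_bigsetU.
have dK n : K n.+1 `<=` K n by apply: subsetC; rewrite big_ord_recr; left.
have dKm m n : (m <= n)%N -> K n `<=` K m.
  by move=> /subnK <-; elim: (n - m)%N => // k IH; rewrite addSn; exact: subset_trans (dK _) IH.
have mU : measurable (\bigcup_n F n) by apply: bigcup_measurable => n _; exact: is_local_measurable.
have KB : \bigcap_n up_closure (K n) `<=` B.
  (* the points of K n that are below x as far as the first n sites can tell *)
  move=> x Kx; pose C n := K n `&` [set y | forall j, j \in sites L n -> (y j <= x j)%O].
  have [|||y Cy] := @local_compact _ _ _ C.
  - move=> n; apply: is_localI => //; exists n => y z /eq_in_map yz Cy j jn.
    by rewrite -yz// Cy.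
  - move=> n y [Ky Cy]; split; first exact: dK.
    by move=> j jn; apply: Cy; move: jn; rewrite !mem_sites => /leqW.
  - by move=> n; have [y Ky yx] := Kx n Logic.I; exists y; split => // j _; exact: yx.
  apply: (iB y) => [|j].
    apply: contrapT => /BF [n _ Fn]; have [Ky _] := Cy n.+1 Logic.I.
    by apply: Ky; rewrite big_ord_recr; right.
  have [_] := Cy (choice.pickle j).+1 Logic.I.
  by apply; rewrite mem_sites.
have mK n : measurable (up_closure (K n)) := is_local_measurable (local_up_closure (lK n)).
have muK n : (mu B <= nu (up_closure (K n)) + e%:E)%E.
  apply: (@le_trans _ _ (mu (K n) + e%:E)%E); last first.
    rewrite leeD2r//; apply: le_trans (h _ (local_up_closure (lK n)) (@increasing_up_closure _)).
    by apply: le_measure; rewrite ?inE//; [exact: (is_local_measurable (lK n))|move=> x Kx; exists x].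
  have : (mu (~` K n) <= mu (~` B) + e%:E)%E.
    apply: le_trans sF; apply: (@le_trans _ _ (mu (\bigcup_n F n))).
      apply: le_measure; rewrite ?inE//; first exact: (measurableC (is_local_measurable (lK n))).
      by rewrite setCK -bigcup_mkord => x [i _ Fi]; exists i.
    apply: measure_sigma_subadditive => // i; exact: is_local_measurable.
  rewrite (probability_setC mu mB) (probability_setC mu (is_local_measurable (lK n))).
  rewrite -(fineK (fin_num_measure mu _ mB)).
  rewrite -(fineK (fin_num_measure mu _ (is_local_measurable (lK n)))).
  by rewrite -?EFinD ?lee_fin => ?; lra.
have cK : nu \o (fun n => up_closure (K n)) @ \oo --> nu (\bigcap_n up_closure (K n)).
  apply: nonincreasing_cvg_mu => //.
  - by rewrite (le_lt_trans (probability_le1 _ _)) ?ltry.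
  - exact: bigcap_measurable.
  - move=> m n mn; apply/subsetPset => x [y Ky yx]; exists y => //; exact: dKm Ky.
apply: (@le_trans _ _ (nu (\bigcap_n up_closure (K n)) + e%:E)%E); last first.
  by rewrite leeD2r// le_measure// inE//; exact: bigcap_measurable.
rewrite -leeBlDr//; apply: (lee_cvg_to (cvg_cst _) cK); apply: nearW => n /=.
by rewrite EFinN leeBlDr.
Qed.

End caratheodory.

(** * Limits of probability measures on configurations *)

Section limits.
Context (R : realType) (L : countType) dA (A : finTBOrderType dA).
Local Notation config := (config L A).
Local Notation is_local := (@is_local L dA A).
Implicit Types (mu nu : probability config R) (law : R -> probability config R).

Lemma fine_probabilityD mu (B C : set config) : measurable B -> measurable C -> C `<=` B ->
  fine (mu (B `\` C)) = fine (mu B) - fine (mu C).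
Proof.
move=> mB mC CB; rewrite measureD//; last by rewrite (le_lt_trans (probability_le1 _ _)) ?ltry.
by rewrite setIidr// fineB// fin_num_measure.
Qed.

Lemma fine_probabilityU mu (B C : set config) : measurable B -> measurable C -> B `&` C = set0 ->
  fine (mu (B `|` C)) = fine (mu B) + fine (mu C).
Proof. by move=> mB mC BC; rewrite measureU// fineD// fin_num_measure. Qed.

Lemma fine_probability_itv mu (B : set config) : measurable B -> 0 <= fine (mu B) <= 1.
Proof.
move=> mB; rewrite fine_ge0//= -lee_fin fineK ?fin_num_measure//.
exact: probability_le1.
Qed.

Lemma local_cvg law mu :
  (forall B, is_local B -> increasing B -> fine (law t B) @[t --> +oo] --> fine (mu B)) ->
  forall B, is_local B -> fine (law t B) @[t --> +oo] --> fine (mu B).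
Proof.
move=> h; apply: (increasing_induction (Phi := fun B =>
  fine (law t B) @[t --> +oo] --> fine (mu B))) => // B C lB lC BC cB cC;
  have mB := is_local_measurable lB; have mC := is_local_measurable lC.
- rewrite fine_probabilityD//; under eq_fun do rewrite fine_probabilityD//.
  exact: cvgB.
- rewrite fine_probabilityU//; under eq_fun do rewrite fine_probabilityU//.
  exact: cvgD.
Qed.

(** The limits extend from increasing to all local events by increasing_induction, are finitely
    additive there, and so define a probability measure. *)
Lemma local_limit law :
  (forall B, is_local B -> increasing B -> cvg (fine (law t B) @[t --> +oo])) ->
  exists mu, forall B, is_local B -> fine (law t B) @[t --> +oo] --> fine (mu B).
Proof.
move=> h.
have cv B : is_local B -> cvg (fine (law t B) @[t --> +oo]).
  move: B; apply: (increasing_induction (Phi := fun B =>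
    cvg (fine (law t B) @[t --> +oo]))) => // B C lB lC BC cB cC;
    have mB := is_local_measurable lB; have mC := is_local_measurable lC.
  - by under eq_fun do rewrite fine_probabilityD//; exact: is_cvgB.
  - by under eq_fun do rewrite fine_probabilityU//; exact: is_cvgD.
pose p B : \bar R := if `[< is_local B >] then (lim (fine (law t B) @[t --> +oo]))%:E else 0%E.
have pE B : is_local B -> p B = (lim (fine (law t B) @[t --> +oo]))%:E.
  by move=> lB; rewrite /p asboolT.
have lT : is_local setT by rewrite -setC0; apply: is_localC; exact: is_local0.
have [||||mu [mul _]] := @local_extension R L dA A p.
- move=> B; rewrite /p; case: asboolP => // lB; rewrite lee_fin.
  apply: limr_ge; first exact: cv.
  by apply: nearW => t; have /andP[] := fine_probability_itv (law t) (is_local_measurable lB).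
- rewrite pE; last exact: is_local0.
  by under eq_fun do rewrite measure0; rewrite lim_cst.
- by rewrite pE//; under eq_fun do rewrite probability_setT; rewrite lim_cst.
- move=> B C lB lC BC; rewrite !pE//; last exact: is_localU.
  have mB := is_local_measurable lB; have mC := is_local_measurable lC.
  under eq_fun do rewrite fine_probabilityU//.
  by rewrite -EFinD limD//; exact: cv.
by exists mu => B lB; rewrite mul// pE//; exact: cv.
Qed.

Definition frozen_outside m (x : config) : config := fun j => if j \in sites L m then x j else \bot%O.

Lemma frozen_outside_sites m x : map (frozen_outside m x) (sites L m) = map x (sites L m).
Proof. by apply/eq_in_map => j jm; rewrite /frozen_outside jm. Qed.

Lemma frozen_outside_local m (f : config -> R) : local_fun (sites L m) (f \o frozen_outside m).
Proof.
move=> y z /eq_in_map yz; rewrite /=; congr f; apply/funext => j.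
by rewrite /frozen_outside; case: ifP => // /yz.
Qed.

(** The coefficient c is the value of g at any configuration with the prescribed letters. *)
Lemma local_fun_sum m (g : config -> R) : local_fun (sites L m) g ->
  exists c : (size (sites L m)).-tuple A -> R, forall x,
    g x = \sum_(t : (size (sites L m)).-tuple A) c t * \1_[set y : config | map y (sites L m) = t] x.
Proof.
move=> lg; exists (fun t => g (get [set y : config | map y (sites L m) = t])) => x.
rewrite (bigD1 (map_tuple x (in_tuple (sites L m))))//= big1 ?addr0.
  rewrite indicE mem_set// mulr1; apply: lg.
  by have := @getPex _ [set y : config | map y (sites L m) = map x (sites L m)] (ex_intro _ x erefl).
move=> t tx; rewrite indicE memNset ?mulr0// => /= xt.
suff e : t = map_tuple x (in_tuple (sites L m)) by rewrite e eqxx in tx.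
by apply: val_inj; rewrite /= xt.
Qed.

Lemma local_sum_cvg law mu m (g : config -> R) : local_fun (sites L m) g ->
  (forall B, is_local B -> fine (law t B) @[t --> +oo] --> fine (mu B)) ->
  (\int[law t]_x g x)%R @[t --> +oo] --> (\int[mu]_x g x)%R.
Proof.
move=> lg cv; have [c gE] := local_fun_sum lg.
pose S (t : (size (sites L m)).-tuple A) := [set y : config | map y (sites L m) = t].
have lS t : is_local (S t) by exists m => y z yz; rewrite /S /= yz.
have mS t : measurable (S t) := is_local_measurable (lS t).
have gI nu : (\int[nu]_x g x)%R = \sum_t c t * fine (nu (S t)).
  rewrite /Rintegral.
  rewrite (eq_integral (fun x => \sum_t (c t * \1_(S t) x)%:E)%E); last first.
    by move=> x _; rewrite gE sumEFin.
  have iS t : nu.-integrable setT (fun x => (\1_(S t) x)%:E).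
    exact: integrable_indic.
  rewrite (@integral_sum _ _ _ nu setT measurableT _ (fun t x => (c t * \1_(S t) x)%:E)).
    rewrite (eq_bigr (fun t => (c t * fine (nu (S t)))%:E)) ?sumEFin// => t _.
    under eq_integral do rewrite EFinM.
    by rewrite integralZl// integral_indic// setIT EFinM fineK// fin_num_measure.
  move=> t; rewrite (_ : (fun x => _) = (fun x => (c t)%:E * (\1_(S t) x)%:E)%E) //.
  exact: integrableZl.
rewrite gI; under eq_fun do rewrite gI.
elim: (index_enum _) => [|t r IH].
  by rewrite big_nil; under eq_fun do rewrite big_nil; exact: cvg_cst.
rewrite big_cons; under [X in X @ _]eq_fun do rewrite big_cons.
by apply: cvgD => //; apply: cvgMr; exact: cv.
Qed.

Lemma measurable_window_continuous (f : config -> R) : window_continuous f -> measurable_fun setT f.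
Proof.
move=> wf; apply: (@measurable_fun_cvg _ _ _ setT (fun n => f \o frozen_outside n)).
  by move=> n; exact: measurable_local_fun (frozen_outside_local (m := n) f).
move=> x _; apply/cvgrPdist_le => e e0; have [m hm] := wf e e0.
exists m => // n /= mn; apply: hm; apply: agree_sites mn _.
by rewrite frozen_outside_sites.
Qed.

(** Up to a uniformly small error, f depends on finitely many sites and takes finitely many
    values. *)
Lemma window_integral_cvg law mu (f : config -> R) M : window_continuous f ->
  (forall x, `|f x| <= M) ->
  (forall B, is_local B -> fine (law t B) @[t --> +oo] --> fine (mu B)) ->
  (\int[law t]_x (f x)%:E)%E @[t --> +oo] --> (\int[mu]_x (f x)%:E)%E.
Proof.
move=> wf fM cv; have mf := measurable_window_continuous wf.
have int (g : config -> R) nu : measurable_fun setT g -> (forall x, `|g x| <= M) ->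
    nu.-integrable setT (EFin \o g).
  move=> mg gM; apply: measurable_bounded_integrable => //.
    by rewrite (le_lt_trans (probability_le1 _ _)) ?ltry.
  by exists M; split; [rewrite num_real|move=> K MK x _; exact: le_trans (gM x) (ltW MK)].
have fI nu : (\int[nu]_x (f x)%:E = (\int[nu]_x f x)%R%:E)%E.
  by rewrite /Rintegral fineK//; apply: integrable_fin_num => //; exact: int.
rewrite fI; under eq_fun do rewrite fI.
apply: cvg_EFin; first exact: nearW.
apply/cvgrPdist_le => e e0.
have e3 : 0 < e / 3 by rewrite divr_gt0.
have [m hm] := wf _ e3.
pose g := f \o frozen_outside m.
have lg := frozen_outside_local (m := m) f.
have mg := measurable_local_fun lg.
have gM x : `|g x| <= M by exact: fM.
have fg nu : `|(\int[nu]_x f x)%R - (\int[nu]_x g x)%R| <= e / 3.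
  have ifg := int f nu mf fM; have ig := int g nu mg gM.
  have id : nu.-integrable setT (EFin \o (fun x => f x - g x)) by exact: (integrableB measurableT ifg ig).
  rewrite -RintegralB//; apply: le_trans (le_normr_Rintegral _ _) _ => //.
  apply: (@le_trans _ _ (\int[nu]_x (e / 3))%R); last first.
    rewrite Rintegral_cst// [X in fine X](_ : _ = 1%E) ?mulr1//; exact: probability_setT.
  apply: le_Rintegral => //.
  - exact: integrable_norm.
  - exact: finite_measure_integrable_cst.
  - by move=> x _; apply: hm; rewrite frozen_outside_sites.
have /cvgrPdist_le/(_ _ e3) := local_sum_cvg (g := g) lg cv.
apply: filterS => t gt /=.
move: gt (fg mu) (fg (law t)); set a := (\int[mu]_x g x)%R; set b := (\int[law t]_x g x)%R.
move: a b (\int[mu]_x f x)%R (\int[law t]_x f x)%R => a b a' b'.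
by rewrite !ler_norml => /andP[? ?] /andP[? ?] /andP[? ?]; apply/andP; split; lra.
Qed.

End limits.

(** * Monotone evolution from the extreme configurations *)

Section monotone_limit.
Context (R : realType).

Lemma nonincreasing_cvg_pinfty (f : R -> R) :
  (forall s t, 0 <= s -> s <= t -> f t <= f s) -> (forall t, 0 <= t -> 0 <= f t) ->
  cvg (f t @[t --> +oo]).
Proof.
move=> df f0; pose S := [set f t | t in [set t | 0 <= t]].
have lS : has_inf S.
  split; first by exists (f 0), 0 => /=.
  by exists 0 => _ [t t0 <-]; exact: f0.
apply/cvg_ex; exists (inf S); apply/cvgrPdist_le => e e0.
have [_ [s s0 <-] fs] := inf_adherent e0 lS.
near=> t; have st : s <= t by near: t; apply: nbhs_pinfty_ge; rewrite num_real.
have t0 : 0 <= t by exact: le_trans st.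
have le1 : inf S <= f t by apply: ge_inf; [exact: lS.2|exists t].
by rewrite distrC ger0_norm ?subr_ge0// lerBlDl ltW// (le_lt_trans (df _ _ s0 st)).
Unshelve. all: end_near. Qed.

End monotone_limit.

Section assembly.
Context (R : realType) d (T : measurableType d) (Pr : probability T R).
Context dA (A : finTBOrderType dA) (L : countType) (N : L -> set L).
Context (P : forall j : L, (N j -> A) -> A -> R).
Context (E U : L -> nat -> {RV Pr >-> R}).
Hypotheses (PT : is_transition_matrix P) (PM : weakly_monotone P).
Hypotheses (dn : driving_noise E U) (cs : causal E N).
Local Notation config := (config L A).
Local Notation is_local := (@is_local L dA A).
Local Notation Q := (mean_state P E U).
Local Notation cst_cfg a := (const_config a : config).
Local Notation law := (evolve E U P).
Local Notation law_const := (evolve_const E U P).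
Implicit Types (mu nu : probability config R) (f : config -> R) (B : set config) (s t : R).

Let chi B : config -> R := \1_B.

Let unit_chi B : unit_valued (chi B).
Proof. by move=> x; rewrite /chi indicE lern1 ler0n leq_b1. Qed.

Let local_chi m B : local_set (sites L m) B -> local_fun (sites L m) (chi B).
Proof.
move=> lB y z yz; rewrite /chi !indicE; congr (_%:R); congr (nat_of_bool _).
by apply/idP/idP; rewrite !inE; [exact: lB yz|exact: lB (esym yz)].
Qed.

Let monotone_chi B y z : increasing B -> config_le y z -> chi B y <= chi B z.
Proof.
move=> iB yz; have [By|nBy] := pselect (B y).
  by rewrite /chi !indicE (mem_set By) (mem_set (iB _ _ By yz)).
by rewrite {1}/chi indicE memNset//; have /andP[] := unit_chi B z.
Qed.

Let measurable_chi B : measurable B -> measurable_fun setT (chi B).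
Proof. exact: measurable_indic. Qed.

Lemma mean_state_le h f c x : measurable_fun setT f -> unit_valued f ->
  (forall y, f y <= c) -> Q h f x <= c.
Proof.
move=> mf f01 fc; rewrite -lee_fin (mean_stateE P dn cs)//.
apply: (@le_trans _ _ (\int[Pr]_w c%:E)%E); last first.
  by rewrite integral_cst// [X in (_ * X)%E](_ : _ = 1%E) ?mule1//; exact: probability_setT.
apply: ge0_le_integral => //.
- by move=> w _; rewrite lee_fin unit_valued_ge0.
- apply/measurable_EFinP; exact: (measurableT_comp mf (measurable_full_noise _ dn cs _ _)).
- by move=> w _; rewrite lee_fin.
Qed.

Lemma mean_state_ge h f c x : measurable_fun setT f -> unit_valued f -> 0 <= c ->
  (forall y, c <= f y) -> c <= Q h f x.
Proof.
move=> mf f01 c0 fc; rewrite -lee_fin (mean_stateE P dn cs)//.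
apply: (@le_trans _ _ (\int[Pr]_w c%:E)%E).
  by rewrite integral_cst// [X in (_ * X)%E](_ : _ = 1%E) ?mule1//; exact: probability_setT.
apply: ge0_le_integral => //.
- apply/measurable_EFinP; exact: (measurableT_comp mf (measurable_full_noise _ dn cs _ _)).
- by move=> w _; rewrite lee_fin.
Qed.

Lemma lawE mu t B : 0 <= t -> measurable B ->
  law mu t B = (\int[mu]_x (Q t (chi B) x)%:E)%E.
Proof.
move=> t0 mB; rewrite -(integral_evolve P dn cs)//; last exact: measurable_chi.
by rewrite /chi integral_indic// setIT.
Qed.

Lemma integral_law_const a t f : 0 <= t -> measurable_fun setT f -> unit_valued f ->
  (\int[law_const a t]_x (f x)%:E)%E = (Q t f (cst_cfg a))%:E.
Proof.
move=> t0 mf f01; rewrite /evolve_const (integral_evolve P dn cs)//.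
rewrite integral_dirac//; first by rewrite diracT mul1e.
by apply/measurable_EFinP; exact: measurable_mean_state.
Qed.

Lemma law_constE a t B : 0 <= t -> measurable B ->
  law_const a t B = (Q t (chi B) (cst_cfg a))%:E.
Proof.
move=> t0 mB; rewrite -integral_law_const//; last exact: measurable_chi.
by rewrite /chi integral_indic// setIT.
Qed.

Let fine_law_constE a t B : 0 <= t -> measurable B ->
  fine (law_const a t B) = Q t (chi B) (cst_cfg a).
Proof. by move=> t0 mB; rewrite law_constE. Qed.

Let bot_le x : config_le (cst_cfg \bot%O) x.
Proof. by move=> j; exact: le0x. Qed.

Let le_top x : config_le x (cst_cfg \top%O).
Proof. by move=> j; exact: lex1. Qed.

Let chi_between s B x : is_local B -> increasing B -> 0 <= s ->
  Q s (chi B) (cst_cfg \bot%O) <= Q s (chi B) x <= Q s (chi B) (cst_cfg \top%O).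
Proof.
move=> [m lB] iB s0; have lc := local_chi lB.
have mono y z : config_le y z -> Q s (chi B) y <= Q s (chi B) z.
  apply: (mean_state_monotone PT dn cs PM s0 lc (unit_chi B)) => y' z'.
  exact: monotone_chi.
by rewrite !mono.
Qed.

Let Q_unit s B : measurable B -> unit_valued (Q s (chi B)).
Proof. by move=> mB; apply: unit_valued_mean_state => //; exact: measurable_chi. Qed.

Let Q_measurable s B : measurable B -> measurable_fun setT (Q s (chi B)).
Proof. by move=> mB; apply: measurable_mean_state => //; exact: measurable_chi. Qed.

(** Running for the time t - s leads from the top configuration to a configuration below it,
    from which the remaining time s leads to a smaller expectation. *)
Lemma law_top_nonincreasing B s t : is_local B -> increasing B -> 0 <= s -> s <= t ->
  Q t (chi B) (cst_cfg \top%O) <= Q s (chi B) (cst_cfg \top%O).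
Proof.
move=> lB iB s0 st; have mB := is_local_measurable lB.
rewrite -(subrK s t) (mean_state_add PT dn cs _ _ s0 (local_chi (projT2 (cid lB))))//.
  apply: mean_state_le; [exact: Q_measurable|exact: Q_unit|move=> y].
  by case/andP: (chi_between y lB iB s0) => _ h; exact: h.
by rewrite subr_ge0.
Qed.

Lemma law_bot_nondecreasing B s t : is_local B -> increasing B -> 0 <= s -> s <= t ->
  Q s (chi B) (cst_cfg \bot%O) <= Q t (chi B) (cst_cfg \bot%O).
Proof.
move=> lB iB s0 st; have mB := is_local_measurable lB.
rewrite -(subrK s t) (mean_state_add PT dn cs _ _ s0 (local_chi (projT2 (cid lB))))//.
  apply: mean_state_ge; [exact: Q_measurable|exact: Q_unit|exact: (unit_valued_ge0 (Q_unit s mB))|].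
  by move=> y; case/andP: (chi_between y lB iB s0) => h _; exact: h.
by rewrite subr_ge0.
Qed.

(** Every initial configuration lies between the two constant ones. *)
Lemma fine_law_between mu t B : is_local B -> increasing B -> 0 <= t ->
  fine (law_const \bot%O t B) <= fine (law mu t B) <= fine (law_const \top%O t B).
Proof.
move=> lB iB t0; have mB := is_local_measurable lB.
have lE := lawE mu t0 mB.
have fin : (\int[mu]_x (Q t (chi B) x)%:E)%E \is a fin_num by rewrite -lE; exact: fin_num_measure.
rewrite lE.
have cst c : (\int[mu]_x c%:E = c%:E)%E.
  by rewrite integral_cst// [X in (_ * X)%E](_ : _ = 1%E) ?mule1//; exact: probability_setT.
have Qge0 := unit_valued_ge0 (Q_unit t mB).
have mQ : measurable_fun setT (fun x => (Q t (chi B) x)%:E).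
  by apply/measurable_EFinP; exact: Q_measurable.
apply/andP; split.
  rewrite [X in X <= _](fine_law_constE _ t0 mB) -lee_fin (fineK fin) -[X in (X <= _)%E]cst.
  apply: (@ge0_le_integral _ _ _ mu _ measurableT _ _ _ (measurable_cst _) mQ) => x _; rewrite lee_fin.
    exact: Qge0.
  by case/andP: (chi_between x lB iB t0) => h _; exact: h.
rewrite [X in _ <= X](fine_law_constE _ t0 mB) -lee_fin (fineK fin) -[X in (_ <= X)%E]cst.
apply: (@ge0_le_integral _ _ _ mu _ measurableT _ _ _ mQ (measurable_cst _)) => x _; rewrite lee_fin.
  exact: Qge0.
by case/andP: (chi_between x lB iB t0) => _ h; exact: h.
Qed.

Lemma local_cvg_weakly (mu_ : R -> probability config R) mu :
  (forall B, is_local B -> fine (mu_ t B) @[t --> +oo] --> fine (mu B)) ->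
  weakly_converges mu_ mu.
Proof.
move=> cv f cf [M [_ bf]].
apply: (@window_integral_cvg _ _ _ _ mu_ mu f (M + 1)) => //; first exact: continuous_window.
by move=> x; apply: bf => //; rewrite ltrDl.
Qed.

Lemma weakly_local_cvg (mu_ : R -> probability config R) mu : weakly_converges mu_ mu ->
  forall B, is_local B -> fine (mu_ t B) @[t --> +oo] --> fine (mu B).
Proof.
move=> wc B lB; have mB := is_local_measurable lB; have [m lBm] := lB.
have bc : bounded_fun (chi B).
  exists 1; split; first by rewrite num_real.
  move=> K K1 x _ /=; rewrite ger0_norm; last by have /andP[] := unit_chi B x.
  by apply: le_trans (ltW K1); have /andP[] := unit_chi B x.
have := wc _ (local_continuous (local_chi lBm)) bc.
have chiE nu : (\int[nu]_x (chi B x)%:E = nu B)%E by rewrite integral_indic// setIT.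
rewrite chiE; under eq_fun do rewrite chiE.
by move=> h; apply: fine_cvg; rewrite fineK ?fin_num_measure.
Qed.

Lemma law_top_dominates s t : 0 <= s -> s <= t ->
  stoch_dominates (law_const \top%O s) (law_const \top%O t).
Proof.
move=> s0 st; apply: local_dominates => B lB iB; have mB := is_local_measurable lB.
by rewrite (law_constE _ s0 mB) (law_constE _ (le_trans s0 st) mB) lee_fin; exact: law_top_nonincreasing.
Qed.

Lemma law_bot_dominates s t : 0 <= s -> s <= t ->
  stoch_dominates (law_const \bot%O t) (law_const \bot%O s).
Proof.
move=> s0 st; apply: local_dominates => B lB iB; have mB := is_local_measurable lB.
by rewrite (law_constE _ s0 mB) (law_constE _ (le_trans s0 st) mB) lee_fin; exact: law_bot_nondecreasing.
Qed.

Lemma exists_law_top_limit : exists mu, forall B, is_local B ->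
  fine (law_const \top%O t B) @[t --> +oo] --> fine (mu B).
Proof.
apply: local_limit => B lB iB; have mB := is_local_measurable lB.
apply: nonincreasing_cvg_pinfty => [s t s0 st|t t0].
  by rewrite (fine_law_constE _ s0 mB) (fine_law_constE _ (le_trans s0 st) mB); exact: law_top_nonincreasing.
by have /andP[] := fine_probability_itv (law_const \top%O t) mB.
Qed.

Lemma exists_law_bot_limit : exists mu, forall B, is_local B ->
  fine (law_const \bot%O t B) @[t --> +oo] --> fine (mu B).
Proof.
apply: local_limit => B lB iB; have mB := is_local_measurable lB.
have h : cvg (1 - fine (law_const \bot%O t B) @[t --> +oo]).
  apply: nonincreasing_cvg_pinfty => [s t s0 st|t t0].
    rewrite (fine_law_constE _ s0 mB) (fine_law_constE _ (le_trans s0 st) mB) lerD2l lerN2.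
    exact: law_bot_nondecreasing.
  by rewrite subr_ge0; have /andP[] := fine_probability_itv (law_const \bot%O t) mB.
rewrite (_ : (fun t => _) = fun t => 1 - (1 - fine (law_const \bot%O t B))).
  exact: is_cvgB (is_cvg_cst _) h.
by apply/funext => t; rewrite subKr.
Qed.

Section extreme_limits.
Variables mu_bot mu_top : probability config R.
Hypothesis cvg_bot : forall B, is_local B ->
  fine (law_const \bot%O t B) @[t --> +oo] --> fine (mu_bot B).
Hypothesis cvg_top : forall B, is_local B ->
  fine (law_const \top%O t B) @[t --> +oo] --> fine (mu_top B).

Lemma invariant_between nu B : invariant_law E U P nu -> is_local B -> increasing B ->
  fine (mu_bot B) <= fine (nu B) <= fine (mu_top B).
Proof.
move=> inv lB iB; have mB := is_local_measurable lB.
have bet : \forall t \near +oo,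
    fine (law_const \bot%O t B) <= fine (nu B) <= fine (law_const \top%O t B).
  near=> t; have t0 : 0 <= t by near: t; apply: nbhs_pinfty_ge; rewrite num_real.
  by rewrite -(inv t t0 B mB); exact: fine_law_between.
apply/andP; split.
  apply: (ler_cvg_to (cvg_bot lB) (cvg_cst _)).
  by apply: filterS bet => t /andP[].
apply: (ler_cvg_to (cvg_cst _) (cvg_top lB)).
by apply: filterS bet => t /andP[].
Unshelve. all: end_near. Qed.

Lemma invariant_dominates nu : invariant_law E U P nu ->
  stoch_dominates nu mu_bot /\ stoch_dominates mu_top nu.
Proof.
move=> inv; split; apply: local_dominates => B lB iB; have mB := is_local_measurable lB;
  rewrite -[X in (X <= _)%E]fineK ?fin_num_measure// -[X in (_ <= X)%E]fineK ?fin_num_measure// lee_fin;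
  by have /andP[] := invariant_between inv lB iB.
Qed.

(** Every law at time t is squeezed between the two extreme ones. *)
Lemma extreme_attractive : same_measure mu_bot mu_top -> attractive_law E U P mu_bot.
Proof.
move=> bt nu; apply: local_cvg_weakly; apply: local_cvg => B lB iB.
have mB := is_local_measurable lB.
apply: (squeeze_cvgr _ (cvg_bot lB)); last by rewrite bt//; exact: cvg_top.
near=> t; have t0 : 0 <= t by near: t; apply: nbhs_pinfty_ge; rewrite num_real.
exact: fine_law_between.
Unshelve. all: end_near. Qed.

(** By the Feller property the law at time s started from mu_bot is the limit of the laws at time
    t + s started from \bot, which is mu_bot again. *)
Lemma extreme_invariant : invariant_law E U P mu_bot.
Proof.
move=> s s0; apply: local_measure_unique => B lB; have mB := is_local_measurable lB.
have [m lBm] := lB.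
have wQ : window_continuous (Q s (chi B)).
  exact: (mean_state_window_continuous P dn cs s0 (local_chi lBm) (unit_chi B)).
have Qb x : `|Q s (chi B) x| <= 1.
  by rewrite ger0_norm; have /andP[] := Q_unit s mB x.
have := window_integral_cvg wQ Qb cvg_bot; rewrite -lawE// => c1.
have c2 : (\int[law_const \bot%O t]_x (Q s (chi B) x)%:E)%E @[t --> +oo] --> mu_bot B.
  have c3 : fine (law_const \bot%O (t + s) B) @[t --> +oo] --> fine (mu_bot B).
    by rewrite (cvg_shiftr s (fun t => fine (law_const \bot%O t B))); exact: cvg_bot.
  rewrite -[X in _ --> X]fineK ?fin_num_measure//.
  have c4 : (fine (law_const \bot%O (t + s) B))%:E @[t --> +oo] --> (fine (mu_bot B))%:E.
    by apply: cvg_EFin; [exact: nearW|exact: c3].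
  apply: cvg_trans c4.
  apply: near_eq_cvg; near=> t.
  have t0 : 0 <= t by near: t; apply: nbhs_pinfty_ge; rewrite num_real.
  rewrite integral_law_const//; [|exact: Q_measurable|exact: Q_unit].
  by rewrite (fine_law_constE _ (addr_ge0 t0 s0) mB) (mean_state_add PT dn cs _ t0 s0 (local_chi lBm)).
exact: cvg_unique c1 c2.
Unshelve. all: end_near. Qed.

Lemma extremes_coincide_ergodic : same_measure mu_bot mu_top <-> ergodic E U P.
Proof.
split => [bt|[mu [_ att]]].
  by exists mu_bot; split; [exact: extreme_invariant|exact: extreme_attractive].
apply: local_measure_unique => B lB; have mB := is_local_measurable lB.
suff : fine (mu_bot B) = fine (mu_top B).
  by move=> e; rewrite -[LHS]fineK ?fin_num_measure// e fineK// fin_num_measure.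
have att_cvg a : fine (law_const a t B) @[t --> +oo] --> fine (mu B).
  exact: (weakly_local_cvg (att _)).
transitivity (fine (mu B)); first exact: (cvg_unique _ (cvg_bot lB) (att_cvg _)).
exact: (cvg_unique _ (att_cvg _) (cvg_top lB)).
Qed.

End extreme_limits.

End assembly.

Theorem theorem5p8 (R : realType)
    (dA : Order.disp_t) (A : finTBOrderType dA)
    (L : countType) (N : L -> set L)
    (P : forall j : L, (N j -> A) -> A -> R)
    (d : measure_display) (T : measurableType d) (Pr : probability T R)
    (E U : L -> nat -> {RV Pr >-> R}) :
  is_lattice N ->
  is_transition_matrix P ->
  weakly_monotone P ->
  driving_noise E U ->
  causal E N ->
  (forall B : set (config L A), increasing_event B ->
     forall s t : R, 0 <= s -> s <= t ->
       (evolve_const E U P \top%O t B <= evolve_const E U P \top%O s B)%E /\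
       (evolve_const E U P \bot%O s B <= evolve_const E U P \bot%O t B)%E) /\
  exists mu_bot mu_top : probability (config L A) R,
    [/\ weakly_converges (evolve_const E U P \bot%O) mu_bot,
        weakly_converges (evolve_const E U P \top%O) mu_top,
        forall nu : probability (config L A) R, invariant_law E U P nu ->
          stoch_dominates nu mu_bot /\ stoch_dominates mu_top nu
      & same_measure mu_bot mu_top <-> ergodic E U P].
Proof.
move=> _ PT PM dn cs; split.
  move=> B iB s t s0 st; split.
    exact: (law_top_dominates PT PM dn cs s0 st iB).
  exact: (law_bot_dominates PT PM dn cs s0 st iB).
have [mu_bot cvg_bot] := exists_law_bot_limit PT PM dn cs.
have [mu_top cvg_top] := exists_law_top_limit PT PM dn cs.
exists mu_bot, mu_top; split.
- exact: local_cvg_weakly.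
- exact: local_cvg_weakly.
- by move=> nu inv; apply: (invariant_dominates PT PM dn cs).
- exact: (extremes_coincide_ergodic PT PM dn cs).
Qed.
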